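(* For $i=1,2$, assume that $\psi_i$ satisfies Assumption $\mathcal{H}^1$ and $0\leq\psi_i\leq\Phi$ with $\Phi$ satisfying Assumption $\mathcal{H}^2$. Let $u^i$ be the unique solution of the variational inequality (VI) with obstacle function $\psi_i$. Then: 1. If $\psi_1\leq\psi_2$, then $u^1\leq u^2$. 2. If $\psi_1-\psi_2\in L^\infty$, then $u^1-u^2\in L^\infty$ and $\|u^1-u^2\|_\infty\leq\|\psi_1-\psi_2\|_\infty$.
   Context: Fixed parameters: $\kappa,\theta,\sigma>0$, $\rho\in(-1,1)$, $T>0$, $\gamma>0$, $\mu>0$, $\beta=\frac{2\kappa\theta}{\sigma^2}$. Let $\mathcal{O}=\mathbb{R}\times(0,\infty)$ and for $\mu'>0$ let $\mathfrak{m}_{\gamma,\mu'}(dx,dy)=y^{\beta-1}e^{-\gamma|x|-\mu' y}\,dx\,dy$; write $\mathfrak{m}=\mathfrak{m}_{\gamma,\mu}$. Spaces (derivatives in the sense of distributions): $H=L^2(\mathcal{O},\mathfrak{m})$ with inner product $(\cdot,\cdot)_H$; $V=\{u\in H:\sqrt{1+y}\,u,\ \sqrt{y}|\nabla u|\in H\}$ with $\|u\|_V^2=\int_{\mathcal{O}}(y|\nabla u|^2+(1+y)u^2)\,d\mathfrak{m}$; $H^2(\mathcal{O},\mathfrak{m})=\{u\in H:\sqrt{1+y}\,u,\ (1+y)|\nabla u|,\ y|D^2u|\in H\}$ with $\|u\|^2_{H^2(\mathcal{O},\mathfrak{m})}=\int_{\mathcal{O}}(y^2|D^2u|^2+(1+y)^2|\nabla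 u|^2+(1+y)u^2)\,d\mathfrak{m}$. For a normed space $E$ of functions on $\mathcal{O}$, $L^p([0,T];E)$ is the space of Borel functions $u:[0,T]\times\mathcal{O}\to\mathbb{R}$ with $u(t,\cdot)\in E$ for a.e. $t$ and $\int_0^T\|u(t)\|_E^p\,dt<\infty$ (essential supremum if $p=\infty$). $L^\infty$ and $\|\cdot\|_\infty$ refer to essentially bounded functions on $[0,T]\times\mathcal{O}$. Operator: $\mathcal{L}=\frac y2\left(\partial_{xx}+2\rho\sigma\,\partial_{xy}+\sigma^2\partial_{yy}\right)+\left(\frac{\rho\kappa\theta}{\sigma}-\frac y2\right)\partial_x+\kappa(\theta-y)\partial_y$. Bilinear form: for $u,v\in V$, $$a(u,v)=\frac12\int_{\mathcal{O}}y\left(u_xv_x+\rho\sigma u_xv_y+\rho\sigma u_yv_x+\sigma^2u_yv_y\right)d\mathfrak{m}+\int_{\mathcal{O}}y\left(j(x)u_x+k(x)u_y\right)v\,d\mathfrak{m},$$ with $j(x)=\frac12(1-\gamma\,\mathrm{sgn}(x)-\mu\rho\sigma)$ and $k(x)=\kappa-\frac{\gamma\rho\sigma}{2}\mathrm{sgn}(x)-\frac{\mu\sigma^2}{2}$. Assumption $\mathcal{H}^1$ on $\psi$: $\psi\in\mathcal{C}([0,T];H)$, $\sqrt{1+y}\,\psi\in L^2([0,T];V)$, $\psi(T)\in V$, and there exists $\Psi\in L^2([0,T];V)$ such that $\left|\frac{\partial\psi}{\partial t}\right|\leq\Psi$. Assumption $\mathcal{H}^2$ on $\Phi$: $\Phi\in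 L^2([0,T];H^2(\mathcal{O},\mathfrak{m}))$, $(1+y)^{3/2}\Phi\in L^2([0,T];H)$, $\frac{\partial\Phi}{\partial t}+\mathcal{L}\Phi\leq0$, and $\sqrt{1+y}\,\Phi\in L^\infty([0,T];L^2(\mathcal{O},\mathfrak{m}_{\gamma,\mu'}))$ for some $0<\mu'<\mu$. The solution of (VI) with obstacle $\psi$ is the unique function $u\in\mathcal{C}([0,T];H)\cap L^2([0,T];V)$ with $\frac{\partial u}{\partial t}\in L^2([0,T];H)$, $u\geq\psi$ a.e. in $[0,T]\times\mathcal{O}$, $u(T)=\psi(T)$, $0\leq u\leq\Phi$ and $-\left(\frac{\partial u}{\partial t},v-u\right)_H+a(u,v-u)\geq0$ a.e. in $[0,T]$ for all $v\in L^2([0,T];V)$ with $v\geq\psi$. *)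

(* Defs.v *)
From HB Require Import structures.
From mathcomp Require Import all_boot all_order all_algebra.
From mathcomp Require Import all_classical all_reals all_analysis.

Set Implicit Arguments.
Unset Strict Implicit.
Unset Printing Implicit Defensive.

Import Order.TTheory GRing.Theory Num.Theory.
Import numFieldNormedType.Exports.

Local Open Scope classical_set_scope.
Local Open Scope ring_scope.

Record heston (R : realType) := Heston {
  kappa : R; theta : R; sigma : R; rho : R; (* coefficients of the model *)
  maturity : R;                             (* the time horizon T *)
  gamma : R; mu : R                         (* exponents of the weight *) }.

Definition admissible (R : realType) (P : heston R) : Prop :=
  [/\ 0 < kappa P, 0 < theta P & 0 < sigma P] /\
  [/\ -1 < rho P < 1, 0 < maturity P, 0 < gamma P & 0 < mu P].

Definition beta (R : realType) (P : heston R) : R :=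
  2 * kappa P * theta P / sigma P ^+ 2.

Section TestFunctions.
Context {R : realType} {V : normedModType R}.

(* For finite-dimensional [V] (the only use below) this is C^oo: every iterated
   directional derivative exists everywhere and is continuous. *)
Definition smooth (f : V -> R) : Prop :=
  forall vs : seq V, let g := foldr (fun v h x => 'D_v h x) f vs in
    continuous g /\ forall x v, derivable g x v.

Definition test_function (U : set V) (f : V -> R) : Prop :=
  let supp := closure [set x | f x != 0] in
  [/\ smooth f, compact supp & supp `<=` U].

End TestFunctions.

Section Domains.
Context {R : realType}.

Local Notation mR := (measurableTypeR R).

Definition leb2 : set (mR * mR) -> \bar R :=
  (@lebesgue_measure R \x @lebesgue_measure R)%E.

HB.instance Definition _ := Measure.on leb2.

(* The library's sigma-finiteness instance for [_ \x _] is only inferred for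
   products of subprobabilities. *)
Lemma leb2_sigma_finite : sigma_finite setT leb2.
Proof.
have /sigma_finiteP[F [TF ndF Foo]] := sigma_finiteT (@lebesgue_measure R).
exists (fun n => F n `*` F n).
  rewrite -setXTT TF predeqE => -[x y]; split.
    move=> [/= [n _ Fnx] [k _ Fky]]; exists (maxn n k) => //; split.
    - by move: x Fnx; exact/subsetPset/ndF/leq_maxl.
    - by move: y Fky; exact/subsetPset/ndF/leq_maxr.
  by move=> [n _ []/= ? ?]; split; exists n.
move=> k; have [? ?] := Foo k; split; first exact: measurableX.
by rewrite /leb2 product_measure1E// lte_mul_pinfty// ge0_fin_numE.
Qed.

HB.instance Definition _ :=
  Measure_isSigmaFinite.Build _ _ _ leb2 leb2_sigma_finite.

Definition leb3 : set (mR * (mR * mR)) -> \bar R :=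
  (@lebesgue_measure R \x leb2)%E.

HB.instance Definition _ := Measure.on leb3.

(* Points of the half-plane are pairs z = (x, y); space-time points are pairs
   (t, z). *)
Definition halfplane : set (R * R) := [set: R] `*` `]0, +oo[.

Definition cylinder (T : R) : set (R * (R * R)) := `[0, T] `*` halfplane.

Definition open_cylinder (T : R) : set (R * (R * R)) := `]0, T[ `*` halfplane.

Definition slice (u : R * (R * R) -> R) (t : R) : R * R -> R :=
  fun z => u (t, z).

Definition ae_time (T : R) (A : R -> Prop) : Prop :=
  {ae lebesgue_measure, forall t, t \in `[0, T] -> A t}.

Definition ae_cylinder (T : R) (A : R * (R * R) -> Prop) : Prop :=
  {ae leb3, forall p, cylinder T p -> A p}.

End Domains.

Section WeakDerivatives.
Context {R : realType}.

Definition loc_integrable2 (U : set (R * R)) (f : R * R -> R) : Prop :=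
  measurable_fun U f /\
  forall K, compact K -> K `<=` U -> leb2.-integrable K (EFin \o f).

Definition loc_integrable3 (U : set (R * (R * R))) (f : R * (R * R) -> R) :
  Prop :=
  measurable_fun U f /\
  forall K, compact K -> K `<=` U -> leb3.-integrable K (EFin \o f).

Definition is_weak_deriv (v : R * R) (f g : R * R -> R) : Prop :=
  [/\ loc_integrable2 halfplane f, loc_integrable2 halfplane g &
      forall phi : R * R -> R, test_function halfplane phi ->
        \int[leb2]_(z in halfplane) (f z * 'D_v phi z) =
        - (\int[leb2]_(z in halfplane) (g z * phi z))].

Definition weakly_derivable (v : R * R) (f : R * R -> R) : Prop :=
  exists g, is_weak_deriv v f g.

(* A representative of the distributional derivative; it is unique up to
   Lebesgue-null sets, and a junk value when the distributional derivative is
   not a function. *)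
Definition weak_deriv (v : R * R) (f : R * R -> R) : R * R -> R :=
  xget (cst 0) (is_weak_deriv v f).

Definition dir_x : R * R := (1, 0).
Definition dir_y : R * R := (0, 1).
Definition dir_t : R * (R * R) := (1, (0, 0)).

Definition dx := weak_deriv dir_x.
Definition dy := weak_deriv dir_y.

Definition has_gradient (f : R * R -> R) : Prop :=
  weakly_derivable dir_x f /\ weakly_derivable dir_y f.

Definition grad_norm (f : R * R -> R) (z : R * R) : R :=
  Num.sqrt (dx f z ^+ 2 + dy f z ^+ 2).

Definition hess_norm (f : R * R -> R) (z : R * R) : R :=
  Num.sqrt (dx (dx f) z ^+ 2 + dx (dy f) z ^+ 2 +
            dy (dx f) z ^+ 2 + dy (dy f) z ^+ 2).

(* [g] is the distributional derivative of [u] with respect to t on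
   (0, T) x O. *)
Definition is_time_deriv (T : R) (u g : R * (R * R) -> R) : Prop :=
  [/\ loc_integrable3 (open_cylinder T) u,
      loc_integrable3 (open_cylinder T) g &
      forall phi : R * (R * R) -> R, test_function (open_cylinder T) phi ->
        \int[leb3]_(p in open_cylinder T) (u p * 'D_dir_t phi p) =
        - (\int[leb3]_(p in open_cylinder T) (g p * phi p))].

End WeakDerivatives.

Section FunctionSpaces.
Context {R : realType}.

(* Normed spaces of functions on O; functions are total on R x R but only their
   values on O matter. *)
Record fspace := FSpace {
  fs_mem : (R * R -> R) -> Prop;
  fs_norm : (R * R -> R) -> \bar R }.

(* Density of m_{gamma, m} with respect to Lebesgue measure on O. *)
Definition weight (P : heston R) (m : R) (z : R * R) : R :=
  z.2 `^ (beta P - 1) * expR (- gamma P * `|z.1| - m * z.2).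

(* Integral over O of a nonnegative function against m_{gamma, m}. *)
Definition wint (P : heston R) (m : R) (f : R * R -> R) : \bar R :=
  (\int[leb2]_(z in halfplane) (f z * weight P m z)%R%:E)%E.

(* Real-valued integral over O of an integrable function against
   m_{gamma, mu}. *)
Definition wRint (P : heston R) (f : R * R -> R) : R :=
  \int[leb2]_(z in halfplane) (f z * weight P (mu P) z).

Definition L2w (P : heston R) (m : R) : fspace := {|
  fs_mem := fun f => measurable_fun halfplane f /\
    (wint P m (fun z => f z ^+ 2)%R < +oo)%E;
  fs_norm := fun f => sqrte (wint P m (fun z => f z ^+ 2)) |}.

Definition spH (P : heston R) : fspace := L2w P (mu P).

Definition inH (P : heston R) := fs_mem (spH P).

Definition dotH (P : heston R) (f g : R * R -> R) : R :=
  wRint P (fun z => f z * g z).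

Definition spV (P : heston R) : fspace := {|
  fs_mem := fun f => [/\ inH P f, has_gradient f,
    inH P (fun z => Num.sqrt (1 + z.2) * f z) &
    inH P (fun z => Num.sqrt z.2 * grad_norm f z)];
  fs_norm := fun f => sqrte (wint P (mu P) (fun z =>
    z.2 * grad_norm f z ^+ 2 + (1 + z.2) * f z ^+ 2)) |}.

Definition inV (P : heston R) := fs_mem (spV P).

Definition spH2 (P : heston R) : fspace := {|
  fs_mem := fun f => [/\ inH P f, has_gradient f,
    has_gradient (dx f) /\ has_gradient (dy f),
    inH P (fun z => Num.sqrt (1 + z.2) * f z) &
    inH P (fun z => (1 + z.2) * grad_norm f z) /\
    inH P (fun z => z.2 * hess_norm f z)];
  fs_norm := fun f => sqrte (wint P (mu P) (fun z =>
    z.2 ^+ 2 * hess_norm f z ^+ 2 + (1 + z.2) ^+ 2 * grad_norm f z ^+ 2 +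
    (1 + z.2) * f z ^+ 2)) |}.

(* Norm of L^p([0, T]; E); [\_] extends by 0 outside of [0, T]. *)
Definition Lp_time_norm (T : R) (p : \bar R) (E : fspace)
    (u : R * (R * R) -> R) : \bar R :=
  Lnorm lebesgue_measure p ((fun t => fs_norm E (slice u t)) \_ `[0, T]).

(* L^p([0, T]; E), for p = 2 or p = +oo below. *)
Definition Lp_time (T : R) (p : \bar R) (E : fspace) (u : R * (R * R) -> R) :
  Prop :=
  [/\ measurable_fun (cylinder T) u,
      ae_time T (fun t => fs_mem E (slice u t)) &
      (Lp_time_norm T p E u < +oo)%E].

Definition L2_time (P : heston R) := Lp_time (maturity P) 2%:E.

(* C([0, T]; H) *)
Definition cont_timeH (P : heston R) (u : R * (R * R) -> R) : Prop :=
  (forall t, t \in `[0, maturity P] -> inH P (slice u t)) /\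
  (forall t, t \in `[0, maturity P] ->
    fs_norm (spH P) (fun z => u (s, z) - u (t, z))
      @[s --> within `[0, maturity P] (nbhs t)] --> 0%E).

Definition norm_oo (T : R) (u : R * (R * R) -> R) : \bar R :=
  Lnorm leb3 +oo%E ((EFin \o u) \_ (cylinder T)).

Definition Linfty (T : R) (u : R * (R * R) -> R) : Prop :=
  measurable_fun (cylinder T) u /\ (norm_oo T u < +oo)%E.

End FunctionSpaces.

Section Heston.
Context {R : realType} (P : heston R).
Let T := maturity P.

Definition opL (f : R * R -> R) (z : R * R) : R :=
  z.2 / 2 * (dx (dx f) z + 2 * rho P * sigma P * dx (dy f) z +
             sigma P ^+ 2 * dy (dy f) z) +
  (rho P * kappa P * theta P / sigma P - z.2 / 2) * dx f z +
  kappa P * (theta P - z.2) * dy f z.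

Definition coef_j (x : R) : R :=
  2^-1 * (1 - gamma P * Num.sg x - mu P * rho P * sigma P).

Definition coef_k (x : R) : R :=
  kappa P - gamma P * rho P * sigma P / 2 * Num.sg x -
  mu P * sigma P ^+ 2 / 2.

Definition form_a (u v : R * R -> R) : R :=
  2^-1 * wRint P (fun z => z.2 *
    (dx u z * dx v z + rho P * sigma P * dx u z * dy v z +
     rho P * sigma P * dy u z * dx v z + sigma P ^+ 2 * dy u z * dy v z)) +
  wRint P (fun z => z.2 * (coef_j z.1 * dx u z + coef_k z.1 * dy u z) * v z).

Definition assumption_H1 (psi : R * (R * R) -> R) : Prop :=
  [/\ cont_timeH P psi,
      L2_time P (spV P) (fun p => Num.sqrt (1 + p.2.2) * psi p),
      inV P (slice psi T) &
      exists Psi dpsi : R * (R * R) -> R,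
        [/\ L2_time P (spV P) Psi, is_time_deriv T psi dpsi &
            ae_cylinder T (fun p => `|dpsi p| <= Psi p)]].

(* dPhi/dt + L Phi <= 0 in the sense of distributions on (0, T) x O. *)
Definition parabolic_supersolution (Phi : R * (R * R) -> R) : Prop :=
  forall phi : R * (R * R) -> R, test_function (open_cylinder T) phi ->
    (forall p, 0 <= phi p) ->
    let dt := - (\int[leb3]_(p in open_cylinder T) (Phi p * 'D_dir_t phi p)) in
    let space := \int[lebesgue_measure]_(t in `]0, T[)
      (\int[leb2]_(z in halfplane) (opL (slice Phi t) z * phi (t, z))) in
    dt + space <= 0.

Definition assumption_H2 (Phi : R * (R * R) -> R) : Prop :=
  [/\ L2_time P (spH2 P) Phi,
      L2_time P (spH P) (fun p => (1 + p.2.2) `^ (3 / 2) * Phi p),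
      parabolic_supersolution Phi &
      exists m, 0 < m < mu P /\
        Lp_time T +oo%E (L2w P m) (fun p => Num.sqrt (1 + p.2.2) * Phi p)].

(* [u] solves (VI) with obstacle [psi] and dominating function [Phi]. *)
Definition solution_VI (Phi psi u : R * (R * R) -> R) : Prop :=
  [/\ cont_timeH P u /\ L2_time P (spV P) u,
      ae_cylinder T (fun p => psi p <= u p),
      {ae leb2, forall z, halfplane z -> u (T, z) = psi (T, z)},
      ae_cylinder T (fun p => 0 <= u p <= Phi p) &
      exists du : R * (R * R) -> R,
        [/\ is_time_deriv T u du, L2_time P (spH P) du &
            forall v, L2_time P (spV P) v ->
              ae_cylinder T (fun p => psi p <= v p) ->
              ae_time T (fun t =>
                let w := fun z => v (t, z) - u (t, z) in
                0 <= - dotH P (slice du t) w + form_a (slice u t) w)]].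

End Heston.

(* Main.v *)
Require Import Defs.
From HB Require Import structures.
From mathcomp Require Import all_boot all_order all_algebra.
From mathcomp Require Import all_classical all_reals all_analysis.
From mathcomp Require Import measurable_realfun ess_sup_inf.
From mathcomp Require Import ring lra.

Set Implicit Arguments.
Unset Strict Implicit.
Unset Printing Implicit Defensive.

Import Order.TTheory GRing.Theory Num.Theory.
Import numFieldNormedType.Exports.

Local Open Scope classical_set_scope.
Local Open Scope ring_scope.

(** Both assertions are instances of one comparison principle: if psi1 <= psi2 + c
    with a constant c >= 0, then u1 <= u2 + c ([comparison_up_to_constant]).

    Let w = (u1 - u2 - c)^+ be the excess. The functions u1 - w and u2 + w lie
    above psi1 and psi2 and belong to L^2(0, T; V), so they may be used in the two
    variational inequalities. Adding these, the coefficients of the form being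
    bounded after division by y and its principal part nondegenerate, one finds
    for almost every t
      (d/dt (u1 - u2), w)_H >= - K * int y w^2 dm      ([power_lower_bound]).
    The left side is the derivative of the energy E(t) = ||w(t)||_H^2 / 2
    ([energy_identity]), and E(T) = 0 because u1(T) = psi1(T) <= psi2(T) + c
    = u2(T) + c ([terminal_excess], [energy_vanishes]).

    The weight y makes Gronwall's lemma inapplicable as such. But 0 <= w <= Phi,
    and Phi is bounded in a space with a weaker weight, so for every M
      int y w^2 dm <= 2 M E + B exp(- (mu - m) M)      ([excess_moment_bound]).
    Gronwall's inequality then bounds E on [a, b] by a multiple of
    exp(2 K M (b - a)) exp(- (mu - m) M) as soon as E vanishes at b. When b - a is
    small this tends to 0 as M -> oo, so E vanishes on [a, b]; the length of the
    step is fixed, and E vanishes almost everywhere ([backward_uniqueness]).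

    The remaining work is to justify these manipulations for distributional
    derivatives. Everything is reduced to lines: with a countable family of test
    functions and the du Bois-Reymond lemma, a function with a weak derivative is
    on almost every line an indefinite integral ([weak_deriv_lines],
    [time_deriv_lines]). On a line the chain rule for the positive part and for
    its square is elementary ([ac_pos], [ac_posq]), which yields the weak
    derivatives of w in space ([weak_deriv_pos]) and the energy identity in time.
    Difference quotients along lines also give uniqueness of weak derivatives and
    their measurability in time ([weak_deriv_quotient],
    [measurable_weak_deriv_slices]); the latter is what makes the V-norm of the
    competitors u1 - w and u2 + w square integrable in time. *)

(** * Indefinite integrals on an interval *)

Lemma integrable_bounded_mul d (T : measurableType d) (R : realType)
    (m : {measure set T -> \bar R}) (D : set T) (F g : T -> R) (M : R) :
  measurable D -> measurable_fun D F -> (forall x, D x -> `|F x| <= M) ->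
  m.-integrable D (EFin \o g) ->
  m.-integrable D (EFin \o (fun x => F x * g x)).
Proof.
move=> mD mF bF ig.
suff bF' : [bounded F x | x in D].
  exact: (@integrableMr _ _ _ m D mD F (EFin \o g) mF bF' ig).
exists M; split; first exact: num_real.
by move=> y My x Dx /=; apply: le_trans (bF _ Dx) (ltW My).
Qed.

Lemma Rintegral_dominated_cvg d (T : measurableType d) (R : realType)
    (m : {measure set T -> \bar R}) (D : set T) (F : nat -> T -> R)
    (f g : T -> R) :
  measurable D -> (forall n, measurable_fun D (F n)) ->
  (forall x, D x -> F n x @[n --> \oo] --> f x) ->
  m.-integrable D (EFin \o g) ->
  (forall n x, D x -> `|F n x| <= g x) ->
  m.-integrable D (EFin \o f) /\
  \int[m]_(x in D) F n x @[n --> \oo] --> \int[m]_(x in D) f x.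
Proof.
move=> mD mF Ff ig Fg.
have mf : measurable_fun D f by exact: measurable_fun_cvg mF Ff.
have [|||||intf _ cv] := @dominated_convergence _ _ _ m D mD
    (fun n => EFin \o F n) (EFin \o f) (EFin \o g).
- by move=> n; apply/measurable_EFinP.
- exact/measurable_EFinP.
- by apply: aeW => x Dx; apply: cvg_EFin; [exact: nearW|exact: Ff].
- exact: ig.
- by apply: aeW => x n Dx; rewrite lee_fin Fg.
split => //; apply: (@fine_cvg _ _ _ _ _ (\int[m]_(x in D) f x)).
by rewrite /Rintegral fineK//; exact: integrable_fin_num.
Qed.

Section AlmostEverywhere.
Context d (T : measurableType d) (R : realType) (m : {measure set T -> \bar R}).
Implicit Types P Q S : T -> Prop.

Lemma ae_imp P Q : (forall x, P x -> Q x) ->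
  {ae m, forall x, P x} -> {ae m, forall x, Q x}.
Proof.
by have FF := ae_filter_ringOfSetsType m; exact: filterS.
Qed.

Lemma ae_imp2 P Q S : (forall x, P x -> Q x -> S x) ->
  {ae m, forall x, P x} -> {ae m, forall x, Q x} -> {ae m, forall x, S x}.
Proof.
by have FF := ae_filter_ringOfSetsType m; exact: filterS2.
Qed.

Lemma ae_and P Q : {ae m, forall x, P x} -> {ae m, forall x, Q x} ->
  {ae m, forall x, P x /\ Q x}.
Proof. exact: ae_imp2. Qed.

End AlmostEverywhere.

Section AbsolutelyContinuous.
Context {R : realType}.
Local Notation mu := (@lebesgue_measure R).
Implicit Types (a b c x y : R) (f g F G : R -> R).

Lemma integrable_subitv a b x y g : mu.-integrable `[a, b] (EFin \o g) ->
  a <= x -> y <= b -> mu.-integrable `[x, y] (EFin \o g).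
Proof.
move=> ig ax yb; apply: integrableS ig => //.
by apply: subset_itv; rewrite bnd_simp.
Qed.

Lemma Rintegral_itv_split a x y g : a <= x -> x <= y ->
  mu.-integrable `[a, y] (EFin \o g) ->
  \int[mu]_(t in `[a, y]) g t - \int[mu]_(t in `[a, x]) g t =
  \int[mu]_(t in `[x, y]) g t.
Proof.
move=> ax xy ig; rewrite Rintegral_itvB ?bnd_simp//.
rewrite Rintegral_itv_obnd_cbnd//; apply: integrableS ig => //.
by apply: subset_itv; rewrite bnd_simp.
Qed.

(** Absolute continuity with derivative g, as an integral identity: the
    derivative is part of the data, so that no differentiation is involved. *)
Definition ac a b F g := mu.-integrable `[a, b] (EFin \o g) /\
  forall x y, a <= x -> x <= y -> y <= b ->
    F y - F x = \int[mu]_(t in `[x, y]) g t.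

Lemma ac_primitive a b c g : mu.-integrable `[a, b] (EFin \o g) ->
  ac a b (fun s => c + \int[mu]_(t in `[a, s]) g t) g.
Proof.
move=> ig; split => // x y ax xy yb.
rewrite opprD addrACA subrr add0r Rintegral_itv_split//.
exact: integrable_subitv ig _ _.
Qed.

Lemma ac_continuous a b F g : a <= b -> ac a b F g ->
  {within `[a, b], continuous F}.
Proof.
move=> ab [ig h].
have := parameterized_integral_continuous ab ig.
move=> /(_ _) c0.
have c1 : {within `[a, b], continuous (fun x => cst (F a) x + parameterized_integral mu a x g)}.
  by move=> x; apply: cvgD; [exact: cvg_cst|exact: c0].
apply: (@subspace_eq_continuous _ _ _ _ _ _ c1) => x.
rewrite inE/= in_itv/= => /andP[ax xb].
by rewrite /from_subspace /parameterized_integral -(h a x)// addrC subrK.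
Qed.

Lemma within_continuous_measurable a b F : {within `[a, b], continuous F} ->
  measurable_fun `[a, b] F.
Proof. by move=> cF; exact: subspace_continuous_measurable_fun. Qed.

Lemma within_continuous_bounded a b F : {within `[a, b], continuous F} ->
  exists M, 0 <= M /\ forall x, x \in `[a, b] -> `|F x| <= M.
Proof.
move=> cF.
have /compact_bounded[M [Mr HM]] :=
  continuous_compact cF (@segment_compact _ a b).
exists (`|M| + 1); split; first by rewrite addr_ge0.
move=> x xab; apply: (HM (`|M| + 1)); last by exists x.
by rewrite (le_lt_trans (ler_norm _))// ltrDl.
Qed.

Lemma integrable_continuous_mul a b F g : {within `[a, b], continuous F} ->
  mu.-integrable `[a, b] (EFin \o g) ->
  mu.-integrable `[a, b] (EFin \o (fun x => F x * g x)).
Proof.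
move=> cF ig; have [M [_ HM]] := within_continuous_bounded cF.
by apply: (@integrable_bounded_mul _ _ _ _ _ _ _ M) => //;
  exact: within_continuous_measurable.
Qed.

Lemma Rintegral_itv_norm_le a b g h : mu.-integrable `[a, b] (EFin \o g) ->
  mu.-integrable `[a, b] (EFin \o h) ->
  (forall x, x \in `[a, b] -> `|g x| <= h x) ->
  `|\int[mu]_(t in `[a, b]) g t| <= \int[mu]_(t in `[a, b]) h t.
Proof.
move=> ig ih gh; apply: le_trans (le_normr_Rintegral _ ig) _ => //.
by apply: le_Rintegral => //; exact: integrable_norm.
Qed.

Lemma ac_sub a b F G f g : ac a b F f -> ac a b G g ->
  ac a b (fun x => F x - G x) (fun x => f x - g x).
Proof.
move=> [if_ hF] [ig hG]; split; first exact: (integrableB _ if_ ig).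
move=> x y ax xy yb; rewrite RintegralB//; [|exact: integrable_subitv if_ _ _|
  exact: integrable_subitv ig _ _].
by rewrite -hF// -hG//; ring.
Qed.

Lemma ac_scale a b k F f : ac a b F f ->
  ac a b (fun x => k * F x) (fun x => k * f x).
Proof.
move=> [if_ hF]; split; first exact: (integrableZl _ k if_).
move=> x y ax xy yb; rewrite RintegralZl//; last exact: integrable_subitv if_ _ _.
by rewrite -hF// mulrBr.
Qed.

Lemma ac_shift a b k F f : ac a b F f -> ac a b (fun x => F x - k) f.
Proof. by move=> [? h]; split=> // x y *; rewrite -h//; ring. Qed.

(** An additive function of intervals that is quadratically small with respect
    to a continuous monotone function vanishes: halving the increment of [A]
    halves the constant. *)
Lemma additive_quadratic0 a b (A : R -> R) (D : R -> R -> R) C :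
  {within `[a, b], continuous A} ->
  (forall x y, a <= x -> x <= y -> y <= b -> A x <= A y) ->
  (forall x y z, a <= x -> x <= y -> y <= z -> z <= b -> D x z = D x y + D y z) ->
  (forall x y, a <= x -> x <= y -> y <= b -> `|D x y| <= C * (A y - A x) ^+ 2) ->
  forall x y, a <= x -> x <= y -> y <= b -> D x y = 0.
Proof.
move=> cA ndA addD quadD.
have key n x y : a <= x -> x <= y -> y <= b ->
    `|D x y| <= C / 2 ^+ n * (A y - A x) ^+ 2.
  elim: n x y => [|n IH] x y ax xy yb.
    by rewrite expr0 divr1; exact: quadD.
  have cxy : {within `[x, y], continuous A}.
    by apply: continuous_subspaceW cA; apply: subset_itv; rewrite bnd_simp.
  have Axy := ndA _ _ ax xy yb.
  have [|m mxy Am] := @IVT _ A x y ((A x + A y) / 2) xy cxy.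
    by rewrite minElt maxElt; case: ltP => ?; apply/andP; split; lra.
  move: mxy; rewrite in_itv/= => /andP[xm my].
  rewrite (addD x m y)// (le_trans (ler_normD _ _))//.
  have H1 := IH x m ax xm (le_trans my yb).
  have H2 := IH m y (le_trans ax xm) my yb.
  apply: (le_trans (lerD H1 H2)); rewrite Am le_eqVlt; apply/orP; left.
  have : (2 : R) ^+ n != 0 by rewrite expf_neq0.
  by rewrite (exprS 2 n) => k0; apply/eqP; field.
move=> x y ax xy yb; apply/eqP; rewrite -normr_eq0; apply/eqP.
apply/le_anti; rewrite normr_ge0 andbT.
set K := C * (A y - A x) ^+ 2.
have H n : `|D x y| <= K * (2^-1) ^+ n.
  by rewrite (le_trans (key n _ _ ax xy yb))// /K exprVn mulrAC.
have cv : (fun n => K * (2^-1) ^+ n) @ \oo --> (0 : R).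
  rewrite -(mulr0 K); apply: cvgM; first exact: cvg_cst.
  by apply: cvg_expr; rewrite ger0_norm; lra.
by apply: (cvgr_to_ge cv); apply: nearW => n; exact: H.
Qed.

Definition pos (s : R) := Num.max s 0.

Lemma pos_ge0 s : 0 <= pos s. Proof. by rewrite le_max lexx orbT. Qed.

Lemma pos_lipschitz s t : `|pos s - pos t| <= `|s - t|.
Proof.
rewrite /pos !maxElt; case: ltP => s0; case: ltP => t0;
  rewrite ler_norml; apply/andP; split; by case: (ger0P (s - t)) => ?; lra.
Qed.

(** Half the square of the positive part: a primitive of [pos] with Lipschitz
    derivative, so that a second-order Taylor estimate holds everywhere. *)
Definition posq (s : R) := pos s ^+ 2 / 2.

Lemma posq_taylor s t :
  `|posq t - posq s - pos s * (t - s)| <= (t - s) ^+ 2 / 2.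
Proof.
rewrite /posq /pos !maxElt; case: (ltP s 0) => s0; case: (ltP t 0) => t0;
  have := sqr_ge0 (t - s); have := sqr_ge0 t; have := sqr_ge0 s;
  rewrite ler_norml !expr2 => ? ? ?.
- by apply/andP; split; lra.
- have st : s * t <= 0 by rewrite nmulr_rle0.
  by apply/andP; split; lra.
- have st : s * t <= 0 by rewrite mulr_ge0_le0// ltW.
  by apply/andP; split; lra.
- by apply/andP; split; lra.
Qed.

Lemma within_continuous_pos a b F : {within `[a, b], continuous F} ->
  {within `[a, b], continuous (fun x => pos (F x))}.
Proof.
move=> cF x; have := cF x => /cvgrPdist_lt h.
apply/cvgrPdist_lt => e e0; near=> y.
by rewrite (le_lt_trans (pos_lipschitz _ _))//; near: y; exact: h.
Unshelve. all: by end_near. Qed.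

(** Chain rule for the square of the positive part, which has a Lipschitz
    derivative: on an interval both sides differ by at most a constant times
    the square of the integral of |g|. *)
Lemma ac_posq a b F g : a <= b -> ac a b F g ->
  ac a b (fun x => posq (F x)) (fun x => pos (F x) * g x).
Proof.
move=> ab acF; have [ig hF] := acF.
have cF := ac_continuous ab acF.
have cP := within_continuous_pos cF.
have iPg := integrable_continuous_mul cP ig.
have iabs := integrable_norm ig.
split => // x y ax xy yb; apply/eqP; rewrite -subr_eq0; apply/eqP.
pose A x := 0 + \int[mu]_(t in `[a, x]) `|g t|.
have acA : ac a b A (fun t => `|g t|) by exact: ac_primitive.
have [_ hA] := acA.
apply: (@additive_quadratic0 a b A (fun x y => posq (F y) - posq (F x) -
    \int[mu]_(t in `[x, y]) (pos (F t) * g t)) (3 / 2)) => //.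
- exact: ac_continuous acA.
- move=> {x y ax xy yb} x y ax xy yb; rewrite -subr_ge0 hA//.
  by apply: Rintegral_ge0.
- move=> {x y ax xy yb} x y z ax xy yz zb.
  have H : mu.-integrable `[x, z] (EFin \o (fun t => pos (F t) * g t)).
    exact: integrable_subitv iPg ax zb.
  have := Rintegral_itv_split xy yz H; move/eqP; rewrite subr_eq => /eqP ->.
  by ring.
move=> {x y ax xy yb} x y ax xy yb.
have igxy := integrable_subitv ig ax yb.
have iPgxy := integrable_subitv iPg ax yb.
have iaxy := integrable_subitv iabs ax yb.
have Fxy : `|F y - F x| <= A y - A x.
  by rewrite hF// hA//; exact: le_normr_Rintegral.
have A0 : 0 <= A y - A x by exact: le_trans Fxy.
have osc t : t \in `[x, y] -> `|pos (F t) - pos (F x)| <= A y - A x.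
  rewrite in_itv/= => /andP[xt ty]; rewrite (le_trans (pos_lipschitz _ _))//.
  apply: (@le_trans _ _ (A t - A x)).
    rewrite hF ?hA ?(le_trans ty)//; apply: le_normr_Rintegral => //.
    exact: integrable_subitv ig _ (le_trans ty yb).
  rewrite lerB// -subr_ge0 hA//; last exact: le_trans xt.
  by apply: Rintegral_ge0.
have H2 : `|\int[mu]_(t in `[x, y]) (pos (F t) * g t) - pos (F x) * (F y - F x)|
    <= (A y - A x) ^+ 2.
  rewrite hF// -RintegralZl// -RintegralB//; last first.
    exact: (integrableZl _ (pos (F x)) igxy).
  have -> : (A y - A x) ^+ 2 = \int[mu]_(t in `[x, y]) ((A y - A x) * `|g t|).
    by rewrite RintegralZl// -hA// expr2.
  apply: Rintegral_itv_norm_le.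
  - exact: (integrableB _ iPgxy (integrableZl _ (pos (F x)) igxy)).
  - exact: (integrableZl _ (A y - A x) iaxy).
  - by move=> t txy; rewrite -mulrBl normrM ler_wpM2r// osc.
have H1 := posq_taylor (F x) (F y).
have H3 : (F y - F x) ^+ 2 <= (A y - A x) ^+ 2.
  by rewrite -(real_normK (num_real (F y - F x))) ler_sqr ?nnegrE.
move: H1 H2 H3; rewrite !ler_norml => /andP[? ?] /andP[? ?] ?.
by apply/andP; split; lra.
Qed.

Lemma ac_opp a b F f : ac a b F f -> ac a b (fun x => - F x) (fun x => - f x).
Proof.
move=> acF; have := ac_scale (-1) acF.
by rewrite (_ : (fun x => -1 * F x) = (fun x => - F x)) 1?(_ : (fun x => -1 * f x) = (fun x => - f x))//;
  apply/funext => x; rewrite mulN1r.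
Qed.

Lemma ac_add a b F G f g : ac a b F f -> ac a b G g ->
  ac a b (fun x => F x + G x) (fun x => f x + g x).
Proof.
move=> acF /ac_opp acG; have := ac_sub acF acG.
by congr ac; apply/funext => x; rewrite opprK.
Qed.

Lemma posqD s : posq s + posq (- s) = s ^+ 2 / 2.
Proof.
rewrite /posq /pos !maxElt oppr_lt0; case: ltgtP => // h; rewrite ?h; ring.
Qed.

Lemma posB s : pos s - pos (- s) = s.
Proof.
by rewrite /pos !maxElt oppr_lt0; case: ltgtP => // h; rewrite ?h; ring.
Qed.

(** Both signs together: s^2 / 2 = posq s + posq (- s). *)
Lemma ac_sqr a b F g : a <= b -> ac a b F g ->
  ac a b (fun x => F x ^+ 2 / 2) (fun x => F x * g x).
Proof.
move=> ab acF; have := ac_add (ac_posq ab acF) (ac_posq ab (ac_opp acF)).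
congr ac; apply/funext => x; first exact: posqD.
by rewrite mulrN -mulrBl posB.
Qed.

(** The product rule follows from that of squares by polarization. *)
Lemma ac_mul a b F G f g : a <= b -> ac a b F f -> ac a b G g ->
  ac a b (fun x => F x * G x) (fun x => F x * g x + f x * G x).
Proof.
move=> ab acF acG.
have := ac_sub (ac_sqr ab (ac_add acF acG)) (ac_add (ac_sqr ab acF) (ac_sqr ab acG)).
by congr ac; apply/funext => x; field.
Qed.

Lemma cvg_harmonic_shift : (fun n => n.+1%:R^-1 : R) @ \oo --> (0 : R).
Proof. exact: cvg_harmonic. Qed.

Let e_ n : R := n.+1%:R^-1.

Let e_gt0 n : 0 < e_ n. Proof. by rewrite /e_ invr_gt0 ltr0n. Qed.

(** [s^+ = lim (posq s - posq (s - e)) / e] as e -> 0+, and the derivatives of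
    the approximations are bounded and converge to the indicator of s > 0. *)
Lemma ac_pos a b F g : a <= b -> ac a b F g ->
  ac a b (fun x => pos (F x)) (fun x => (0 < F x)%R%:R * g x).
Proof.
move=> ab acF; have [ig hF] := acF.
pose h n s := (e_ n)^-1 * (pos s - pos (s - e_ n)).
pose q n s := (e_ n)^-1 * (posq s - posq (s - e_ n)).
have acq n : ac a b (fun x => q n (F x)) (fun x => h n (F x) * g x).
  have := ac_scale (e_ n)^-1
    (ac_sub (ac_posq ab acF) (ac_posq ab (ac_shift (e_ n) acF))).
  by congr ac; apply/funext => x; rewrite /h; ring.
have cq s : q n s @[n --> \oo] --> pos s.
  apply/cvgrPdist_le => e e0; near=> n.
  have en : e_ n <= e by near: n; exact: (cvgr_le _ cvg_harmonic_shift).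
  have := posq_taylor s (s - e_ n).
  rewrite (_ : s - e_ n - s = - e_ n); last by ring.
  rewrite -(ler_pM2l (_ : 0 < (e_ n)^-1)) ?invr_gt0//.
  rewrite -[X in X * `|_|](gtr0_norm (_ : 0 < (e_ n)^-1)) ?invr_gt0// -normrM.
  have -> : (e_ n)^-1 * (posq (s - e_ n) - posq s - pos s * - e_ n) = pos s - q n s.
    by rewrite /q; field; rewrite gt_eqF.
  move=> /le_trans; apply.
  have -> : (e_ n)^-1 * ((- e_ n) ^+ 2 / 2) = e_ n / 2 by field; rewrite gt_eqF.
  by have := e_gt0 n; lra.
have ch s : h n s @[n --> \oo] --> ((0 < s)%R%:R : R).
  apply/cvgrPdist_le => e e0; case: (ltP 0 s) => s0; near=> n.
    have en : e_ n <= s by near: n; exact: (cvgr_le _ cvg_harmonic_shift).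
    rewrite /h /pos !max_l ?subr_ge0 ?(ltW s0)//.
    rewrite (_ : true%:R - _ = 0) ?normr0 ?(ltW e0)//.
    by rewrite mulr1n; field; rewrite gt_eqF.
  rewrite /h /pos !max_r//; first by rewrite subrr mulr0 subrr normr0 ltW.
  by rewrite subr_le0 (le_trans s0)// ltW.
have hb n s : `|h n s| <= 1.
  rewrite normrM (gtr0_norm (_ : 0 < (e_ n)^-1)) ?invr_gt0// mulrC.
  rewrite ler_pdivrMr// mul1r (le_trans (pos_lipschitz _ _))//.
  by rewrite opprB addrCA subrr addr0 gtr0_norm.
have dom x y : a <= x -> y <= b ->
    mu.-integrable `[x, y] (EFin \o (fun x => (0 < F x)%R%:R * g x)) /\
    \int[mu]_(t in `[x, y]) (h n (F t) * g t) @[n --> \oo] -->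
    \int[mu]_(t in `[x, y]) ((0 < F t)%R%:R * g t).
  move=> ax yb; have igxy := integrable_subitv ig ax yb.
  apply: (@Rintegral_dominated_cvg _ _ _ mu _ _ _ (fun t => `|g t|)) => //.
  - move=> n; have [/integrableP[/measurable_EFinP mh _] _] := acq n.
    by apply: measurable_funS mh => //; apply: subset_itv; rewrite bnd_simp.
  - by move=> t _; apply: cvgM; [exact: ch|exact: cvg_cst].
  - exact: integrable_norm igxy.
  - by move=> n t _; rewrite normrM ler_piMl.
split; first by have [] := dom a b (lexx a) (lexx b).
move=> x y ax xy yb; have [_ cvI] := dom x y ax yb.
have cvq : q n (F y) - q n (F x) @[n --> \oo] --> pos (F y) - pos (F x).
  by apply: cvgB; exact: cq.
apply: (cvg_unique _ cvq) => //.
have -> : (fun n => q n (F y) - q n (F x)) =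
    (fun n => \int[mu]_(t in `[x, y]) (h n (F t) * g t)).
  by apply/funext => n; have [_ ->] := acq n.
exact: cvI.
Unshelve. all: by end_near. Qed.

End AbsolutelyContinuous.

(** * Lebesgue differentiation along the steps 1/n *)

Section Differentiation.
Context {R : realType}.
Local Notation mu := (@lebesgue_measure R).
Implicit Types (a b c x y : R) (f g F G : R -> R).

Lemma derivable_quotient_cvg F x : derivable F x 1 ->
  n.+1%:R * (F (x + n.+1%:R^-1) - F x) @[n --> \oo] --> derive1 F x.
Proof.
move=> dF; rewrite derive1E.
have h : h^-1 *: ((F \o shift x) (h *: (1 : R)) - F x) @[h --> 0^'] --> 'D_1 F x.
  exact: dF.
have cn : (fun n => n.+1%:R^-1 : R) @ \oo --> (0 : R)^'.
  move=> A hA; have hA' : nbhs (0 : R) [set t | t != 0 -> A t] := hA.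
  have hn : \forall n \near \oo, n.+1%:R^-1 != 0 :> R -> A n.+1%:R^-1 := cvg_harmonic hA'.
  apply: (filterS _ hn) => n; apply.
  by rewrite invr_eq0 pnatr_eq0.
apply: cvg_trans (cvg_comp _ _ cn h); apply: near_eq_cvg; near=> n.
by rewrite /= invrK /GRing.scale/= mulr1 [_ + x]addrC.
Unshelve. all: by end_near. Qed.

(** Lebesgue differentiation. A single sequence of steps suffices below, and
    limits along a sequence stay measurable in parameters. *)
Lemma ac_ae_quotient a b F g : a < b -> ac a b F g ->
  {ae mu, forall s, s \in `]a, b[ ->
    n.+1%:R * (F (s + n.+1%:R^-1) - F s) @[n --> \oo] --> g s}.
Proof.
move=> ab [ig hF].
pose gr := g \_ `[a, b].
have lgr : locally_integrable [set: R] gr by exact: integrable_locally_restrict.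
have igT : mu.-integrable setT (EFin \o gr).
  by rewrite -restrict_EFin; apply/(integrable_mkcond _ _).1.
have igr y : mu.-integrable `[a, y] (EFin \o gr) by exact: integrableS igT.
pose Gr x := \int[mu]_(t in `[a, x]) gr t.
have := @FTC1 R gr (BLeft a) igr lgr.
apply: filterS; first exact: (ae_filter_ringOfSetsType mu).
move=> s /= hs; rewrite in_itv/= => /andP[as_ sb].
have [|ds dE] := hs; first by rewrite lte_fin.
have sab : s \in `[a, b] by rewrite in_itv/= !ltW.
have -> : g s = derive1 Gr s by rewrite dE /gr patchE mem_set.
apply: cvg_trans (derivable_quotient_cvg ds); apply: near_eq_cvg; near=> n.
have nb : s + n.+1%:R^-1 <= b.
  rewrite -lerBrDl; near: n; apply: (cvgr_le _ cvg_harmonic).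
  by rewrite subr_gt0.
have sn : s <= s + n.+1%:R^-1 by rewrite lerDl invr_ge0.
congr (_ * _).
rewrite hF// ?(ltW as_)// /Gr Rintegral_itv_split//; [|exact: ltW].
apply: eq_Rintegral => t; rewrite inE/= in_itv/= => /andP[st ts].
rewrite /gr patchE mem_set//= in_itv/= (le_trans ts nb) andbT.
by rewrite (le_trans _ st)// ltW.
Unshelve. all: by end_near. Qed.

Lemma ae_zero_of_primitive a b g : a < b -> mu.-integrable `[a, b] (EFin \o g) ->
  (forall x, x \in `[a, b] -> \int[mu]_(t in `[a, x]) g t = 0) ->
  {ae mu, forall s, s \in `]a, b[ -> g s = 0}.
Proof.
move=> ab ig g0.
have acg : ac a b (fun=> 0) g.
  split=> // x y ax xy yb; rewrite subrr -(Rintegral_itv_split ax xy).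
    by rewrite !g0 ?subr0// in_itv/= ?ax ?(le_trans xy)// (le_trans ax).
  exact: integrable_subitv ig _ _.
apply: ae_imp (ac_ae_quotient ab acg) => s /= h /h.
under eq_fun do rewrite subrr mulr0.
by move=> c; apply: (cvg_unique _ c) => //; exact: cvg_cst.
Qed.

End Differentiation.

(** * Smooth functions and bumps *)

Section SmoothFunctions.
Context {R : realType}.
Implicit Types (f g : R -> R) (p : {poly R}).

(** The derivatives are carried along, so that primitives and derivatives of
    smooth functions are shifts of the sequence. *)
Definition smooth1 f := exists F : nat -> R -> R,
  F 0%N = f /\ forall n (x : R), is_derive x (1 : R) (F n) (F n.+1 x).

Lemma smooth1_primitive f g : (forall x : R, is_derive x (1 : R) f (g x)) ->
  smooth1 g -> smooth1 f.
Proof.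
move=> fg [F [F0 hF]]; exists (fun n => if n is n'.+1 then F n' else f).
by split => // -[|n] x //=; rewrite F0.
Qed.

Lemma is_derive_quadratic_bound f (x df C : R) :
  (forall y, `|f y - f x - df * (y - x)| <= C * (y - x) ^+ 2) ->
  is_derive x (1 : R) f df.
Proof.
move=> fx.
have C0 : 0 <= C.
  have := le_trans (normr_ge0 _) (fx (x + 1)).
  by rewrite addrAC subrr add0r expr1n mulr1.
suff h : h^-1 *: ((f \o shift x) (h *: (1 : R)) - f x) @[h --> 0^'] --> df.
  by apply: DeriveDef; [apply/cvg_ex; exists df|apply: cvg_lim h].
apply/cvgrPdist_le => e e0; near=> h; rewrite /= /GRing.scale/= mulr1.
have h0 : h != 0 by near: h; exact: nbhs_dnbhs_neq.
have hn : `|h| <= e / (C + 1).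
  near: h; apply: dnbhs0_le.
  by rewrite divr_gt0// ltr_wpDl.
have := fx (h + x); rewrite addrK => H.
rewrite distrC (_ : _ - df = h^-1 * (f (h + x) - f x - df * h)); last by field.
rewrite normrM normfV ler_pdivrMl ?normr_gt0//.
rewrite (le_trans H)// -(real_normK (num_real h)) expr2 mulrCA ler_wpM2l//.
move: hn; rewrite ler_pdivlMr ?ltr_wpDl// => hn.
rewrite (le_trans _ hn)// mulrC ler_wpM2l// lerDl ler01.
Unshelve. all: by end_near. Qed.

Lemma monomial_exp_bound c n (u : R) : 0 < c -> 0 <= u ->
  u ^+ n * expR (- (c * u)) <= n`!%:R / c ^+ n.
Proof.
move=> c0 u0; rewrite expRN ler_pdivrMr ?expR_gt0// mulrAC.
rewrite ler_pdivlMr ?exprn_gt0// -exprMn [u * c]mulrC.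
have cu : 0 <= c * u by rewrite mulr_ge0// ltW.
case: n => [|n].
  by rewrite expr0 fact0 mul1r (le_trans _ (expR_ge1Dx _))// lerDl.
rewrite -ler_pdivrMl ?ltr0n ?fact_gt0// [_^-1 * _]mulrC.
by rewrite (le_trans _ (@expR_ge1Dxn R _ n cu))// lerDr ler01.
Qed.

(** The exponential absorbs the pole of p(1/x) at 0; this gives the quadratic
    bound from which the flat functions below are differentiable at 0. *)
Lemma poly_exp_bound c p m : 0 < c -> exists C, forall u : R, 0 <= u ->
  `|p.[u]| * u ^+ m * expR (- (c * u)) <= C.
Proof.
move=> c0; elim/poly_ind: p m => [|p a IH] m.
  by exists 0 => u u0; rewrite horner0 normr0 !mul0r.
have [C HC] := IH m.+1.
exists (C + `|a| * (m`!%:R / c ^+ m)) => u u0.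
rewrite hornerD hornerMX hornerC.
apply: (@le_trans _ _ ((`|p.[u] * u| + `|a|) * u ^+ m * expR (- (c * u)))).
  by rewrite -!mulrA ler_wpM2r ?ler_normD// mulr_ge0 ?expR_ge0// exprn_ge0.
rewrite !mulrDl lerD//.
  rewrite normrM (ger0_norm u0); have := HC u u0.
  by rewrite exprS !mulrA.
by rewrite -!mulrA ler_wpM2l// monomial_exp_bound.
Qed.

(** The functions [p(1/x) exp(-c/x)] on x > 0, extended by 0: a family closed
    under differentiation. *)
Definition flat c p (x : R) : R :=
  if 0 < x then p.[x^-1] * expR (- (c * x^-1)) else 0.

(** In the variable u = 1/x, differentiation of exp(- c u) and of p(u) with
    respect to x both bring out a factor u^2. *)
Definition flat_deriv c p := c *: 'X^2 * p - 'X^2 * p^`()%R.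

Lemma is_derive_flat c p (x : R) : 0 < c ->
  is_derive x (1 : R) (flat c p) (flat c (flat_deriv c p) x).
Proof.
move=> c0; case: (ltrgtP x 0) => x0.
- rewrite {2}/flat ltNge (ltW x0)/=.
  apply: (near_eq_is_derive _ (is_derive_cst 0 x 1)); near=> y.
  by rewrite /flat ltNge ltW//; near: y; exact: lt_nbhsl.
- rewrite {2}/flat x0.
  have -> : (flat_deriv c p).[x^-1] * expR (- (c * x^-1)) =
      p.[x^-1] * (expR (- c * x^-1) * (- c * (- x ^- 2 * 1))) +
      expR (- c * x^-1) * (p^`()%R.[x^-1] * (- x ^- 2 * 1)).
    rewrite /flat_deriv !(hornerD, hornerN, hornerM, hornerZ, hornerXn, hornerX).
    rewrite -[- (c * x^-1)]mulNr; move: (expR _) p.[_] p^`().[_] => e q q'.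
    by field; rewrite gt_eqF.
  have dV : is_derive x (1 : R) (fun y : R => y^-1) (- x ^- 2 * 1).
    by apply: is_deriveV; rewrite gt_eqF.
  have dcV : is_derive x (1 : R) (fun y : R => - c * y^-1) (- c * (- x ^- 2 * 1)).
    exact: (is_deriveZ (- c) dV).
  have dp := is_derive1_comp (is_derive_poly p x^-1) dV.
  have de := @is_derive1_comp R expR (fun y => - c * y^-1) x _ _
    (is_derive_expR _) dcV.
  apply: (near_eq_is_derive _ (is_deriveM dp de)); near=> y.
  have y0 : 0 < y by near: y; exact: lt_nbhsr.
  by rewrite /flat y0 -mulNr.
have [C HC] := poly_exp_bound p 2 c0.
apply: (@is_derive_quadratic_bound _ _ _ C) => y.
rewrite x0 /flat ltxx mul0r !subr0; case: ltP => y0; last first.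
  rewrite normr0 mulr_ge0 ?sqr_ge0//.
  by have := HC 0 (lexx 0); rewrite expr0n/= mulr0 mul0r.
have := HC y^-1; rewrite invr_ge0 (ltW y0) => /(_ isT).
rewrite exprVn mulrAC ler_pdivrMr ?exprn_gt0//.
by rewrite normrM (ger0_norm (expR_ge0 _)).
Unshelve. all: by end_near. Qed.

Lemma smooth1_flat c p : 0 < c -> smooth1 (flat c p).
Proof.
move=> c0; exists (fun n => flat c (iter n (flat_deriv c) p)).
by split => // n x; exact: is_derive_flat.
Qed.

Section SmoothAlgebra.
Variable V : normedModType R.

Definition clin (l : V -> R) :=
  continuous l /\ forall h v x, l (h *: v + x) = h * l v + l x.

(** The algebra generated by the functions [f \o l], f smooth of one variable
    and l a continuous linear form: it is stable under directional
    derivatives, so its members are smooth. *)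
Inductive smalg : (V -> R) -> Prop :=
| smalg_line f l : smooth1 f -> clin l -> smalg (fun x => f (l x))
| smalg_add (f g : V -> R) : smalg f -> smalg g -> smalg (fun x => f x + g x)
| smalg_mul (f g : V -> R) : smalg f -> smalg g -> smalg (fun x => f x * g x)
| smalg_scale k (f : V -> R) : smalg f -> smalg (fun x => k * f x).

Lemma is_derive_line f df (l : V -> R) (x v : V) : clin l ->
  is_derive (l x) (1 : R) f df -> is_derive x v (fun y => f (l y)) (l v * df).
Proof.
move=> [_ ll] [dfx dfE].
have dif : differentiable f (l x) by apply/derivable1_diffP.
have E : (fun h => h^-1 *: (((fun y => f (l y)) \o shift x) (h *: v) - f (l x)))
    = (fun h => h^-1 *: ((f \o shift (l x)) (h *: l v) - f (l x))).
  by apply/funext => h /=; rewrite ll.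
have dd : derivable f (l x) (l v) by exact: diff_derivable.
apply: DeriveDef; first by rewrite /derivable E.
rewrite /derive E -/(derive f (l x) (l v)) deriveE// diff1E// derive1E dfE.
by [].
Qed.

Lemma smalg_derive (f : V -> R) : smalg f -> forall v,
  exists2 df, smalg df & forall x, is_derive x v f (df x).
Proof.
elim=> {f} [f l [F [<- hF]] lin|f g _ IHf _ IHg|f g af IHf ag IHg|k f _ IHf] v.
- exists (fun x => l v * F 1%N (l x)).
    apply: smalg_scale; apply: smalg_line lin.
    by exists (fun n => F n.+1).
  by move=> x; apply: is_derive_line.
- have [df adf Hf] := IHf v; have [dg adg Hg] := IHg v.
  exists (fun x => df x + dg x); first exact: smalg_add.
  by move=> x; exact: is_deriveD.
- have [df adf Hf] := IHf v; have [dg adg Hg] := IHg v.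
  exists (fun x => f x * dg x + g x * df x).
    by apply: smalg_add; exact: smalg_mul.
  by move=> x; exact: is_deriveM.
- have [df adf Hf] := IHf v.
  exists (fun x => k * df x); first exact: smalg_scale.
  by move=> x; exact: is_deriveZ.
Qed.

Lemma smalg_continuous (f : V -> R) : smalg f -> continuous f.
Proof.
elim=> {f} [f l [F [<- hF]] [cl _] x|f g _ IHf _ IHg x|f g af IHf ag IHg x|k f _ IHf x].
- apply: continuous_comp; first exact: cl.
  by apply: differentiable_continuous; apply/derivable1_diffP; have [] := hF 0%N (l x).
- by apply: cvgD; [exact: IHf|exact: IHg].
- by apply: cvgM; [exact: IHf|exact: IHg].
- by apply: cvgM; [exact: cvg_cst|exact: IHf].
Qed.

Lemma smalg_derive_op (f : V -> R) v : smalg f -> smalg (fun x => 'D_v f x).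
Proof.
move=> /smalg_derive/(_ v)[df adf Hf].
by rewrite (_ : (fun x => _) = df)//; apply/funext => x; have [] := Hf x.
Qed.

Lemma smalg_smooth (f : V -> R) : smalg f -> smooth f.
Proof.
move=> af vs /=; set g := foldr _ _ _.
have ag : smalg g.
  by rewrite /g; elim: vs {g} => //= v vs IH; exact: smalg_derive_op.
split; first exact: smalg_continuous.
by move=> x v; have [dg _ Hg] := smalg_derive ag v; have [] := Hg x.
Qed.

End SmoothAlgebra.

Lemma clin_id : @clin R id.
Proof. by split=> // x; exact: cvg_id. Qed.

Lemma smalg_smooth1 f : @smalg R f -> smooth1 f.
Proof.
move=> af; exists (fun n => iter n (fun (h : R -> R) (x : R) => 'D_(1 : R) h x) f); split => // n x.
set g := iter n _ f; have ag : @smalg R g.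
  by rewrite /g; elim: n {g} => //= n IH; exact: smalg_derive_op.
have [dg _ Hg] := smalg_derive ag (1 : R); have [dgx dgE] := Hg x.
exact: DeriveDef.
Qed.

Lemma smooth1_smalg f : smooth1 f -> @smalg R f.
Proof. by move=> sf; exact: (smalg_line sf clin_id). Qed.

Lemma smooth1_mul f g : smooth1 f -> smooth1 g -> smooth1 (fun x => f x * g x).
Proof.
by move=> /smooth1_smalg sf /smooth1_smalg sg; exact/smalg_smooth1/smalg_mul.
Qed.

Lemma smooth1_lincomb h k f g : smooth1 f -> smooth1 g ->
  smooth1 (fun x => h * f x + k * g x).
Proof.
move=> /smooth1_smalg sf /smooth1_smalg sg.
by apply: smalg_smooth1; apply: smalg_add; exact: smalg_scale.
Qed.

Lemma smooth1_affine f h k : smooth1 f -> smooth1 (fun x => f (h * x + k)).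
Proof.
move=> [F [F0 hF]].
exists (fun n x => h ^+ n * F n (h * x + k)); split.
  by apply/funext => x; rewrite expr0 mul1r F0.
move=> n x.
have dl : is_derive x (1 : R) (fun x => h * x + k) h.
  have := is_deriveD (is_deriveZ h (is_derive_id x (1 : R))) (is_derive_cst k x (1 : R)).
  by rewrite addr0 /GRing.scale/= mulr1.
have := is_deriveZ (h ^+ n) (@is_derive1_comp R _ (fun x => h * x + k) x _ _
  (hF n (h * x + k)) dl).
move=> H; apply: (is_derive_eq H).
by rewrite /GRing.scale/= exprS; ring.
Qed.

(** [bump p q n] is smooth, vanishes outside of ]p, q[ and increases to the
    indicator of ]p, q[ as n -> oo. *)
Definition bump (p q : R) (n : nat) (x : R) : R :=
  flat n.+1%:R^-1 1 (x - p) * flat n.+1%:R^-1 1 (q - x).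

Lemma smooth1_bump (p q : R) n : smooth1 (bump p q n).
Proof.
have n0 : (0 : R) < n.+1%:R^-1 by rewrite invr_gt0.
have := smooth1_mul (smooth1_affine 1 (- p) (smooth1_flat 1 n0))
  (smooth1_affine (-1) q (smooth1_flat 1 n0)).
congr smooth1; apply/funext => x; rewrite /bump mul1r mulN1r.
by rewrite [- x + q]addrC.
Qed.

Lemma flat_ge0 c x : 0 <= flat c 1 x.
Proof. by rewrite /flat; case: ifP => // _; rewrite hornerC mul1r expR_ge0. Qed.

Lemma flat_le1 c x : 0 < c -> flat c 1 x <= 1.
Proof.
move=> c0; rewrite /flat; case: ifP => // x0; rewrite hornerC mul1r.
by rewrite -[leRHS]expR0 ler_expR oppr_le0 mulr_ge0 ?invr_ge0 ?ltW.
Qed.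

Lemma flat_cvg x : flat n.+1%:R^-1 1 x @[n --> \oo] --> ((0 < x)%R%:R : R).
Proof.
rewrite /flat; case: (ltP 0 x) => x0; last by rewrite mulr0n; exact: cvg_cst.
rewrite (_ : (fun n => _) = (fun n => expR (- (n.+1%:R^-1 * x^-1)))); last first.
  by apply/funext => n; rewrite hornerC mul1r.
rewrite [X in _ --> X](_ : _ = expR (- (0 * x^-1))); last by rewrite mul0r oppr0 expR0.
apply: continuous_cvg; first exact: continuous_expR.
by apply: cvgN; apply: cvgM; [exact: cvg_harmonic|exact: cvg_cst].
Qed.

Lemma bump_ge0 (p q : R) n x : 0 <= bump p q n x.
Proof. by rewrite mulr_ge0 ?flat_ge0. Qed.

Lemma bump_le1 (p q : R) n x : bump p q n x <= 1.
Proof. by rewrite mulr_ile1 ?flat_ge0 ?flat_le1 ?invr_gt0. Qed.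

Lemma bump_out (p q : R) n x : x \notin `]p, q[ -> bump p q n x = 0.
Proof.
rewrite in_itv/= negb_and -!leNgt /bump /flat => /orP[h|h].
  by rewrite ifF ?mul0r//; apply/negbTE; rewrite -leNgt subr_le0.
by rewrite mulrC ifF ?mul0r//; apply/negbTE; rewrite -leNgt subr_le0.
Qed.

Lemma bump_cvg (p q : R) x : bump p q n x @[n --> \oo] --> ((x \in `]p, q[)%:R : R).
Proof.
rewrite in_itv/= -mulnb natrM.
rewrite -(subr_gt0 p) -(subr_gt0 x).
exact: (cvgM (@flat_cvg (x - p)) (@flat_cvg (q - x))).
Qed.

End SmoothFunctions.

(** * A countable family of test functions; the du Bois-Reymond lemma *)

Lemma ae_forall_countable d (T : measurableType d) (R : realType)
    (m : {measure set T -> \bar R}) (I : countType) (P : I -> T -> Prop) :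
  (forall i, {ae m, forall x, P i x}) -> {ae m, forall x, forall i, P i x}.
Proof.
move=> aeP.
have H n : {ae m, forall x, if unpickle n is Some i then P i x else True}.
  by case: unpickle => [i|]; [exact: aeP|exact: aeW].
by apply: ae_imp (ae_foralln H) => x Hx i; have := Hx (pickle i); rewrite pickleK.
Qed.

Section TestFamily.
Context {R : realType}.
Local Notation mu := (@lebesgue_measure R).
Implicit Types (a b x : R) (f g h : R -> R) (i : rat * rat * nat).

(** A countable family of test functions, rich enough to detect functions
    vanishing almost everywhere; countability is what allows to exchange
    quantification over test functions and almost everywhere. *)
Definition test1 i : R -> R := bump (ratr i.1.1) (ratr i.1.2) i.2.

Definition inside a b i := a < ratr i.1.1 /\ ratr i.1.2 < b.

Lemma smooth1_continuous f : smooth1 f -> continuous f.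
Proof. by move=> /smooth1_smalg; exact: smalg_continuous. Qed.

Lemma continuous_test1 i : continuous (test1 i).
Proof. exact/smooth1_continuous/smooth1_bump. Qed.

Lemma continuous_integrable_itv a b f : continuous f ->
  mu.-integrable `[a, b] (EFin \o f).
Proof.
move=> cf; apply: continuous_compact_integrable; first exact: segment_compact.
exact: continuous_subspaceT.
Qed.

Lemma integrable_continuous_mulT a b f h : continuous f ->
  mu.-integrable `[a, b] (EFin \o h) ->
  mu.-integrable `[a, b] (EFin \o (fun s => h s * f s)).
Proof.
move=> cf ih; under [X in EFin \o X]eq_fun do rewrite mulrC.
by apply: integrable_continuous_mul => //; exact: continuous_subspaceT.
Qed.

Lemma within_continuous_rat_limit a b (F : R -> R) c : a < b ->
  {within `[a, b], continuous F} ->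
  (forall q : rat, a < ratr q < b -> F (ratr q) = c) ->
  forall x, x \in `[a, b] -> F x = c.
Proof.
move=> ab cF Fq x xab; apply/eqP; rewrite -subr_eq0 -normr_le0 leNgt.
apply/negP => Fx0.
have /cvgrPdist_lt/(_ _ Fx0) := (subspace_continuousP _ _).1 cF x xab.
rewrite near_withinE => /nbhs_ballP[d /= d0 hd].
move: xab; rewrite in_itv/= => /andP[ax xb].
have [|q] := @rat_in_itvoo R (Num.max a (x - d)) (Num.min b (x + d)).
  by rewrite lt_min !gt_max ab/=; apply/and3P; split; lra.
rewrite in_itv/= gt_max lt_min => /andP[/andP[aq xq] /andP[qb qx]].
have xbq : ball x d (ratr q).
  by rewrite /ball/= ltr_norml; apply/andP; split; lra.
have := hd _ xbq; rewrite in_itv/= !ltW// => /(_ isT).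
by rewrite /from_subspace Fq ?aq ?qb// ltxx.
Qed.

Lemma Rintegral_indic_itv a b p q h : a <= p -> p <= q -> q <= b ->
  mu.-integrable `[a, b] (EFin \o h) ->
  \int[mu]_(s in `[a, b]) (h s * (s \in `]p, q[)%:R) = \int[mu]_(s in `[p, q]) h s.
Proof.
move=> ap pq qb ih.
have ipq : mu.-integrable `[p, q] (EFin \o h) by exact: integrable_subitv ih _ _.
have -> : \int[mu]_(s in `[p, q]) h s = \int[mu]_(s in `]p, q[) h s.
  rewrite -Rintegral_itv_obnd_cbnd; last first.
    by apply: integrableS ipq => //; apply: subset_itv; rewrite bnd_simp.
  rewrite -Rintegral_itv_bndo_bndc//.
  by apply: integrableS ipq => //; apply: subset_itv; rewrite bnd_simp.
rewrite Rintegral_mkcond [RHS]Rintegral_mkcond; apply: eq_Rintegral => s _.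
rewrite !patchE; case: ifPn => sab; case: ifPn => //.
- by rewrite inE/= => ->; rewrite mulr1.
- by rewrite notin_setE/= => /negP/negbTE ->; rewrite mulr0.
- rewrite inE/= in_itv/= => /andP[ps sq]; move: sab.
  by rewrite notin_setE/= in_itv/= (le_trans ap (ltW ps)) (le_trans (ltW sq) qb).
Qed.

(** The bumps increase to the indicators of rational intervals, over which h
    thus integrates to 0: the primitive of h is constant. *)
Lemma test1_separates a b h : a < b -> mu.-integrable `[a, b] (EFin \o h) ->
  (forall i, inside a b i -> \int[mu]_(s in `[a, b]) (h s * test1 i s) = 0) ->
  {ae mu, forall s, s \in `]a, b[ -> h s = 0}.
Proof.
move=> ab ih h0; apply: (@ae_zero_of_primitive _ a b) => // x xab.
pose H s := 0 + \int[mu]_(t in `[a, s]) h t.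
have acH : ac a b H h by exact: ac_primitive.
have cH := ac_continuous (ltW ab) acH.
have pq0 (p q : rat) : a < ratr p -> ratr p < ratr q :> R -> ratr q < b ->
    \int[mu]_(s in `[ratr p, ratr q]) h s = 0.
  move=> ap pq qb.
  rewrite -(Rintegral_indic_itv (ltW ap) (ltW pq) (ltW qb) ih).
  have [|||||_ cv] := @Rintegral_dominated_cvg _ _ _ mu `[a, b]
    (fun n s => h s * test1 (p, q, n) s)
    (fun s => h s * (s \in `]ratr p, ratr q[)%:R) (fun s => `|h s|).
  - by [].
  - move=> n; have /integrableP[/measurable_EFinP] :=
      integrable_continuous_mulT (@continuous_test1 (p, q, n)) ih.
    by [].
  - by move=> s _; apply: cvgM; [exact: cvg_cst|exact: bump_cvg].
  - exact: integrable_norm.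
  - move=> n s _; rewrite normrM (ger0_norm (bump_ge0 _ _ _ _)).
    by rewrite ler_piMr//; exact: bump_le1.
  apply: (cvg_unique _ cv) => //.
  rewrite (_ : (fun n => _) = (fun=> 0)); first exact: cvg_cst.
  by apply/funext => n; rewrite h0.
have [|p0] := @rat_in_itvoo R a b; first by [].
rewrite in_itv/= => /andP[ap0 p0b].
have Hq (q : rat) : a < ratr q < b -> H (ratr q) = H (ratr p0).
  move=> /andP[aq qb]; apply/eqP; rewrite -subr_eq0; apply/eqP.
  have [_ hH] := acH.
  case: (ltgtP (ratr q : R) (ratr p0)) => [qp|pq|->]; last by rewrite subrr.
  - by rewrite -opprB hH ?ltW// pq0// oppr0.
  - by rewrite hH ?ltW// pq0.
have Hc := within_continuous_rat_limit ab cH Hq.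
have : H x = H a by rewrite !Hc// in_itv/= lexx ltW.
by rewrite /H !add0r set_itv1 Rintegral_set1.
Qed.

(** The functions [test1 i - k test1 j] with vanishing integral are the
    derivatives of test functions. *)
Definition mean a b i := \int[mu]_(s in `[a, b]) test1 i s.

Definition test1_deriv a b j i s :=
  test1 i s - mean a b i / mean a b j * test1 j s.

Definition test1_prim a b j i s := \int[mu]_(t in `[a, s]) test1_deriv a b j i t.

Lemma smooth1_test1_deriv a b j i : smooth1 (test1_deriv a b j i).
Proof.
have := smooth1_lincomb 1 (- (mean a b i / mean a b j))
  (smooth1_bump (ratr i.1.1) (ratr i.1.2) i.2)
  (smooth1_bump (ratr j.1.1) (ratr j.1.2) j.2).
by congr smooth1; apply/funext => s; rewrite mul1r mulNr.
Qed.

Let continuous_deriv a b j i := smooth1_continuous (smooth1_test1_deriv a b j i).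

Lemma ac_test1_prim a b j i : ac a b (test1_prim a b j i) (test1_deriv a b j i).
Proof.
have := ac_primitive 0 (continuous_integrable_itv a b (@continuous_deriv a b j i)).
by congr ac; apply/funext => s; rewrite add0r.
Qed.

(** To the right of both supports the primitive is the whole integral of
    [test1_deriv], which vanishes by the choice of the coefficient. *)
Lemma test1_prim_out a b j i : a < b -> inside a b j -> inside a b i ->
  mean a b j != 0 -> exists c d, [/\ a < c, d < b &
    forall s, s \notin `[c, d] -> test1_prim a b j i s = 0].
Proof.
move=> ab [aj jb] [ai ib] mj0.
pose c := Num.min (ratr j.1.1) (ratr i.1.1) : R.
pose d := Num.max (ratr j.1.2) (ratr i.1.2) : R.
have ac_ : a < c by rewrite lt_min aj ai.
have db : d < b by rewrite gt_max jb ib.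
have out s : s \notin `[c, d] -> test1_deriv a b j i s = 0.
  rewrite in_itv/= negb_and -!ltNge => scd.
  rewrite /test1_deriv /test1 !bump_out ?mulr0 ?subr0// in_itv/= negb_and -!leNgt.
    by case/orP: scd; rewrite ?lt_min ?gt_max => /andP[h1 h2];
      [rewrite (ltW h1)|rewrite (ltW h1) orbT].
  by case/orP: scd; rewrite ?lt_min ?gt_max => /andP[h1 h2];
      [rewrite (ltW h2)|rewrite (ltW h2) orbT].
exists c, d; split => // s scd.
move: (scd); rewrite in_itv/= negb_and -!ltNge => /orP[sc|ds].
  rewrite /test1_prim (@eq_Rintegral _ _ _ _ _ (fun=> 0)); last first.
    move=> t; rewrite inE/= in_itv/= => /andP[_ ts]; apply: out.
    by rewrite in_itv/= negb_and -!ltNge (le_lt_trans ts sc).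
  by rewrite Rintegral_cst// mul0r.
have ad : a <= Num.max d a by rewrite le_max lexx orbT.
have full : test1_prim a b j i b = 0.
  rewrite /test1_prim RintegralB//=.
  - rewrite RintegralZl//; last exact: continuous_integrable_itv (@continuous_test1 j).
    by rewrite -/(mean a b i) -/(mean a b j) divfK// subrr.
  - exact: continuous_integrable_itv (@continuous_test1 i).
  - have := continuous_integrable_itv a b (@continuous_test1 j).
    exact: (@integrableZl _ _ _ mu _ _ (mean a b i / mean a b j)).
case: (ltP s a) => sa.
  by rewrite /test1_prim set_itv_ge ?Rintegral_set0// bnd_simp -ltNge.
have zero x y : d < x -> \int[mu]_(t in `[x, y]) test1_deriv a b j i t = 0.
  move=> dx; rewrite (@eq_Rintegral _ _ _ _ _ (fun=> 0)); last first.
    move=> t; rewrite inE/= in_itv/= => /andP[xt _]; apply: out.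
    by rewrite in_itv/= negb_and -!ltNge (lt_le_trans dx xt) orbT.
  by rewrite Rintegral_cst// mul0r.
have split_ x y : a <= x -> x <= y -> test1_prim a b j i y =
    test1_prim a b j i x + \int[mu]_(t in `[x, y]) test1_deriv a b j i t.
  move=> ax xy.
  have iy := continuous_integrable_itv a y (@continuous_deriv a b j i).
  have /eqP := Rintegral_itv_split ax xy iy.
  by rewrite subr_eq addrC => /eqP.
case: (leP s b) => sb.
  by move: full; rewrite (split_ s b)// zero// addr0.
by rewrite (split_ b s) ?ltW// full zero// addr0.
Qed.

Lemma is_derive_test1_prim a b j i (s : R) : a < b -> inside a b j ->
  inside a b i -> mean a b j != 0 ->
  is_derive s (1 : R) (test1_prim a b j i) (test1_deriv a b j i s).
Proof.
move=> ab aj ai mj0.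
have cd := @continuous_deriv a b j i.
have [c [d [ac_ db out]]] := test1_prim_out ab aj ai mj0.
case: (leP s a) => sa; last first.
  have ss : s < s + 1 by rewrite ltrDl.
  have [|ds dE] := continuous_FTC1_closed ss (continuous_integrable_itv a (s + 1) cd) sa.
    exact: cd.
  by apply: DeriveDef; [exact: ds|rewrite -derive1E; exact: dE].
have s0 : test1_deriv a b j i s = 0.
  have sc : s < Num.min (ratr j.1.1) (ratr i.1.1).
    by rewrite (le_lt_trans sa)// lt_min aj.1 ai.1.
  move: sc; rewrite lt_min => /andP[sj si].
  by rewrite /test1_deriv /test1 !bump_out ?mulr0 ?subr0// in_itv/= negb_and
    -!leNgt ?(ltW sj) ?(ltW si).
rewrite s0; apply: (near_eq_is_derive _ (is_derive_cst 0 s 1)); near=> y.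
rewrite out// in_itv/= negb_and -!ltNge; apply/orP; left.
by near: y; apply: lt_nbhsl; exact: le_lt_trans ac_.
Unshelve. all: by end_near. Qed.

Lemma smooth1_test1_prim a b j i : a < b -> inside a b j -> inside a b i ->
  mean a b j != 0 -> smooth1 (test1_prim a b j i).
Proof.
move=> ab aj ai mj0; apply: (smooth1_primitive _ (smooth1_test1_deriv a b j i)).
by move=> s; exact: is_derive_test1_prim.
Qed.

Lemma exists_mean_neq0 a b : a < b -> exists j, inside a b j /\ mean a b j != 0.
Proof.
move=> ab; have [|p] := @rat_in_itvoo R a b; first by [].
rewrite in_itv/= => /andP[ap pb].
have [|q] := @rat_in_itvoo R (ratr p) b; first by [].
rewrite in_itv/= => /andP[pq qb].
have h1 : mu.-integrable `[a, b] (EFin \o (fun=> 1)).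
  by apply: continuous_integrable_itv => x; exact: cvg_cst.
have [|||||_ cv] := @Rintegral_dominated_cvg _ _ _ mu `[a, b]
  (fun n s => 1 * test1 (p, q, n) s)
  (fun s => 1 * (s \in `]ratr p, ratr q[)%:R) (fun=> 1).
- by [].
- move=> n; have /integrableP[/measurable_EFinP] :=
    integrable_continuous_mulT (@continuous_test1 (p, q, n)) h1.
  by [].
- by move=> s _; apply: cvgM; [exact: cvg_cst|exact: bump_cvg].
- exact: h1.
- move=> n s _; rewrite mul1r (ger0_norm (bump_ge0 _ _ _ _)).
  exact: bump_le1.
move: cv; rewrite (Rintegral_indic_itv (ltW ap) (ltW pq) (ltW qb) h1).
rewrite Rintegral_cst//= lebesgue_measure_itv/= lte_fin pq/= mul1r => cv.
apply: contrapT => /forallNP H.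
have : ratr q - ratr p = 0 :> R.
  apply: (cvg_unique _ cv) => //.
  rewrite (_ : (fun n => _) = (fun=> 0)); first exact: cvg_cst.
  apply/funext => n; apply/eqP/negPn/negP => m0.
  apply: (H (p, q, n)); split => //; rewrite /mean.
  by under eq_Rintegral do rewrite -[test1 _ _]mul1r.
by move/eqP; rewrite subr_eq0 gt_eqF.
Qed.

(** Du Bois-Reymond. Integration by parts shows that f minus the primitive of
    g is orthogonal to every [test1_deriv]; once its mean against [test1 j] is
    subtracted, it is orthogonal to every [test1 i], hence null. *)
Lemma du_bois_reymond a b j f g : a < b -> inside a b j -> mean a b j != 0 ->
  mu.-integrable `[a, b] (EFin \o f) -> mu.-integrable `[a, b] (EFin \o g) ->
  (forall i, inside a b i -> \int[mu]_(s in `[a, b])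
     (f s * test1_deriv a b j i s + g s * test1_prim a b j i s) = 0) ->
  exists c, {ae mu, forall s, s \in `]a, b[ ->
    f s = c + \int[mu]_(t in `[a, s]) g t}.
Proof.
move=> ab aj mj0 if_ ig fg0.
pose G s := 0 + \int[mu]_(t in `[a, s]) g t.
have acG : ac a b G g by exact: ac_primitive.
have cG := ac_continuous (ltW ab) acG.
have iG : mu.-integrable `[a, b] (EFin \o G).
  apply: continuous_compact_integrable => //; exact: segment_compact.
pose h s := f s - G s.
have ih : mu.-integrable `[a, b] (EFin \o h) by exact: (integrableB _ if_ iG).
have h0 i : inside a b i ->
    \int[mu]_(s in `[a, b]) (h s * test1_deriv a b j i s) = 0.
  move=> ai; have acp := ac_test1_prim a b j i.
  have [ip hp] := ac_mul (ltW ab) acG acp.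
  have [c [d [ac_ db out]]] := test1_prim_out ab aj ai mj0.
  have pa : test1_prim a b j i a = 0.
    by apply: out; rewrite in_itv/= negb_and -!ltNge ac_.
  have pb : test1_prim a b j i b = 0.
    by apply: out; rewrite in_itv/= negb_and -!ltNge db orbT.
  have E := hp a b (lexx a) (ltW ab) (lexx b).
  rewrite pa pb !mulr0 subrr in E.
  have cd := @continuous_deriv a b j i.
  have ifd := integrable_continuous_mulT cd if_.
  have cp := ac_continuous (ltW ab) acp.
  have igp := integrable_continuous_mul cp ig.
  have ifg : mu.-integrable `[a, b] (EFin \o (fun s =>
      f s * test1_deriv a b j i s + g s * test1_prim a b j i s)).
    have := integrableD _ ifd igp.
    by move=> /(_ (measurable_itv _)); apply: eq_integrable => // s _ /=;
      rewrite EFinD [g s * _]mulrC.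
  rewrite (_ : (fun s => _) = (fun s =>
      (f s * test1_deriv a b j i s + g s * test1_prim a b j i s) -
      (G s * test1_deriv a b j i s + g s * test1_prim a b j i s))); last first.
    by apply/funext => s; rewrite /h; ring.
  by rewrite RintegralB// fg0// -E subrr.
exists (\int[mu]_(s in `[a, b]) (h s * test1 j s) / mean a b j).
set c := _ / _.
have ihj i : mu.-integrable `[a, b] (EFin \o (fun s => h s * test1 i s)).
  exact: integrable_continuous_mulT (@continuous_test1 i) ih.
have it i : mu.-integrable `[a, b] (EFin \o test1 i).
  exact: continuous_integrable_itv (@continuous_test1 i).
have ic : mu.-integrable `[a, b] (EFin \o (fun=> c)).
  by apply: continuous_integrable_itv => x; exact: cvg_cst.
have : {ae mu, forall s, s \in `]a, b[ -> h s - c = 0}.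
  apply: test1_separates ab _ _; first exact: (integrableB _ ih ic).
  move=> i ai.
  have -> : \int[mu]_(s in `[a, b]) ((h s - c) * test1 i s) =
      \int[mu]_(s in `[a, b]) (h s * test1 i s) - c * mean a b i.
    rewrite /mean -RintegralZl// -RintegralB//; last first.
      exact: (@integrableZl _ _ _ mu _ _ c _ (it i)).
    by apply: eq_Rintegral => s _; rewrite mulrBl.
  apply/eqP; rewrite subr_eq0 /c mulrAC -mulrA mulrC -[X in _ == X]RintegralZl//.
  rewrite -subr_eq0 -RintegralB//; last first.
    exact: (@integrableZl _ _ _ mu _ _ (mean a b i / mean a b j) _ (ihj j)).
  rewrite -[X in _ == X](h0 i ai); apply/eqP; apply: eq_Rintegral => s _.
  by rewrite /test1_deriv; ring.
apply: ae_imp => s + /[dup] => /[apply] /eqP + _.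
by rewrite /h subr_eq0 subr_eq => /eqP ->; rewrite /G add0r.
Qed.

End TestFamily.

(** * Product measures and real-valued Fubini *)

Section FubiniTools.
Context d1 d2 (T1 : measurableType d1) (T2 : measurableType d2) (R : realType).
Variables (m1 : {sigma_finite_measure set T1 -> \bar R}).
Variables (m2 : {sigma_finite_measure set T2 -> \bar R}).
Local Notation m12 := (m1 \x m2)%E.

Lemma product_measure12 (A : set (T1 * T2)) : measurable A ->
  m12 A = (m1 \x^ m2)%E A.
Proof.
by move=> mA; apply: product_measure_unique => // ? ? ? ?; exact: product_measure2E.
Qed.

Lemma ae_product1 (P : T1 * T2 -> Prop) : {ae m12, forall p, P p} ->
  {ae m1, forall x, {ae m2, forall y, P (x, y)}}.
Proof.
move=> [N [mN N0 PN]].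
have mf : measurable_fun setT (m2 \o xsection N) by exact: measurable_fun_xsection.
have : (\int[m1]_x `|(m2 \o xsection N) x| = 0)%E.
  rewrite -[RHS]N0; apply: eq_integral => x _.
  by rewrite gee0_abs.
move/(ae_eq_integral_abs _ measurableT mf).
apply: ae_imp => x /(_ I) /= xN0.
exists (xsection N x); split => //; first exact: measurable_xsection.
by move=> y /= nP; rewrite /xsection/= inE; apply: PN.
Qed.

Lemma product_ae1 (P : set (T1 * T2)) : measurable P ->
  {ae m1, forall x, {ae m2, forall y, P (x, y)}} -> {ae m12, forall p, P p}.
Proof.
move=> mP aeP; exists (~` P); split => //; first exact: measurableC.
have mf : measurable_fun setT (m2 \o xsection (~` P)).
  by apply: measurable_fun_xsection; exact: measurableC.
have H : {ae m1, forall x, setT x -> (m2 \o xsection (~` P)) x = cst 0%E x}.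
  apply: ae_imp aeP => x [N [mN N0 PN]] _ /=.
  apply/eqP; rewrite -measure_le0 -N0 le_measure ?inE//.
    by apply: measurable_xsection; exact: measurableC.
  by move=> y; rewrite /xsection/= inE; exact: PN.
have := (ae_eq_integral_abs m1 measurableT mf).2 H.
rewrite /product_measure1 => <-; apply: eq_integral => x _.
by rewrite gee0_abs.
Qed.

Lemma product_ae2 (P : set (T1 * T2)) : measurable P ->
  {ae m2, forall y, {ae m1, forall x, P (x, y)}} -> {ae m12, forall p, P p}.
Proof.
move=> mP aeP; exists (~` P); split => //; first exact: measurableC.
have mf : measurable_fun setT (m1 \o ysection (~` P)).
  by apply: measurable_fun_ysection; exact: measurableC.
have H : {ae m2, forall x, setT x -> (m1 \o ysection (~` P)) x = cst 0%E x}.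
  apply: ae_imp aeP => x [N [mN N0 PN]] _ /=.
  apply/eqP; rewrite -measure_le0 -N0 le_measure ?inE//.
    by apply: measurable_ysection; exact: measurableC.
  by move=> y; rewrite /ysection/= inE; exact: PN.
have := (ae_eq_integral_abs m2 measurableT mf).2 H.
rewrite product_measure12; last exact: measurableC.
rewrite /product_measure2 => <-; apply: eq_integral => x _.
by rewrite gee0_abs.
Qed.

Section RealFubini.
Variables (A : set T1) (B : set T2) (F : T1 * T2 -> R).
Hypotheses (mA : measurable A) (mB : measurable B).
Hypothesis iF : m12.-integrable (A `*` B) (EFin \o F).
Let G : T1 * T2 -> \bar R := (EFin \o F) \_ (A `*` B).

Let mAB : measurable (A `*` B). Proof. exact: measurableX. Qed.

Let iG : m12.-integrable setT G.
Proof. by apply/(integrable_mkcond _ mAB).1. Qed.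

Let G1 x : A x -> (fun y => G (x, y)) = (fun y => (F (x, y))%:E) \_ B.
Proof.
move=> Ax; apply/funext => y; rewrite /G !patchE.
rewrite (_ : ((x, y) \in A `*` B) = (y \in B))//.
by apply/idP/idP; rewrite !inE/=; [case|].
Qed.

Let G2 y : B y -> (fun x => G (x, y)) = (fun x => (F (x, y))%:E) \_ A.
Proof.
move=> By; apply/funext => x; rewrite /G !patchE.
rewrite (_ : ((x, y) \in A `*` B) = (x \in A))//.
by apply/idP/idP; rewrite !inE/=; [case|].
Qed.

Lemma fine_integrable d (T : measurableType d) (m : {measure set T -> \bar R})
    (D : set T) (h : T -> \bar R) : measurable D -> m.-integrable D h ->
  m.-integrable D (EFin \o (fine \o h)) /\
  (\int[m]_(x in D) (EFin \o (fine \o h)) x = \int[m]_(x in D) h x)%E.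
Proof.
move=> mD ih; have mh := measurable_int m ih.
have mfh : measurable_fun D (EFin \o (fine \o h)).
  apply/measurable_EFinP; apply: measurableT_comp mh.
  exact: fine_measurable.
split.
  apply: (le_integrable mD mfh _ ih) => x Dx /=.
  by case: (h x) => [r| |]//=; rewrite normr0 leey.
apply: ae_eq_integral => //.
apply: ae_imp (integrable_ae mD ih) => x hx Dx /=.
by rewrite fineK// hx.
Qed.

Lemma Rfubini1 :
  [/\ {ae m1, forall x, A x -> m2.-integrable B (fun y => (F (x, y))%:E)},
      m1.-integrable A (EFin \o (fun x => \int[m2]_(y in B) F (x, y))) &
      \int[m12]_(z in A `*` B) F z =
      \int[m1]_(x in A) (\int[m2]_(y in B) F (x, y))].
Proof.
have FE : fubini_F m2 G = (fun x => \int[m2]_(y in B) (F (x, y))%:E)%E \_ A.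
  apply/funext => x; rewrite /fubini_F patchE; case: ifPn => xA.
    by rewrite [RHS]integral_mkcond -G1//; exact/set_mem.
  rewrite integral0_eq// => y _; rewrite /G patchE ifF//.
  by apply/negbTE; rewrite notin_setE/= => -[/mem_set]; rewrite (negbTE xA).
have iFF : m1.-integrable A (fun x => \int[m2]_(y in B) (F (x, y))%:E)%E.
  by apply/(integrable_mkcond _ mA).2; rewrite -FE; exact: integrable_fubini_F.
have [i1 i2] := fine_integrable mA iFF.
split.
- apply: ae_imp (ae_integrable1 iG) => x /= + Ax; rewrite G1// => h.
  exact/(integrable_mkcond _ mB).2.
- exact: i1.
- rewrite /Rintegral i2 integral_mkcond -/G -(integral12_prod_meas1 iG) FE.
  by rewrite -integral_mkcond.
Qed.

Lemma Rfubini2 :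
  [/\ {ae m2, forall y, B y -> m1.-integrable A (fun x => (F (x, y))%:E)},
      m2.-integrable B (EFin \o (fun y => \int[m1]_(x in A) F (x, y))) &
      \int[m12]_(z in A `*` B) F z =
      \int[m2]_(y in B) (\int[m1]_(x in A) F (x, y))].
Proof.
have FE : fubini_G m1 G = (fun y => \int[m1]_(x in A) (F (x, y))%:E)%E \_ B.
  apply/funext => y; rewrite /fubini_G patchE; case: ifPn => yB.
    by rewrite [RHS]integral_mkcond -G2//; exact/set_mem.
  rewrite integral0_eq// => x _; rewrite /G patchE ifF//.
  by apply/negbTE; rewrite notin_setE/= => -[_ /mem_set]; rewrite (negbTE yB).
have iFF : m2.-integrable B (fun y => \int[m1]_(x in A) (F (x, y))%:E)%E.
  apply/(integrable_mkcond _ mB).2; rewrite -FE.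
  have mG := measurable_int _ iG.
  have mfG : measurable_fun setT (fubini_G m1 G) by exact: measurable_fubini_G iG.
  apply/integrableP; split => //.
  apply: le_lt_trans ((integrable21ltyP m1 m2 mG).1 iG).
  apply: ge0_le_integral => //.
  - by apply: measurableT_comp.
  - apply: (measurable_fun_fubini_tonelli_G (abse \o G)).
      exact: measurableT_comp.
    by move=> p; exact: abse_ge0.
  - move=> y _; apply: le_abse_integral => //.
    exact: measurableT_comp mG (pair2_measurable y).
have [i1 i2] := fine_integrable mB iFF.
split.
- apply: ae_imp (ae_integrable2 iG) => y /= + By; rewrite G2// => h.
  exact/(integrable_mkcond _ mA).2.
- exact: i1.
- rewrite /Rintegral i2 integral_mkcond -/G -(integral21_prod_meas1 iG) FE.
  by rewrite -integral_mkcond.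
Qed.

End RealFubini.
End FubiniTools.

(** * Lebesgue measure on lines and in the plane *)

Section LineTools.
Context {R : realType}.
Local Notation mu := (@lebesgue_measure R).
Local Notation mR := (measurableTypeR R).
Implicit Types (a b x : R) (f g F : R -> R).

Definition shiftR (h : R) : mR -> mR := fun s => s + h.

Lemma measurable_shiftR (h : R) : measurable_fun setT (shiftR h).
Proof.
have : measurable_fun setT (fun s : R => s + h).
  by apply: measurable_funD => //; exact: measurable_cst.
by [].
Qed.

HB.instance Definition _ (h : R) :=
  isMeasurableFun.Build _ _ mR mR (shiftR h) (measurable_shiftR h).

Lemma lebesgue_measure_shift (h : R) (A : set mR) : measurable A ->
  pushforward mu (shiftR h) A = mu A.
Proof.
move=> mA; apply/esym/lebesgue_measure_unique => //= _ [[a b]] _ <-.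
rewrite /pushforward.
have -> : shiftR h @^-1` `]a, b]%classic = `]a - h, b - h]%classic.
  by apply/seteqP; split => s /=; rewrite /shiftR !in_itv/= ltrBlDr lerBrDr.
rewrite !lebesgue_measure_itv/= !lte_fin ltrD2r; case: ifP => // _.
by rewrite -!EFinB; congr EFin; ring.
Qed.

(** Difference quotients evaluate identities valid almost everywhere at
    shifted points. *)
Lemma ae_shift (h : R) (P : R -> Prop) : {ae mu, forall s, P s} ->
  {ae mu, forall s, P (s + h)}.
Proof.
move=> [N [mN N0 PN]]; exists (shiftR h @^-1` N); split.
- by rewrite -[X in measurable X]setTI; exact: measurable_shiftR.
- by have := lebesgue_measure_shift h mN; rewrite N0.
- by move=> s /= nP; exact: PN.
Qed.

Lemma C1_ac a b f g : (forall s : R, is_derive s (1 : R) f (g s)) ->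
  continuous g -> ac a b f g.
Proof.
move=> fg cg; split; first exact: continuous_integrable_itv.
have cf : continuous f.
  by move=> s; apply: differentiable_continuous; apply/derivable1_diffP; have [] := fg s.
move=> x y ax; rewrite le_eqVlt => /orP[/eqP -> _|xy yb].
  by rewrite set_itv1 Rintegral_set1 subrr.
rewrite /Rintegral (@continuous_FTC2 _ g f x y) => //.
- exact: continuous_subspaceT.
- split.
  + by move=> s _; have [] := fg s.
  + by apply: cvg_at_right_filter; exact: cf.
  + by apply: cvg_at_left_filter; exact: cf.
- by move=> s _; rewrite derive1E; have [] := fg s.
Qed.

Lemma ac_parts0 a b F f G g : a <= b -> ac a b F f -> ac a b G g ->
  G a = 0 -> G b = 0 -> \int[mu]_(s in `[a, b]) (F s * g s + f s * G s) = 0.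
Proof.
move=> ab acF acG Ga Gb; have [_ h] := ac_mul ab acF acG.
by rewrite -h// Ga Gb !mulr0 subrr.
Qed.

Lemma ae_eq_Rintegral (d : measure_display) (T : measurableType d)
    (m : {measure set T -> \bar R}) (D : set T) (f g : T -> R) :
  measurable D -> m.-integrable D (EFin \o f) -> measurable_fun D g ->
  {ae m, forall s, D s -> f s = g s} ->
  m.-integrable D (EFin \o g) /\ \int[m]_(s in D) f s = \int[m]_(s in D) g s.
Proof.
move=> mD if_ mg fg.
have mf := measurable_int _ if_.
have mg' : measurable_fun D (EFin \o g) by exact/measurable_EFinP.
have E : ae_eq m D (EFin \o f) (EFin \o g).
  by apply: ae_imp fg => s h Ds /=; rewrite h.
split; last by rewrite /Rintegral (@ae_eq_integral _ _ _ m D _ _ mD mf mg' E).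
apply/integrableP; split => //.
have [_] := integrableP _ _ _ if_.
rewrite (@ae_eq_integral _ _ _ m D _ _ mD _ _ (ae_eq_abse E))//;
  exact: measurableT_comp.
Qed.

(** The family of open rectangles with rational vertices is countable, so the
    open sets of the plane belong to the product sigma-algebra. *)
Lemma open_measurable2 (O : set (R * R)) : open O ->
  measurable (O : set (mR * mR)).
Proof.
move=> oO.
pose rect (i : (rat * rat) * (rat * rat)) : set (mR * mR) :=
  `]ratr i.1.1, ratr i.1.2[%classic `*` `]ratr i.2.1, ratr i.2.2[%classic.
have -> : O = \bigcup_(i in [set i | rect i `<=` O]) rect i.
  apply/seteqP; split => [[x y] Oxy|p [i /= ? ?]]; last by auto.
  have /nbhs_ballP[e /= e0 he] : nbhs (x, y) O by exact: open_nbhs_nbhs.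
  have xe : x - e < x by rewrite ltrBlDr ltrDl.
  have ex : x < x + e by rewrite ltrDl.
  have ye : y - e < y by rewrite ltrBlDr ltrDl.
  have ey : y < y + e by rewrite ltrDl.
  have [p1] := rat_in_itvoo xe; have [q1] := rat_in_itvoo ex.
  have [p2] := rat_in_itvoo ye; have [q2] := rat_in_itvoo ey.
  rewrite !in_itv/= => /andP[yq2 q2y] /andP[yp2 p2y] /andP[xq1 q1x] /andP[xp1 p1x].
  exists ((p1, q1), (p2, q2)); last by split => /=; rewrite in_itv/=; apply/andP.
  move=> [s t] [/= ]; rewrite !in_itv/= => /andP[? ?] /andP[? ?].
  apply: he; split; rewrite /ball/= ltr_norml; apply/andP; split; lra.
rewrite bigcup_mkcond; apply: countable_bigcupT_measurable => // i.
by case: ifP => // _; apply: measurableX; exact: measurable_itv.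
Qed.

End LineTools.

Lemma continuous_measurable2 (R : realType) (f : R * R -> R) : continuous f ->
  measurable_fun (setT : set (measurableTypeR R * measurableTypeR R)) f.
Proof.
move=> cf; apply: (measurability _ (RGenOInfty.measurableE R)).
move=> _ [_ [r ->] <-]; rewrite setTI; apply: open_measurable2.
rewrite set_itvoy; have /continuousP h := cf; apply: h; exact: open_gt.
Qed.

Section TestFunctions.
Context {R : realType}.

Lemma test_function_of_smalg (V : normedModType R) (U K : set V) (f : V -> R) :
  smalg f -> compact K -> K `<=` U -> (forall x, ~ K x -> f x = 0) ->
  test_function U f.
Proof.
move=> af cK KU f0; have clK : closed K.
  by apply: compact_closed => //; exact: norm_hausdorff.
have sK : closure [set x | f x != 0] `<=` K.
  rewrite [X in _ `<=` X](closure_id K).1//; apply: closure_subset => x /= fx.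
  by apply: contrapT => /f0; exact/eqP.
split; first exact: smalg_smooth.
- by apply: subclosed_compact cK sK; exact: closed_closure.
- exact: subset_trans sK KU.
Qed.

Lemma test_function_derivative (V : normedModType R) (U : set V) (f : V -> R)
    (v : V) : test_function U f ->
  [/\ continuous f, continuous (fun x => 'D_v f x),
      forall x, is_derive x v f ('D_v f x) &
      forall x, ~ closure [set x | f x != 0] x -> f x = 0 /\ 'D_v f x = 0].
Proof.
move=> [sf _ _]; have [cf df] := sf [::]; have [cdf _] := sf [:: v].
split; [exact: cf|exact: cdf| |].
  by move=> x; apply: DeriveDef; [exact: df|].
move=> x nx.
have f0 y : ~ closure [set x | f x != 0] y -> f y = 0.
  move=> ny; apply/eqP; apply: contrapT => /negP fy; apply: ny.
  exact: subset_closure.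
split; first exact: f0.
have : \forall y \near x, f y = cst 0 y.
  have : nbhs x (~` closure [set x | f x != 0]).
    by apply: open_nbhs_nbhs; split => //; apply: closed_openC; exact: closed_closure.
  by apply: filterS => y; exact: f0.
by move=> /(near_eq_derive v) ->; rewrite derive_cst.
Qed.

Lemma clin_fst : @clin R (R * R)%type fst.
Proof. by split=> [x|//]; exact: cvg_fst. Qed.

Lemma clin_snd : @clin R (R * R)%type snd.
Proof. by split=> [x|//]; exact: cvg_snd. Qed.

End TestFunctions.

(** * Weak derivatives restricted to lines *)

(** The two coordinate directions of the plane are treated together: [pt d s z]
    is the point with coordinate s in direction d and z in the other one. *)
Section Directions.
Context {R : realType}.
Local Notation mu := (@lebesgue_measure R).
Local Notation mR := (measurableTypeR R).
Implicit Types (d : bool) (a b c e s z : R) (p : R * R) (f g : R * R -> R).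

Definition pt d s z : R * R := if d then (s, z) else (z, s).

Definition dirv d : R * R := pt d 1 0.

Definition along d p : R := if d then p.1 else p.2.

Definition across d p : R := if d then p.2 else p.1.

Lemma along_pt d s z : along d (pt d s z) = s. Proof. by case: d. Qed.

Lemma across_pt d s z : across d (pt d s z) = z. Proof. by case: d. Qed.

Lemma pt_shift d s z h : pt d s z + h *: dirv d = pt d (s + h) z.
Proof.
by case: d; rewrite /dirv /pt; apply/pair_equal_spec; split;
  rewrite /= /GRing.scale/= ?mulr1 ?mulr0 ?addr0.
Qed.

Lemma clin_along d : clin (along d).
Proof. by case: d; [exact: clin_fst|exact: clin_snd]. Qed.

Lemma clin_across d : clin (across d).
Proof. by case: d; [exact: clin_snd|exact: clin_fst]. Qed.

Definition box d a b c e : set (R * R) :=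
  [set p | along d p \in `[a, b] /\ across d p \in `[c, e]].

Lemma boxE d a b c e : box d a b c e =
  if d then `[a, b]%classic `*` `[c, e]%classic
  else `[c, e]%classic `*` `[a, b]%classic.
Proof.
by case: d; apply/seteqP; split => -[x y] [].
Qed.

Lemma measurable_box d a b c e :
  measurable (box d a b c e : set (mR * mR)).
Proof. by rewrite boxE; case: d; apply: measurableX; exact: measurable_itv. Qed.

Lemma compact_box d a b c e : compact (box d a b c e).
Proof. by rewrite boxE; case: d; apply: compact_setX; exact: segment_compact. Qed.

Lemma Rfubini_box d a b c e f : leb2.-integrable (box d a b c e) (EFin \o f) ->
  [/\ {ae mu, forall z, z \in `[c, e] ->
        mu.-integrable `[a, b] (EFin \o (fun s => f (pt d s z)))},
      mu.-integrable `[c, e] (EFin \o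
        (fun z => \int[mu]_(s in `[a, b]) f (pt d s z))) &
      \int[leb2]_(p in box d a b c e) f p =
      \int[mu]_(z in `[c, e]) (\int[mu]_(s in `[a, b]) f (pt d s z))].
Proof.
rewrite boxE /leb2; case: d => i.
- have [h1 h2 h3] := @Rfubini2 _ _ mR mR R mu mu `[a, b]%classic `[c, e]%classic
    f (measurable_itv _) (measurable_itv _) i.
  split; [exact: h1|exact: h2|exact: h3].
- have [h1 h2 h3] := @Rfubini1 _ _ mR mR R mu mu `[c, e]%classic `[a, b]%classic
    f (measurable_itv _) (measurable_itv _) i.
  split; [exact: h1|exact: h2|exact: h3].
Qed.

Lemma Rintegral_support (d0 : measure_display) (T : measurableType d0)
    (m : {measure set T -> \bar R}) (D K : set T) (f : T -> R) : K `<=` D ->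
  (forall x, ~ K x -> f x = 0) ->
  \int[m]_(x in D) f x = \int[m]_(x in K) f x.
Proof.
move=> KD f0; rewrite Rintegral_mkcond [RHS]Rintegral_mkcond.
apply: eq_Rintegral => x _; rewrite !patchE.
case: ifPn => xD; case: ifPn => xK //.
- by apply: f0; move: xK; rewrite notin_setE.
- by move: xD; rewrite notin_setE => nD; case: nD; apply: KD; exact/set_mem.
Qed.

Definition tens d (phi om : R -> R) p := phi (along d p) * om (across d p).

Lemma derive_tens d phi om (dphi : R -> R) p : smooth1 om ->
  (forall s : R, is_derive s (1 : R) phi (dphi s)) ->
  'D_(dirv d) (tens d phi om) p = tens d dphi om p.
Proof.
move=> [F [<- hF]] hphi.
have h1 := is_derive_line (dirv d) (clin_along d) (hphi (along d p)).
have h2 := is_derive_line (dirv d) (clin_across d) (hF 0%N (across d p)).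
have [_ ->] := is_deriveM h1 h2.
rewrite /dirv along_pt across_pt /GRing.scale/= mul0r mulr0 add0r mul1r /tens.
by rewrite mulrC.
Qed.

Lemma test_function_tens (U : set (R * R)) d a b c e phi om :
  smooth1 phi -> smooth1 om -> box d a b c e `<=` U ->
  (forall s, s \notin `[a, b] -> phi s = 0) ->
  (forall s, s \notin `[c, e] -> om s = 0) ->
  test_function U (tens d phi om).
Proof.
move=> sphi som bU phi0 om0.
apply: (@test_function_of_smalg R _ U (box d a b c e)) => //.
- apply: smalg_mul; first exact: smalg_line sphi (clin_along d).
  exact: smalg_line som (clin_across d).
- exact: compact_box.
- move=> p /not_andP[/negP h|/negP h].
    by rewrite /tens phi0 ?mul0r.
  by rewrite /tens om0 ?mulr0.
Qed.

Lemma box_integrable_mul d a b c e f (w : R * R -> R) : continuous w ->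
  leb2.-integrable (box d a b c e) (EFin \o f) ->
  leb2.-integrable (box d a b c e) (EFin \o (fun p => f p * w p)).
Proof.
move=> cw i_f.
have /compact_bounded[M [Mr HM]] :=
  continuous_compact (continuous_subspaceT cw) (@compact_box d a b c e).
rewrite (_ : (fun p => f p * w p) = (fun p => w p * f p)); last first.
  by apply/funext => p; rewrite mulrC.
apply: (@integrable_bounded_mul _ _ _ leb2 _ _ _ (`|M| + 1)) => //.
- exact: measurable_box.
- by apply: measurable_funTS; exact: continuous_measurable2.
- move=> p bp; apply: (HM (`|M| + 1)); last by exists p.
  by rewrite (le_lt_trans (ler_norm _))// ltrDl.
Qed.

Lemma continuous_along d (u : R -> R) : continuous u ->
  continuous (fun p => u (along d p)).
Proof.
by move=> cu p; apply: continuous_comp; [exact: (clin_along d).1|exact: cu].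
Qed.

Lemma continuous_across d (u : R -> R) : continuous u ->
  continuous (fun p => u (across d p)).
Proof.
by move=> cu p; apply: continuous_comp; [exact: (clin_across d).1|exact: cu].
Qed.

Lemma box_subset d a b c e a' b' c' e' : a <= a' -> b' <= b -> c <= c' ->
  e' <= e -> box d a' b' c' e' `<=` box d a b c e.
Proof.
move=> aa bb cc ee p [/=]; rewrite !in_itv/= => /andP[h1 h2] /andP[h3 h4].
by split; rewrite /= in_itv/= ?(le_trans aa)// ?(le_trans h2)// ?(le_trans cc)// (le_trans h4).
Qed.

Lemma test1_out a b i s : inside a b i -> s \notin `[a, b] -> test1 i s = 0.
Proof.
move=> [ai ib] sab; apply: bump_out; apply: contra sab.
rewrite !in_itv/= => /andP[h1 h2].
by rewrite (le_trans (ltW ai) (ltW h1)) (le_trans (ltW h2) (ltW ib)).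
Qed.

(** Test functions are taken as products of a [test1_prim] along the line and
    a [test1] across it. By Fubini and [test1_separates] across the lines,
    almost every line satisfies the hypothesis of [du_bois_reymond]; the
    families being countable, the exceptional null set does not depend on the
    test function. *)
Theorem weak_deriv_lines d a b c e f g : is_weak_deriv (dirv d) f g ->
  a < b -> c < e -> box d a b c e `<=` halfplane ->
  {ae mu, forall z, z \in `]c, e[ ->
    [/\ mu.-integrable `[a, b] (EFin \o (fun s => f (pt d s z))),
        mu.-integrable `[a, b] (EFin \o (fun s => g (pt d s z))) &
        exists k, {ae mu, forall s, s \in `]a, b[ ->
          f (pt d s z) = k + \int[mu]_(r in `[a, s]) g (pt d r z)}]}.
Proof.
move=> [[mf lf] [mg lg] wd] ab ce bH.
have cbox := @compact_box d a b c e.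
have if_ := lf _ cbox bH; have ig := lg _ cbox bH.
have [j [jin jm]] := exists_mean_neq0 ab.
pose psi i := test1_deriv a b j i; pose phi i := test1_prim a b j i.
have cpsi i : continuous (psi i).
  exact: smooth1_continuous (smooth1_test1_deriv a b j i).
have sphi i : inside a b i -> smooth1 (phi i).
  by move=> ii; exact: smooth1_test1_prim.
have cphi i : inside a b i -> continuous (phi i).
  by move=> /sphi; exact: smooth1_continuous.
pose H i p := f p * psi i (along d p) + g p * phi i (along d p).
have iH i : inside a b i -> leb2.-integrable (box d a b c e) (EFin \o H i).
  move=> ii.
  have h1 := box_integrable_mul (@continuous_along d _ (@cpsi i)) if_.
  have h2 := box_integrable_mul (@continuous_along d _ (cphi i ii)) ig.
  exact: (integrableD (measurable_box d a b c e) h1 h2).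
have key i : inside a b i -> {ae mu, forall z, z \in `]c, e[ ->
    \int[mu]_(s in `[a, b]) H i (pt d s z) = 0}.
  move=> ii; have [iHs iHz _] := Rfubini_box (iH i ii).
  apply: (test1_separates ce iHz) => l lin.
  have com := @continuous_test1 R l.
  have som : smooth1 (test1 l : R -> R) by exact: smooth1_bump.
  have [a' [b' [aa' bb' out]]] := test1_prim_out ab jin ii jm.
  have tf : test_function halfplane (tens d (phi i) (test1 l)).
    apply: (@test_function_tens _ d a' b' (ratr l.1.1) (ratr l.1.2)) => //.
    - exact: sphi.
    - case: lin => l1 l2; apply: subset_trans bH.
      by apply: box_subset; exact: ltW.
    - move=> s; rewrite in_itv/= => sl; apply: bump_out.
      by apply: contra sl; rewrite in_itv/= => /andP[/ltW -> /ltW ->].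
  have dtens p : 'D_(dirv d) (tens d (phi i) (test1 l)) p =
      tens d (psi i) (test1 l) p.
    by apply: derive_tens => // s; exact: is_derive_test1_prim.
  have off (u : R -> R) p : (forall s, s \notin `[a, b] -> u s = 0) ->
      ~ box d a b c e p -> tens d u (test1 l) p = 0.
    move=> u0 /not_andP[/negP pa|/negP pc]; rewrite /tens.
      by rewrite u0 ?mul0r.
    by rewrite (test1_out lin) ?mulr0.
  have psi0 s : s \notin `[a, b] -> psi i s = 0.
    by move=> sab; rewrite /psi /test1_deriv !(test1_out _ sab)// mulr0 subr0.
  have phi0 s : s \notin `[a, b] -> phi i s = 0.
    move=> sab; apply: out; apply: contra sab; rewrite !in_itv/= => /andP[h1 h2].
    by rewrite (le_trans (ltW aa') h1) (le_trans h2 (ltW bb')).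
  have E := wd _ tf.
  have E1 : \int[leb2]_(p in box d a b c e)
      (f p * tens d (psi i) (test1 l) p + g p * tens d (phi i) (test1 l) p) = 0.
    have ct u : continuous u -> continuous (tens d u (test1 l)).
      move=> cu p; apply: cvgM; [exact: continuous_along|exact: continuous_across].
    rewrite RintegralD; first last.
    - exact: box_integrable_mul (ct _ (cphi i ii)) ig.
    - exact: box_integrable_mul (ct _ (@cpsi i)) if_.
    - exact: measurable_box.
    move/eqP: E; rewrite -addr_eq0 => /eqP <-; congr (_ + _).
      rewrite [RHS](Rintegral_support leb2 bH).
        by apply: eq_Rintegral => p _; rewrite dtens.
      by move=> p bp; rewrite dtens off ?mulr0.
    rewrite [RHS](Rintegral_support leb2 bH)//.
    by move=> p bp; rewrite off ?mulr0.
  pose w p := test1 l (across d p).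
  have iHw := box_integrable_mul (@continuous_across d _ com) (iH i ii).
  have [_ iz Ez] := Rfubini_box iHw.
  rewrite -[RHS]E1 (_ : (fun p => _ + _) = (fun p => H i p * w p)); last first.
    by apply/funext => p; rewrite /H /tens /w; ring.
  rewrite [RHS]Ez; apply: (ae_eq_Rintegral _ _ _ _).2 => //.
  - exact: integrable_continuous_mulT com iHz.
  - by have /measurable_EFinP miz := measurable_int mu iz; exact: miz.
  - apply: ae_imp iHs => z hz zce.
    have mI : measurable (`[a, b]%classic : set mR) by exact: measurable_itv.
    rewrite -RintegralZr; [|exact: mI|exact: hz].
    by apply: eq_Rintegral => s _; rewrite /w across_pt.
have aeH : {ae mu, forall z, forall i, inside a b i ->
    z \in `]c, e[ -> \int[mu]_(s in `[a, b]) H i (pt d s z) = 0}.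
  apply: ae_forall_countable => i.
  have [ii|ii] := pselect (inside a b i); last exact: aeW.
  by apply: ae_imp (key i ii) => z hz _.
have [ifs _ _] := Rfubini_box if_; have [igs _ _] := Rfubini_box ig.
have aefg : {ae mu, forall z, z \in `[c, e] ->
    mu.-integrable `[a, b] (EFin \o (fun s => f (pt d s z))) /\
    mu.-integrable `[a, b] (EFin \o (fun s => g (pt d s z)))}.
  by apply: ae_imp2 ifs igs => z h1 h2 hz; split; [exact: h1|exact: h2].
apply: ae_imp2 aeH aefg => z Hz fgz zce.
have zce' : z \in `[c, e].
  by move: zce; rewrite !in_itv/= => /andP[/ltW -> /ltW ->].
have [fz gz] := fgz zce'; split; [exact: fz|exact: gz|].
apply: (du_bois_reymond ab jin jm fz gz) => i ii.
rewrite -[RHS](Hz i ii zce); apply: eq_Rintegral => s _.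
by rewrite /H along_pt.
Qed.

End Directions.

(** * Difference quotients and uniqueness of weak derivatives *)

(** Convergence is the vanishing of the upper limit of the distance to g. *)
Lemma measurable_cvg_set d (T : measurableType d) (R : realType)
    (q : nat -> T -> R) (g : T -> R) : (forall n, measurable_fun setT (q n)) ->
  measurable_fun setT g -> measurable [set x | q n x @[n --> \oo] --> g x].
Proof.
move=> mq mg; pose u n x := `|q n x - g x|%:E.
have mu_ : measurable_fun setT (fun x => limn_esup (u ^~ x)).
  apply: measurable_fun_limn_esup => n; apply/measurable_EFinP.
  by apply: measurableT_comp => //; exact: measurable_funB.
rewrite (_ : [set x | _] = (fun x => limn_esup (u ^~ x)) @^-1` [set 0%E]).
  by rewrite -[X in measurable X]setTI; apply: mu_ => //; exact: emeasurable_set1.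
apply/seteqP; split => x /=.
- move=> qg; have : u n x @[n --> \oo] --> 0%E.
    apply: cvg_EFin; first exact: nearW.
    rewrite (_ : fine \o _ = fun n => `|q n x - g x|)//.
    rewrite -(@normr0 _ R) -(subrr (g x)); apply: cvg_norm.
    by apply: cvgB => //; exact: cvg_cst.
  by move/cvg_limn_einf_sup => [_ ->].
- move=> u0; have : u n x @[n --> \oo] --> 0%E.
    by apply: limn_esup_le_cvg; [rewrite u0|move=> n; rewrite lee_fin].
  move/fine_cvg => /= h; apply/subr_cvg0/norm_cvg0P.
  by rewrite (_ : (fun n => _) = (fine \o (u ^~ x))).
Qed.

Section Quotients.
Context {R : realType}.
Local Notation mu := (@lebesgue_measure R).
Local Notation mR := (measurableTypeR R).
Implicit Types (d : bool) (a b c e s z : R) (p : R * R).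

Lemma ae_primitive_quotient a b k (f g : R -> R) : a < b ->
  mu.-integrable `[a, b] (EFin \o g) ->
  {ae mu, forall s, s \in `]a, b[ -> f s = k + \int[mu]_(r in `[a, s]) g r} ->
  {ae mu, forall s, s \in `]a, b[ ->
    n.+1%:R * (f (s + n.+1%:R^-1) - f s) @[n --> \oo] --> g s}.
Proof.
move=> ab ig fg.
pose F s := k + \int[mu]_(r in `[a, s]) g r.
have acF : ac a b F g by exact: ac_primitive.
have fn : {ae mu, forall s, forall n : nat, s + n.+1%:R^-1 \in `]a, b[ ->
    f (s + n.+1%:R^-1) = F (s + n.+1%:R^-1)}.
  by apply: ae_foralln => n; exact: (ae_shift n.+1%:R^-1 fg).
have fq : {ae mu, forall s, s \in `]a, b[ -> f s = F s /\
    n.+1%:R * (F (s + n.+1%:R^-1) - F s) @[n --> \oo] --> g s}.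
  apply: ae_imp2 fg (ac_ae_quotient ab acF) => s h1 h2 sab.
  by split; [exact: h1|exact: h2].
apply: ae_imp2 fn fq => s hn hs sab; have [fs qs] := hs sab.
move: sab; rewrite in_itv/= => /andP[as_ sb].
apply: cvg_trans qs; apply: near_eq_cvg; near=> n.
rewrite fs hn// in_itv/= (lt_trans as_) ?ltrDl//= -ltrBrDl.
near: n; apply: (cvgr_lt _ cvg_harmonic).
by rewrite subr_gt0.
Unshelve. all: by end_near. Qed.

Definition ratbox d (i : (rat * rat) * (rat * rat)) : set (R * R) :=
  box d (ratr i.1.1) (ratr i.1.2) (ratr i.2.1) (ratr i.2.2).

(** A countable cover of the half-plane, by which almost everywhere
    statements pass from boxes to the half-plane. *)
Lemma halfplane_rat_box d s z : halfplane (pt d s z) ->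
  exists i : (rat * rat) * (rat * rat),
    [/\ s \in `]ratr i.1.1, ratr i.1.2[, z \in `]ratr i.2.1, ratr i.2.2[ &
    ratbox d i `<=` halfplane].
Proof.
move=> H.
pose l d y : R := if d then y - 1 else y / 2.
have lP d' (y : R) : (~~ d' -> 0 < y) -> exists p q : rat,
    (y \in `]ratr p, ratr q[) /\ (~~ d' -> 0 < ratr p :> R).
  move=> y0; have [|p hp] := @rat_in_itvoo R (l d' y) y.
    rewrite /l; case: d' y0 => [_|/(_ isT) y0]; first by rewrite ltrBlDr ltrDl.
    by lra.
  have [|q hq] := @rat_in_itvoo R y (y + 1); first by rewrite ltrDl.
  move: hp hq; rewrite !in_itv/= => /andP[lp py] /andP[yq _].
  exists p, q; split; first by rewrite in_itv/= py yq.
  move=> d0; apply: lt_trans lp; rewrite /l (negbTE d0).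
  by have := y0 d0; lra.
have [|a [b [sab a0]]] := lP d s.
  by move: H; clear; case: d => // -[_ /=]; rewrite in_itv/= andbT.
have [|c [e [zce c0]]] := lP (~~ d) z.
  by move: H; clear; case: d => // -[_ /=]; rewrite in_itv/= andbT.
exists ((a, b), (c, e)); split => //= p [/=].
rewrite !in_itv/= => /andP[h1 h2] /andP[h3 h4]; split => //=.
rewrite in_itv/= andbT; move: a0 c0 h1 h3; clear; case: d => /= a0 c0 h1 h3.
  exact: lt_le_trans (c0 isT) h3.
exact: lt_le_trans (a0 isT) h1.
Qed.

Lemma measurable_halfplane : measurable (halfplane : set (mR * mR)).
Proof. by apply: measurableX => //; exact: measurable_itv. Qed.

Lemma measurable_shift2 (v : R * R) :
  measurable_fun setT ((fun p => p + v) : mR * mR -> mR * mR).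
Proof.
apply/measurable_fun_pairP; split.
- have := measurableT_comp (measurable_shiftR v.1) measurable_fst.
  by move=> h; exact: h.
- have := measurableT_comp (measurable_shiftR v.2) measurable_snd.
  by move=> h; exact: h.
Qed.

Lemma halfplane_shift d n (p : R * R) : halfplane p ->
  halfplane (p + n.+1%:R^-1 *: dirv d).
Proof.
case: p => x y [_ /=]; rewrite !in_itv/= !andbT => y0; split => //=.
rewrite in_itv/= andbT ltr_wpDr// /dirv; case: d => /=.
  by rewrite /GRing.scale/= mulr0.
by rewrite /GRing.scale/= mulr1.
Qed.

(** Along the steps 1/n, difference quotients of a weakly differentiable
    function converge almost everywhere to its weak derivative. As the limit
    does not depend on the chosen weak derivative, this yields uniqueness, and
    a jointly measurable version of weak derivatives depending on a
    parameter. *)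
Theorem weak_deriv_quotient d (f g : R * R -> R) : is_weak_deriv (dirv d) f g ->
  {ae leb2, forall p, halfplane p ->
    n.+1%:R * (f (p + n.+1%:R^-1 *: dirv d) - f p) @[n --> \oo] --> g p}.
Proof.
move=> wd; have [[mf _] [mg _] _] := wd.
pose fh := f \_ halfplane; pose gh := g \_ halfplane.
pose q n p := n.+1%:R * (fh (p + n.+1%:R^-1 *: dirv d) - fh p).
have mfh : measurable_fun (setT : set (mR * mR)) fh.
  exact: ((measurable_restrictT f measurable_halfplane).1 mf).
have mgh : measurable_fun (setT : set (mR * mR)) gh.
  exact: ((measurable_restrictT g measurable_halfplane).1 mg).
have mq n : measurable_fun (setT : set (mR * mR)) (q n).
  apply: measurable_funM; first exact: measurable_cst.
  apply: measurable_funB => //.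
  have h := measurableT_comp mfh (measurable_shift2 (n.+1%:R^-1 *: dirv d)).
  exact: h.
pose P : set (mR * mR) := ~` halfplane `|` [set p | q n p @[n --> \oo] --> gh p].
have mP : measurable P.
  apply: measurableU; first by apply: measurableC; exact: measurable_halfplane.
  exact: measurable_cvg_set.
have PE p : halfplane p ->
    (n.+1%:R * (f (p + n.+1%:R^-1 *: dirv d) - f p) @[n --> \oo] --> g p) <-> P p.
  move=> Hp.
  have -> : g p = gh p by rewrite /gh patchE mem_set.
  have -> : (fun n => n.+1%:R * (f (p + n.+1%:R^-1 *: dirv d) - f p)) = q ^~ p.
    apply/funext => n; rewrite /q /fh !patchE mem_set; last exact: halfplane_shift.
    by rewrite mem_set.
  split=> [h|[/(_ Hp)//|h]]; first by right.
  exact: h.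
suff : {ae leb2, forall p, P p} by apply: ae_imp => p Pp Hp; exact/PE.
have lines : {ae mu, forall z, {ae mu, forall s, P (pt d s z)}}.
  have : {ae mu, forall z, forall i : (rat * rat) * (rat * rat),
      z \in `]ratr i.2.1, ratr i.2.2[ ->
      ratbox d i `<=` halfplane ->
      {ae mu, forall s, s \in `]ratr i.1.1, ratr i.1.2[ -> P (pt d s z)}}.
    apply: ae_forall_countable => -[[a b] [c e]] /=.
    have [ab|ab] := ltP (ratr a : R) (ratr b); last first.
      apply: aeW => z _ _; apply: aeW => s; rewrite in_itv/= => /andP[h1 h2].
      by have := lt_le_trans (lt_trans h1 h2) ab; rewrite ltxx.
    have [ce|ce] := ltP (ratr c : R) (ratr e); last first.
      apply: aeW => z; rewrite in_itv/= => /andP[h1 h2].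
      by have := lt_le_trans (lt_trans h1 h2) ce; rewrite ltxx.
    have [bH|bH] := pselect (ratbox d ((a, b), (c, e)) `<=` halfplane); last exact: aeW.
    apply: ae_imp (weak_deriv_lines wd ab ce bH) => z hz zce _.
    have [ifz igz [k hk]] := hz zce.
    apply: ae_imp (ae_primitive_quotient ab igz hk) => s hs sab.
    have Hp : halfplane (pt d s z).
      apply: bH; split; rewrite /= ?along_pt ?across_pt; apply: subset_itv_oo_cc.
        exact: sab.
      exact: zce.
    apply/PE => //; apply: cvg_trans (hs sab); apply: near_eq_cvg.
    by apply: nearW => n; rewrite pt_shift.
  apply: ae_imp => z hz.
  have : {ae mu, forall s, forall i : (rat * rat) * (rat * rat),
      z \in `]ratr i.2.1, ratr i.2.2[ ->
      ratbox d i `<=` halfplane ->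
      s \in `]ratr i.1.1, ratr i.1.2[ -> P (pt d s z)}.
    apply: ae_forall_countable => i.
    have [zi|zi] := boolP (z \in `]ratr i.2.1, ratr i.2.2[); last exact: aeW.
    have [bi|bi] := pselect (ratbox d i `<=` halfplane); last exact: aeW.
    by apply: ae_imp (hz i zi bi) => s hs _ _; exact: hs.
  apply: ae_imp => s hs.
  have [Hp|Hp] := pselect (halfplane (pt d s z)); last by left.
  by have [i [si zi bi]] := halfplane_rat_box Hp; exact: (hs i).
rewrite /leb2; move: (P) mP lines => Q mQ; clear - mQ; case: d => lines.
- exact: (product_ae2 mQ lines).
- exact: (product_ae1 mQ lines).
Qed.

Corollary weak_deriv_unique d (f g h : R * R -> R) :
  is_weak_deriv (dirv d) f g -> is_weak_deriv (dirv d) f h ->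
  {ae leb2, forall p, halfplane p -> g p = h p}.
Proof.
move=> /weak_deriv_quotient wg /weak_deriv_quotient wh.
apply: ae_imp2 wg wh => p hg hh Hp.
exact: (cvg_unique _ (hg Hp) (hh Hp)).
Qed.

End Quotients.

(** * Truncation of weakly differentiable functions *)

Section WeakCalculus.
Context {R : realType}.
Local Notation mu := (@lebesgue_measure R).
Local Notation mR := (measurableTypeR R).
Implicit Types (d : bool) (a b c e s z : R) (p v : R * R) (f g h : R * R -> R).

Lemma closed_measurable2 (K : set (R * R)) : closed K ->
  measurable (K : set (mR * mR)).
Proof.
move=> cK; rewrite -(setCK K); apply: measurableC; apply: open_measurable2.
exact: closed_openC.
Qed.

Lemma compact_measurable2 (K : set (R * R)) : compact K ->
  measurable (K : set (mR * mR)).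
Proof.
move=> cK; apply: closed_measurable2; apply: compact_closed cK.
exact: norm_hausdorff.
Qed.

Lemma compact_halfplane_box d (K : set (R * R)) : compact K ->
  K `<=` halfplane -> exists a b c e, [/\ a < b, c < e,
    box d a b c e `<=` halfplane &
    forall p, K p -> (along d p \in `]a, b[) /\ (across d p \in `]c, e[)].
Proof.
move=> cK KH.
have c1 : continuous (fst : R * R -> R) by move=> x; exact: cvg_fst.
have c2 : continuous (snd : R * R -> R) by move=> x; exact: cvg_snd.
have k1 := continuous_compact (continuous_subspaceT c1) cK.
have k2 := continuous_compact (continuous_subspaceT c2) cK.
have bnd (A : set R) : compact A -> exists M, 0 < M /\ forall x, A x -> `|x| < M.
  move=> /compact_bounded[M [Mr HM]]; exists (`|M| + 2); split.
    by rewrite ltr_wpDl.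
  move=> x Ax; apply: (@le_lt_trans _ _ (`|M| + 1)).
    by apply: HM => //; rewrite (le_lt_trans (ler_norm _))// ltrDl.
  by rewrite ltrD2l ltr1n.
have [M1 [M10 HM1]] := bnd _ k1; have [M2 [M20 HM2]] := bnd _ k2.
have [dl [dl0 Hdl]] : exists dl : R, 0 < dl /\ forall p, K p -> dl <= p.2.
  have cl2 : closed [set snd x | x in K].
    by apply: compact_closed k2; exact: Rhausdorff.
  have : nbhs (0 : R) (~` [set snd x | x in K]).
    apply: open_nbhs_nbhs; split; first exact: closed_openC.
    by move=> [p Kp p0]; have [_ /=] := KH _ Kp; rewrite in_itv/= p0 ltxx.
  move=> /nbhs_ballP[r /= r0 hr]; exists r; split => // p Kp.
  rewrite leNgt; apply/negP => pr; apply: (hr p.2); last by exists p.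
  have [_ /=] := KH _ Kp; rewrite in_itv/= andbT => p0.
  by rewrite /ball/= sub0r normrN gtr0_norm.
have Kin p : K p -> (p.1 \in `]- M1, M1[) /\ (p.2 \in `](dl / 2), (M2 + dl)[).
  move=> Kp; split; rewrite in_itv/=.
    by rewrite -ltr_norml; apply: HM1; exists p.
  have := Hdl _ Kp => h1; have : `|p.2| < M2 by apply: HM2; exists p.
  by rewrite ltr_norml => /andP[_ h2]; apply/andP; split; lra.
case: d.
- exists (- M1), M1, (dl / 2), (M2 + dl); split => //; [lra|lra|].
  move=> p [_ /=]; rewrite in_itv/= => /andP[h _]; split => //=.
  by rewrite in_itv/= andbT (lt_le_trans _ h)// divr_gt0.
- exists (dl / 2), (M2 + dl), (- M1), M1; split => //; [lra|lra| |].
    move=> p [/= + _]; rewrite in_itv/= => /andP[h _]; split => //=.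
    by rewrite in_itv/= andbT (lt_le_trans _ h)// divr_gt0.
  by move=> p /Kin[h1 h2].
Qed.

Lemma test_function_box d v phi : test_function halfplane phi ->
  exists a b c e, [/\ a < b, c < e, box d a b c e `<=` halfplane &
    forall p, ~ ((along d p \in `]a, b[) /\ (across d p \in `]c, e[)) ->
      phi p = 0 /\ 'D_v phi p = 0].
Proof.
move=> tf; have [_ cK KH] := tf.
have [_ _ _ out] := test_function_derivative v tf.
have [a [b [c [e [ab ce bH inK]]]]] := compact_halfplane_box d cK KH.
exists a, b, c, e; split => // p np; apply: out => Kp.
by apply: np; exact: inK.
Qed.

(** A test function lives in a box, where both sides of the identity are
    integrable: there it becomes the vanishing of a single integral, to which
    linearity and Fubini apply. *)
Lemma weak_identity_box d v a b c e f g phi : test_function halfplane phi ->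
  box d a b c e `<=` halfplane ->
  (forall p, ~ ((along d p \in `]a, b[) /\ (across d p \in `]c, e[)) ->
      phi p = 0 /\ 'D_v phi p = 0) ->
  loc_integrable2 halfplane f -> loc_integrable2 halfplane g ->
  leb2.-integrable (box d a b c e)
    (EFin \o (fun p => f p * 'D_v phi p + g p * phi p)) /\
  (\int[leb2]_(p in halfplane) (f p * 'D_v phi p) =
     - (\int[leb2]_(p in halfplane) (g p * phi p)) <->
   \int[leb2]_(p in box d a b c e) (f p * 'D_v phi p + g p * phi p) = 0).
Proof.
move=> tf bH out [_ lf] [_ lg].
have [cphi cdphi _ _] := test_function_derivative v tf.
have cb := @compact_box _ d a b c e.
have i1 := box_integrable_mul cdphi (lf _ cb bH).
have i2 := box_integrable_mul cphi (lg _ cb bH).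
have off p : ~ box d a b c e p -> phi p = 0 /\ 'D_v phi p = 0.
  move=> nb; apply: out => -[h1 h2]; apply: nb.
  by split; apply: subset_itv_oo_cc; [exact: h1|exact: h2].
split; first exact: (integrableD (measurable_box d a b c e) i1 i2).
rewrite (RintegralD (measurable_box d a b c e) i1 i2).
rewrite (Rintegral_support leb2 bH); last first.
  by move=> p /off[_ ->]; rewrite mulr0.
rewrite (Rintegral_support leb2 bH (f := fun p => g p * phi p)); last first.
  by move=> p /off[-> _]; rewrite mulr0.
by split => [->|/eqP]; [rewrite addNr|rewrite addr_eq0 => /eqP].
Qed.

Lemma loc_integrable2_le f h : loc_integrable2 halfplane f ->
  measurable_fun halfplane h -> (forall p, halfplane p -> `|h p| <= `|f p|) ->
  loc_integrable2 halfplane h.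
Proof.
move=> [mf lf] mh hf; split => // K cK KH.
apply: (le_integrable (compact_measurable2 cK) _ _ (lf _ cK KH)).
  have mh' : measurable_fun (K : set (mR * mR)) h.
    exact: (measurable_funS measurable_halfplane KH mh).
  exact/measurable_EFinP.
by move=> p Kp /=; rewrite lee_fin; apply: hf; exact: KH.
Qed.

Lemma loc_integrable2B f g : loc_integrable2 halfplane f ->
  loc_integrable2 halfplane g -> loc_integrable2 halfplane (fun p => f p - g p).
Proof.
move=> [mf lf] [mg lg]; split; first exact: measurable_funB.
move=> K cK KH.
exact: (integrableB (compact_measurable2 cK) (lf _ cK KH) (lg _ cK KH)).
Qed.

Lemma is_weak_derivB v f1 g1 f2 g2 : is_weak_deriv v f1 g1 ->
  is_weak_deriv v f2 g2 ->
  is_weak_deriv v (fun p => f1 p - f2 p) (fun p => g1 p - g2 p).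
Proof.
move=> [lf1 lg1 w1] [lf2 lg2 w2]; split; [exact: loc_integrable2B..|].
move=> phi tf.
have [a [b [c [e [ab ce bH out]]]]] := test_function_box true v tf.
have [i1 e1] := weak_identity_box tf bH out lf1 lg1.
have [i2 e2] := weak_identity_box tf bH out lf2 lg2.
have [_ e3] := weak_identity_box tf bH out (loc_integrable2B lf1 lf2)
  (loc_integrable2B lg1 lg2).
apply/e3; have /e1 z1 := w1 _ tf; have /e2 z2 := w2 _ tf.
rewrite -[RHS](subrr 0) -{1}z1 -z2 -(RintegralB (measurable_box _ _ _ _ _) i1 i2).
by apply: eq_Rintegral => p _; ring.
Qed.

Lemma is_derive_line_pt d s z phi (dphi : R) :
  is_derive (pt d s z) (dirv d) phi dphi ->
  is_derive s (1 : R) (fun r => phi (pt d r z)) dphi.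
Proof.
move=> [dp <-].
have E : (fun r => r^-1 *: (((fun r => phi (pt d r z)) \o shift s) (r *: (1 : R)) - phi (pt d s z)))
    = (fun r => r^-1 *: ((phi \o shift (pt d s z)) (r *: dirv d) - phi (pt d s z))).
  apply/funext => r /=; congr (_ *: (phi _ - _)).
  by rewrite [RHS]addrC pt_shift [_ + s]addrC /GRing.scale/= mulr1.
by apply: DeriveDef; rewrite ?/derivable /derive E.
Qed.

Lemma continuous_pt d z : continuous (fun s => pt d s z).
Proof.
rewrite (_ : (fun s => _) = (fun s => pt d 0 z + s *: dirv d)); last first.
  by apply/funext => s; rewrite pt_shift add0r.
move=> s; apply: cvgD; first exact: cvg_cst.
by apply: cvgZ; [exact: cvg_id|exact: cvg_cst].
Qed.

Lemma continuous_on_line d z (u : R * R -> R) : continuous u ->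
  continuous (fun s => u (pt d s z)).
Proof.
by move=> cu s; apply: continuous_comp; [exact: continuous_pt|exact: cu].
Qed.

Definition step (r : R) : R := (0 < r)%R%:R.

Lemma measurable_step : measurable_fun setT step.
Proof.
rewrite (_ : step = \1_(`]0, +oo[%classic : set R)); first exact: measurable_indic.
apply/funext => r; rewrite indicE /step (_ : (r \in _) = (0 < r))//.
by apply/idP/idP; rewrite inE/= in_itv/= andbT.
Qed.

Lemma continuous_pos : continuous (@pos R).
Proof.
move=> x; apply/cvgrPdist_lt => e e0.
have /cvgrPdist_lt/(_ _ e0) : y @[y --> x] --> x by exact: cvg_id.
by apply: filterS => y; exact: le_lt_trans (pos_lipschitz _ _).
Qed.

Lemma measurable_pos : measurable_fun setT (@pos R).
Proof. exact: continuous_measurable_fun continuous_pos. Qed.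

(** The positive part of a weakly differentiable function. On almost every
    line it is an indefinite integral by [ac_pos], and one integrates by parts
    there. *)
Theorem weak_deriv_pos d k f g : 0 <= k -> is_weak_deriv (dirv d) f g ->
  is_weak_deriv (dirv d) (fun p => pos (f p - k)) (fun p => step (f p - k) * g p).
Proof.
move=> k0 wd; have [lf lg _] := wd; have [mf _] := lf; have [mg _] := lg.
have mfk : measurable_fun halfplane (fun p => f p - k).
  by apply: measurable_funB => //; exact: measurable_cst.
have lF : loc_integrable2 halfplane (fun p => pos (f p - k)).
  apply: loc_integrable2_le lf _ _.
    exact: (measurableT_comp measurable_pos mfk).
  move=> p _; rewrite ger0_norm ?pos_ge0// ge_max normr_ge0 andbT.
  by rewrite lerBlDr (le_trans (ler_norm _))// lerDl.
have lG : loc_integrable2 halfplane (fun p => step (f p - k) * g p).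
  apply: loc_integrable2_le lg _ _.
    apply: measurable_funM mg.
    exact: (measurableT_comp measurable_step mfk).
  by move=> p _; rewrite normrM ler_piMl// ger0_norm// /step lern1; case: (0 < _).
split => // phi tf.
have [a [b [c [e [ab ce bH out]]]]] := test_function_box d (dirv d) tf.
have [iFG EFG] := weak_identity_box tf bH out lF lG.
apply/EFG; have [_ iz ->] := Rfubini_box iFG.
have [cphi cdphi dphi _] := test_function_derivative (dirv d) tf.
have outz s z : (s \notin `]a, b[) \/ (z \notin `]c, e[) ->
    phi (pt d s z) = 0 /\ 'D_(dirv d) phi (pt d s z) = 0.
  by move=> sz; apply: out; rewrite along_pt across_pt => -[h1 h2];
    case: sz; rewrite ?h1 ?h2.
have i0 : mu.-integrable `[c, e] (EFin \o (fun=> 0 : R)).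
  by apply: continuous_integrable_itv => x; exact: cvg_cst.
have inner0 : {ae mu, forall z, `[c, e]%classic z -> 0 =
    \int[mu]_(s in `[a, b]) (pos (f (pt d s z) - k) * 'D_(dirv d) phi (pt d s z) +
      step (f (pt d s z) - k) * g (pt d s z) * phi (pt d s z))}.
  apply: ae_imp (weak_deriv_lines wd ab ce bH) => z hz _.
  have [zce|zce] := boolP (z \in `]c, e[); last first.
    rewrite (@eq_Rintegral _ _ _ _ _ (fun=> 0)) ?Rintegral_cst ?mul0r// => s _.
    by have [-> ->] := outz s z (or_intror zce); rewrite !mulr0 addr0.
  have [ifz igz [C hC]] := hz zce.
  pose F s := C + \int[mu]_(r in `[a, s]) g (pt d r z).
  have acF : ac a b (fun s => F s - k) (fun s => g (pt d s z)).
    by apply: ac_shift; exact: ac_primitive.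
  have acphi : ac a b (fun s => phi (pt d s z))
      (fun s => 'D_(dirv d) phi (pt d s z)).
    apply: C1_ac => [s|s]; first by apply: is_derive_line_pt; exact: dphi.
    exact: (@continuous_on_line d z _ cdphi).
  have acP := ac_pos (ltW ab) acF.
  have [|pa _] := outz a z; first by left; rewrite in_itv/= ltxx.
  have [|pb _] := outz b z; first by left; rewrite in_itv/= ltxx andbF.
  rewrite -[LHS](ac_parts0 (ltW ab) acP acphi pa pb).
  have [iPphi _] := ac_mul (ltW ab) acP acphi.
  have cpd (u : R * R -> R) : continuous u ->
      measurable_fun (`[a, b]%classic : set mR) (fun s => u (pt d s z)).
    move=> cu; apply: measurable_funTS; apply: continuous_measurable_fun.
    exact: (@continuous_on_line d z _ cu).
  have mfz : measurable_fun (`[a, b]%classic : set mR) (fun s => f (pt d s z) - k).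
    have /measurable_EFinP mfz := measurable_int mu ifz.
    by apply: measurable_funB; [exact: mfz|exact: measurable_cst].
  have mgz : measurable_fun (`[a, b]%classic : set mR) (fun s => g (pt d s z)).
    by have /measurable_EFinP mgz := measurable_int mu igz; exact: mgz.
  apply: (ae_eq_Rintegral _ iPphi _ _).2 => //.
    apply: measurable_funD; apply: measurable_funM.
    - exact: (measurableT_comp measurable_pos mfz).
    - exact: (cpd _ cdphi).
    - apply: measurable_funM mgz.
      exact: (measurableT_comp measurable_step mfz).
    - exact: (cpd _ cphi).
  apply: ae_imp hC => s hs sab'.
  have [sab|sab] := boolP (s \in `]a, b[); first by rewrite /step (hs sab).
  by have [-> ->] := outz s z (or_introl sab); rewrite !mulr0.
have miz : measurable_fun (`[c, e]%classic : set mR) (fun z =>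
    \int[mu]_(s in `[a, b]) (pos (f (pt d s z) - k) * 'D_(dirv d) phi (pt d s z) +
      step (f (pt d s z) - k) * g (pt d s z) * phi (pt d s z))).
  by have /measurable_EFinP miz := measurable_int mu iz; exact: miz.
have [_ <-] := @ae_eq_Rintegral R _ mR mu `[c, e]%classic _ _
  (measurable_itv `[c, e]) i0 miz inner0.
by rewrite Rintegral_cst// mul0r.
Qed.

End WeakCalculus.

(** * The distributional time derivative on lines *)

Lemma integrable_mul_comp d (T : measurableType d) (R : realType)
    (m : {measure set T -> \bar R}) (D : set T) (h : T -> R) (cm : T -> R)
    (u : R -> R) (a b : R) : measurable D -> measurable_fun setT cm ->
  (forall x, D x -> cm x \in `[a, b]) -> continuous u ->
  m.-integrable D (EFin \o h) ->
  m.-integrable D (EFin \o (fun x => h x * u (cm x))).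
Proof.
move=> mD mcm cab cu ih.
have [M [_ HM]] := within_continuous_bounded
  (continuous_subspaceT cu : {within `[a, b], continuous u}).
rewrite (_ : (fun x => _) = (fun x => u (cm x) * h x)); last first.
  by apply/funext => x; rewrite mulrC.
apply: (@integrable_bounded_mul _ _ _ _ _ _ _ M) => //.
- apply: measurable_funTS; apply: measurableT_comp mcm.
  exact: continuous_measurable_fun.
- by move=> x Dx; apply: HM; exact: cab.
Qed.

Section TimeLines.
Context {R : realType}.
Local Notation mu := (@lebesgue_measure R).
Local Notation mR := (measurableTypeR R).
Local Notation V3 := (R * (R * R))%type.
Implicit Types (a b c e s z : R) (p : R * R) (f g h : R * R -> R).

(** Two applications of [test1_separates], linked by Fubini. *)
Lemma test2_separates a b c e h : a < b -> c < e ->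
  leb2.-integrable (box true a b c e) (EFin \o h) ->
  (forall i l, inside a b i -> inside c e l ->
    \int[leb2]_(p in box true a b c e) (h p * test1 i p.1 * test1 l p.2) = 0) ->
  {ae leb2, forall p, p.1 \in `]a, b[ -> p.2 \in `]c, e[ -> h p = 0}.
Proof.
move=> ab ce ih h0.
have mb := measurable_box true a b c e.
have key i : inside a b i -> {ae mu, forall z, z \in `]c, e[ ->
    \int[mu]_(s in `[a, b]) (h (s, z) * test1 i s) = 0}.
  move=> ii.
  have ih1 : leb2.-integrable (box true a b c e) (EFin \o (fun p => h p * test1 i p.1)).
    exact: (box_integrable_mul (@continuous_along _ true _ (@continuous_test1 R i)) ih).
  have [is1 iz1 _] := Rfubini_box ih1.
  apply: (test1_separates ce iz1) => l il.
  have ih2 : leb2.-integrable (box true a b c e)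
      (EFin \o (fun p => h p * test1 i p.1 * test1 l p.2)).
    exact: (box_integrable_mul (@continuous_across _ true _ (@continuous_test1 R l)) ih1).
  have [_ iz2 E2] := Rfubini_box ih2.
  rewrite -[RHS](h0 i l ii il) [RHS]E2.
  have iL := integrable_continuous_mulT (@continuous_test1 R l) iz1.
  have mz2 : measurable_fun (`[c, e]%classic : set mR) (fun z => \int[mu]_(s in `[a, b])
      (h (pt true s z) * test1 i (pt true s z).1 * test1 l (pt true s z).2)).
    by have /measurable_EFinP m2 := measurable_int mu iz2; exact: m2.
  have [//|_ ->//] := @ae_eq_Rintegral R _ mR mu `[c, e]%classic _ _
    (measurable_itv `[c, e]) iL mz2 _.
  apply: ae_imp is1 => z hz zce; rewrite -RintegralZr//; exact: hz.
have lines : {ae mu, forall z, z \in `]c, e[ -> {ae mu, forall s, s \in `]a, b[ ->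
    h (s, z) = 0}}.
  have : {ae mu, forall z, forall i, inside a b i -> z \in `]c, e[ ->
    \int[mu]_(s in `[a, b]) (h (s, z) * test1 i s) = 0}.
    apply: ae_forall_countable => i.
    have [ii|ii] := pselect (inside a b i); last exact: aeW.
    by apply: ae_imp (key i ii) => z hz _.
  have [is0 _ _] := Rfubini_box ih.
  move=> aeh; apply: ae_imp2 aeh is0 => z hz iz zce.
  apply: (test1_separates ab) => [|i ii]; last exact: hz.
  by apply: iz; exact: subset_itv_oo_cc.
pose hr := h \_ (box true a b c e).
have mhr : measurable_fun (setT : set (mR * mR)) hr.
  have /measurable_EFinP mh := measurable_int _ ih.
  exact: ((measurable_restrictT h mb).1 mh).
pose P : set (mR * mR) := [set p | hr p = 0] `|`
   ~` (`]a, b[%classic `*` `]c, e[%classic).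
have mP : measurable P.
  apply: measurableU; last first.
    by apply: measurableC; apply: measurableX; exact: measurable_itv.
  rewrite (_ : [set p | _] = hr @^-1` [set 0]); last by [].
  by rewrite -[X in measurable X]setTI; apply: mhr.
have : {ae leb2, forall p, P p}.
  apply: (product_ae2 mP); apply: ae_imp lines => z hz.
  have [zce|zce] := boolP (z \in `]c, e[); last first.
    by apply: aeW => s; right => -[_ /= h2]; rewrite h2 in zce.
  apply: ae_imp (hz zce) => s hs.
  have [sab|sab] := boolP (s \in `]a, b[); last first.
    by right => -[/= h2 _]; rewrite h2 in sab.
  by left; rewrite /hr/= patchE; case: ifP => // _; exact: hs.
apply: ae_imp => -[s z] Psz sab zce; case: Psz => [hs|n]; last by case: n.
have <- : hr (s, z) = h (s, z).
  by rewrite /hr patchE mem_set//; split => /=; exact: subset_itv_oo_cc.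
exact: hs.
Qed.

Lemma clin3_t : @clin R V3 fst.
Proof. by split=> [x|//]; exact: cvg_fst. Qed.

Lemma clin3_x : @clin R V3 (fst \o snd).
Proof.
split=> [x|//]; apply: continuous_comp; [exact: cvg_snd|exact: cvg_fst].
Qed.

Lemma clin3_y : @clin R V3 (snd \o snd).
Proof.
split=> [x|//]; apply: continuous_comp; [exact: cvg_snd|exact: cvg_snd].
Qed.

Definition tens3 (phi om1 om2 : R -> R) (q : V3) :=
  phi q.1 * (om1 q.2.1 * om2 q.2.2).

Lemma derive_tens3 phi om1 om2 (dphi : R -> R) q : smooth1 om1 -> smooth1 om2 ->
  (forall s : R, is_derive s (1 : R) phi (dphi s)) ->
  'D_dir_t (tens3 phi om1 om2) q = tens3 dphi om1 om2 q.
Proof.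
move=> [F1 [<- hF1]] [F2 [<- hF2]] hphi.
have h0 := is_derive_line dir_t clin3_t (hphi q.1).
have h1 := is_derive_line dir_t clin3_x (hF1 0%N q.2.1).
have h2 := is_derive_line dir_t clin3_y (hF2 0%N q.2.2).
have [_ ->] := is_deriveM h0 (is_deriveM h1 h2).
rewrite /dir_t/= !mul0r !scaler0 addr0 scaler0 add0r /GRing.scale/= mul1r.
by rewrite /tens3 mulrC.
Qed.

Lemma test_function_tens3 (U : set V3) a b c e c' e' phi om1 om2 :
  smooth1 phi -> smooth1 om1 -> smooth1 om2 ->
  `[a, b]%classic `*` (`[c, e]%classic `*` `[c', e']%classic) `<=` U ->
  (forall s, s \notin `[a, b] -> phi s = 0) ->
  (forall s, s \notin `[c, e] -> om1 s = 0) ->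
  (forall s, s \notin `[c', e'] -> om2 s = 0) ->
  test_function U (tens3 phi om1 om2).
Proof.
move=> sphi som1 som2 bU phi0 om10 om20.
apply: test_function_of_smalg bU _.
- apply: smalg_mul; first exact: smalg_line sphi clin3_t.
  apply: smalg_mul; first exact: smalg_line som1 clin3_x.
  exact: smalg_line som2 clin3_y.
- apply: compact_setX; first exact: segment_compact.
  by apply: compact_setX; exact: segment_compact.
- move=> q nq; rewrite /tens3.
  have [h|/phi0 ->] := boolP (q.1 \in `[a, b]); last by rewrite mul0r.
  have [h1|/om10 ->] := boolP (q.2.1 \in `[c, e]); last by rewrite mul0r mulr0.
  have [h2|/om20 ->] := boolP (q.2.2 \in `[c', e']); last by rewrite !mulr0.
  by exfalso; apply: nq.
Qed.

(** As for [weak_deriv_lines], with products of three functions of one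
    variable; the separation across the lines now takes place in the plane. *)
Theorem time_deriv_lines (T : R) (a b : R) (f g : V3 -> R) :
  is_time_deriv T f g -> 0 < a -> a < b -> b < T ->
  {ae leb2, forall p, halfplane p ->
    [/\ mu.-integrable `[a, b] (EFin \o (fun s => f (s, p))),
        mu.-integrable `[a, b] (EFin \o (fun s => g (s, p))) &
        exists k, {ae mu, forall s, s \in `]a, b[ ->
          f (s, p) = k + \int[mu]_(r in `[a, s]) g (r, p)}]}.
Proof.
move=> [[mf lf] [mg lg] wd] a0 ab bT.
pose B i : set (R * R) := ratbox true i.
have iB (h : V3 -> R) i : loc_integrable3 (open_cylinder T) h ->
    B i `<=` halfplane ->
    leb3.-integrable (`[a, b]%classic `*` B i) (EFin \o h).
  move=> [_ lh] bH; apply: lh.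
    by apply: compact_setX; [exact: segment_compact|exact: compact_box].
  move=> [t p] [/= tab Bp]; split => /=; last exact: bH.
  by move: tab; rewrite !in_itv/= => /andP[h1 h2]; apply/andP; split; lra.
have key : {ae leb2, forall p, forall i : (rat * rat) * (rat * rat),
    p.1 \in `]ratr i.1.1, ratr i.1.2[ -> p.2 \in `]ratr i.2.1, ratr i.2.2[ ->
    B i `<=` halfplane ->
    [/\ mu.-integrable `[a, b] (EFin \o (fun s => f (s, p))),
        mu.-integrable `[a, b] (EFin \o (fun s => g (s, p))) &
        exists k, {ae mu, forall s, s \in `]a, b[ ->
          f (s, p) = k + \int[mu]_(r in `[a, s]) g (r, p)}]}.
  apply: ae_forall_countable => i.
  have [bH|bH] := pselect (B i `<=` halfplane); last exact: aeW.
  have [xx|xx] := ltP (ratr i.1.1 : R) (ratr i.1.2); last first.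
    apply: aeW => p; rewrite in_itv/= => /andP[h1 h2].
    by have := lt_le_trans (lt_trans h1 h2) xx; rewrite ltxx.
  have [yy|yy] := ltP (ratr i.2.1 : R) (ratr i.2.2); last first.
    apply: aeW => p _; rewrite in_itv/= => /andP[h1 h2].
    by have := lt_le_trans (lt_trans h1 h2) yy; rewrite ltxx.
  have if_ := iB f i (conj mf lf) bH; have ig := iB g i (conj mg lg) bH.
  have mB : measurable (B i : set (mR * mR)) by exact: measurable_box.
  have mA : measurable (`[a, b]%classic : set mR) by exact: measurable_itv.
  have [j [jin jm]] := exists_mean_neq0 ab.
  pose psi l := test1_deriv a b j l; pose phi l := test1_prim a b j l.
  have cpsi l : continuous (psi l).
    exact: smooth1_continuous (smooth1_test1_deriv a b j l).
  have sphi l : inside a b l -> smooth1 (phi l).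
    by move=> ll; exact: smooth1_test1_prim.
  pose H l q := f q * psi l q.1 + g q * phi l q.1.
  have mABi := measurableX mA mB.
  have t_in q : (`[a, b]%classic `*` B i) q -> q.1 \in `[a, b] by case.
  have x_in q : (`[a, b]%classic `*` B i) q -> q.2.1 \in `[ratr i.1.1, ratr i.1.2].
    by move=> [_ []].
  have y_in q : (`[a, b]%classic `*` B i) q -> q.2.2 \in `[ratr i.2.1, ratr i.2.2].
    by move=> [_ []].
  have m1 : measurable_fun (setT : set (mR * (mR * mR))) (fun q => q.1 : R) by exact: measurable_fst.
  have m2 : measurable_fun (setT : set (mR * (mR * mR))) (fun q => q.2.1 : R).
    exact: (measurableT_comp measurable_fst measurable_snd).
  have m3 : measurable_fun (setT : set (mR * (mR * mR))) (fun q => q.2.2 : R).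
    exact: (measurableT_comp measurable_snd measurable_snd).
  have iH l : inside a b l -> leb3.-integrable (`[a, b]%classic `*` B i) (EFin \o H l).
    move=> ll.
    have h1 := integrable_mul_comp mABi m1 t_in (@cpsi l) if_.
    have h2 := integrable_mul_comp mABi m1 t_in (smooth1_continuous (sphi l ll)) ig.
    exact: (integrableD mABi h1 h2).
  have keyl l : inside a b l -> {ae leb2, forall p,
      p.1 \in `]ratr i.1.1, ratr i.1.2[ -> p.2 \in `]ratr i.2.1, ratr i.2.2[ ->
      \int[mu]_(s in `[a, b]) H l (s, p) = 0}.
    move=> ll; have [iHs iHz _] := Rfubini2 mA mB (iH l ll).
    apply: (test2_separates xx yy iHz) => l1 l2 in1 in2.
    have [a' [b' [aa' bb' out]]] := test1_prim_out ab jin ll jm.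
    have som (n : rat * rat * nat) : smooth1 (test1 n : R -> R) by exact: smooth1_bump.
    have bO : `[a, b]%classic `*` B i `<=` open_cylinder T.
      move=> [t p] [/= tab Bp]; split => /=; last exact: bH.
      by move: tab; rewrite !in_itv/= => /andP[h1 h2]; apply/andP; split; lra.
    have psi0 s : s \notin `[a, b] -> psi l s = 0.
      by move=> sab; rewrite /psi /test1_deriv !(test1_out _ sab)// mulr0 subr0.
    have phi0 s : s \notin `[a, b] -> phi l s = 0.
      move=> sab; apply: out; apply: contra sab; rewrite !in_itv/= => /andP[h1 h2].
      by rewrite (le_trans (ltW aa') h1) (le_trans h2 (ltW bb')).
    have tf : test_function (open_cylinder T) (tens3 (phi l) (test1 l1) (test1 l2)).
      apply: (@test_function_tens3 _ a b (ratr i.1.1) (ratr i.1.2)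
        (ratr i.2.1) (ratr i.2.2)) => //.
      - exact: sphi.
      - by move=> s; exact: (test1_out in1).
      - by move=> s; exact: (test1_out in2).
    have dtens q : 'D_dir_t (tens3 (phi l) (test1 l1) (test1 l2)) q =
        tens3 (psi l) (test1 l1) (test1 l2) q.
      by apply: derive_tens3 => // s; exact: is_derive_test1_prim.
    have off (u : R -> R) q : (forall s, s \notin `[a, b] -> u s = 0) ->
        ~ (`[a, b]%classic `*` B i) q -> tens3 u (test1 l1) (test1 l2) q = 0.
      move=> u0 nq; rewrite /tens3.
      have [h|/u0 ->] := boolP (q.1 \in `[a, b]); last by rewrite mul0r.
      have [h1|/(test1_out in1) ->] := boolP (q.2.1 \in `[ratr i.1.1, ratr i.1.2]);
        last by rewrite mul0r mulr0.
      have [h2|/(test1_out in2) ->] := boolP (q.2.2 \in `[ratr i.2.1, ratr i.2.2]);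
        last by rewrite !mulr0.
      by exfalso; apply: nq.
    pose w (q : V3) := H l q * test1 l1 q.2.1 * test1 l2 q.2.2.
    have imul (h : V3 -> R) u : leb3.-integrable (`[a, b]%classic `*` B i) (EFin \o h) ->
        continuous u -> leb3.-integrable (`[a, b]%classic `*` B i)
          (EFin \o (fun q => h q * tens3 u (test1 l1) (test1 l2) q)).
      move=> ih cu.
      have i1 := integrable_mul_comp mABi m1 t_in cu ih.
      have i2 := integrable_mul_comp mABi m2 x_in (@continuous_test1 R l1) i1.
      have i3 := integrable_mul_comp mABi m3 y_in (@continuous_test1 R l2) i2.
      by apply: eq_integrable i3 => // q _ /=; rewrite /tens3 !mulrA.
    have iw : leb3.-integrable (`[a, b]%classic `*` B i) (EFin \o w).
      have i2 := integrable_mul_comp mABi m2 x_in (@continuous_test1 R l1) (iH l ll).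
      exact: (integrable_mul_comp mABi m3 y_in (@continuous_test1 R l2) i2).
    have [_ iz Ez] := Rfubini2 mA mB iw.
    have E1 : \int[leb3]_(q in `[a, b]%classic `*` B i) w q = 0.
      have E := wd _ tf.
      rewrite (_ : w = fun q => f q * tens3 (psi l) (test1 l1) (test1 l2) q +
        g q * tens3 (phi l) (test1 l1) (test1 l2) q); last first.
        by apply/funext => q; rewrite /w /H /tens3; ring.
      rewrite (RintegralD mABi (imul _ _ if_ (@cpsi l))
        (imul _ _ ig (smooth1_continuous (sphi l ll)))).
      move/eqP: E; rewrite -addr_eq0 => /eqP <-; congr (_ + _).
        rewrite [RHS](Rintegral_support leb3 bO).
          by apply: eq_Rintegral => q _; rewrite dtens.
        by move=> q bq; rewrite dtens off ?mulr0.
      rewrite [RHS](Rintegral_support leb3 bO)//.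
      by move=> q bq; rewrite off ?mulr0.
    rewrite -[RHS]E1 [RHS]Ez.
    have iL : leb2.-integrable (B i) (EFin \o (fun p =>
        (\int[mu]_(s in `[a, b]) H l (s, p)) * test1 l1 p.1 * test1 l2 p.2)).
      have i1 := box_integrable_mul (@continuous_along _ true _ (@continuous_test1 R l1)) iHz.
      exact: (box_integrable_mul (@continuous_across _ true _ (@continuous_test1 R l2)) i1).
    have mz2 : measurable_fun (B i : set (mR * mR))
        (fun p => \int[mu]_(s in `[a, b]) w (s, p)).
      by have /measurable_EFinP mz := measurable_int _ iz; exact: mz.
    have [|_ ->//] := @ae_eq_Rintegral R _ _ leb2 (B i) _ _ mB iL mz2 _.
    apply: ae_imp iHs => p hp Bp; have i0 := hp Bp.
    have i1 := integrableZr mA (test1 l1 p.1) i0.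
    by rewrite /w/= -!RintegralZr//; first [exact: i0|exact: i1].
  have aeH : {ae leb2, forall p, forall l, inside a b l ->
      p.1 \in `]ratr i.1.1, ratr i.1.2[ -> p.2 \in `]ratr i.2.1, ratr i.2.2[ ->
      \int[mu]_(s in `[a, b]) H l (s, p) = 0}.
    apply: ae_forall_countable => l.
    have [ll|ll] := pselect (inside a b l); last exact: aeW.
    by apply: ae_imp (keyl l ll) => p hp _.
  have [ifs _ _] := Rfubini2 mA mB if_; have [igs _ _] := Rfubini2 mA mB ig.
  have aefg : {ae leb2, forall p, B i p ->
      mu.-integrable `[a, b] (EFin \o (fun s => f (s, p))) /\
      mu.-integrable `[a, b] (EFin \o (fun s => g (s, p)))}.
    by apply: ae_imp2 ifs igs => p h1 h2 hp; split; [exact: h1|exact: h2].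
  apply: ae_imp2 aeH aefg => p Hp fgp p1 p2 _.
  have Bp : B i p by split; exact: subset_itv_oo_cc.
  have [fp gp] := fgp Bp; split => //.
  apply: (du_bois_reymond ab jin jm fp gp) => l ll.
  by rewrite -[RHS](Hp l ll p1 p2).
apply: ae_imp key => p hp Hp.
have [|i [h1 h2 h3]] := @halfplane_rat_box R true p.1 p.2.
  by case: p {hp} Hp.
exact: (hp i).
Qed.

End TimeLines.

(** * Integrals of functions not known to be measurable *)

Section LowerIntegral.
Context d (T : measurableType d) (R : realType) (m : {measure set T -> \bar R}).
Implicit Types (D : set T) (f g : T -> \bar R).
Local Open Scope ereal_scope.

(** The integral of a nonnegative function is a supremum over simple functions
    and makes sense, as a lower integral, without measurability. Norms in V of
    slices are such functions of time. *)
Lemma le_lower_integral D f g : (forall x, D x -> 0 <= f x) ->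
  (forall x, D x -> f x <= g x) -> \int[m]_(x in D) f x <= \int[m]_(x in D) g x.
Proof.
move=> f0 fg; rewrite !ge0_integralE//; last first.
  by move=> x Dx; exact: le_trans (f0 _ Dx) (fg _ Dx).
apply: ereal_sup_le => _ [h /= hf <-]; exists h => // x.
apply: le_trans (hf x) _; rewrite !patchE; case: ifPn => // /set_mem; exact: fg.
Qed.

(** In an inequality valid almost everywhere, only the measurable side can be
    modified on the exceptional null set; hence the two forms below. *)
Lemma ae_le_lower_integral_l D f g : measurable D -> measurable_fun D g ->
  (forall x, D x -> 0 <= f x) -> (forall x, D x -> 0 <= g x) ->
  {ae m, forall x, D x -> g x <= f x} ->
  \int[m]_(x in D) g x <= \int[m]_(x in D) f x.
Proof.
move=> mD mg f0 g0 [N [mN N0 gfN]].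
pose g' := g \_ (~` N).
have g'0 x : D x -> 0 <= g' x.
  by move=> Dx; rewrite /g' patchE; case: ifP => // _; exact: g0.
have mg' : measurable_fun D g'.
  apply/measurable_restrict => //; first exact: measurableC.
  by apply: measurable_funS mg => // x [].
rewrite (@ge0_ae_eq_integral _ _ _ m D g g')//; last first.
  exists N; split => // x /= /not_implyP[Dx gx]; apply: contrapT => Nx.
  by apply: gx; rewrite /g' patchE mem_set.
apply: le_lower_integral => // x Dx; rewrite /g' patchE.
case: ifPn => [/set_mem Nx|_]; last exact: f0.
by apply: contrapT => gf; apply: Nx; apply: gfN => /(_ Dx).
Qed.

Lemma ae_le_lower_integral_r D f g : measurable D -> measurable_fun D g ->
  (forall x, D x -> 0 <= f x) -> (forall x, D x -> 0 <= g x) ->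
  {ae m, forall x, D x -> f x <= g x} ->
  \int[m]_(x in D) f x <= \int[m]_(x in D) g x.
Proof.
move=> mD mg f0 g0 [N [mN N0 fgN]].
pose g' x := if x \in N then +oo else g x.
have g'0 x : D x -> 0 <= g' x.
  by move=> Dx; rewrite /g'; case: ifP => // _; exact: g0.
have mg' : measurable_fun D g'.
  apply: measurable_fun_if => //.
  - apply: (measurable_fun_bool true).
    rewrite (_ : _ @^-1` _ = N); first exact: measurableI.
    by apply/seteqP; split => x /=; [move/set_mem|move/mem_set].
  - by apply: measurable_funS mg => // x [].
rewrite (@ge0_ae_eq_integral _ _ _ m D g g')//; last first.
  exists N; split => // x /= /not_implyP[Dx gx]; apply: contrapT => Nx.
  by apply: gx; rewrite /g' memNset.
apply: le_lower_integral => // x Dx; rewrite /g'.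
case: ifPn => [_|/negP Nx]; first exact: leey.
by apply: contrapT => gf; apply: Nx; apply/mem_set; apply: fgN => /(_ Dx).
Qed.

End LowerIntegral.

Lemma Lnorm2_sqrte (d : measure_display) (T : measurableType d) (R : realType)
    (m : {measure set T -> \bar R}) (D : set T) (N : T -> \bar R) :
  (forall t, 0 <= N t)%E ->
  (Lnorm m 2%:E ((fun t => sqrte (N t)) \_ D) < +oo)%E =
  (\int[m]_(t in D) N t < +oo)%E.
Proof.
move=> N0.
have E : (\int[m]_(t in D) N t = \int[m]_t (`|((fun t => sqrte (N t)) \_ D) t| `^ 2))%E.
  rewrite integral_mkcond; apply: eq_integral => t _; rewrite !patchE.
  case: ifP => _; last by rewrite abse0 poweR0r.
  rewrite gee0_abs ?sqrte_ge0// -poweR12_sqrt// -poweRrM mulVf// poweRe1//.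
rewrite E; apply/idP/idP => h.
  have := poweR_lty 2 h; rewrite poweR_Lnorm//.
by rewrite unlock /Lnorm; exact: poweR_lty.
Qed.

Lemma normM_le_sqrD (R : realType) (x y : R) : `|x * y| <= x ^+ 2 + y ^+ 2.
Proof.
have h1 : 0 <= (x + y) ^+ 2 by exact: sqr_ge0.
have h2 : 0 <= (x - y) ^+ 2 by exact: sqr_ge0.
have h3 : 0 <= x ^+ 2 by exact: sqr_ge0.
have h4 : 0 <= y ^+ 2 by exact: sqr_ge0.
by rewrite ler_norml; apply/andP; split; nra.
Qed.

Lemma sqrD_le (R : realType) (x y : R) : (x + y) ^+ 2 <= 2 * (x ^+ 2 + y ^+ 2).
Proof. by have := sqr_ge0 (x - y); nra. Qed.

(** * Weighted spaces *)

Section WeightedSpaces.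
Context {R : realType} (P : heston R).
Local Notation mR := (measurableTypeR R).
Local Notation H := (halfplane : set (mR * mR)).
Implicit Types (m : R) (z : R * R) (f g h : R * R -> R).

Lemma weight_ge0 m z : 0 <= weight P m z.
Proof. by rewrite mulr_ge0 ?powR_ge0 ?expR_ge0. Qed.

Lemma weight_gt0 m z : halfplane z -> 0 < weight P m z.
Proof.
by move=> [_ /=]; rewrite in_itv/= andbT => z0; rewrite mulr_gt0 ?powR_gt0 ?expR_gt0.
Qed.

Lemma measurable_weight m : measurable_fun (setT : set (mR * mR)) (weight P m).
Proof.
have m1 : measurable_fun (setT : set (mR * mR)) (fun z => z.1 : R).
  exact: measurable_fst.
have m2 : measurable_fun (setT : set (mR * mR)) (fun z => z.2 : R).
  exact: measurable_snd.
apply: measurable_funM.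
  exact: (measurableT_comp (measurable_powR (beta P - 1)) m2).
apply: (measurableT_comp (@measurable_expR R)).
apply: measurable_funB.
- apply: measurable_funM; first exact: measurable_cst.
  exact: (measurableT_comp (continuous_measurable_fun (@norm_continuous _ R)) m1).
- by apply: measurable_funM; [exact: measurable_cst|exact: m2].
Qed.

Local Notation winteg m f :=
  (leb2.-integrable H (EFin \o (fun z => f z * weight P m z))).

Lemma measurable_weighted m f : measurable_fun H f ->
  measurable_fun H (fun z => f z * weight P m z).
Proof.
by move=> mf; apply: measurable_funM => //; apply: measurable_funTS;
  exact: measurable_weight.
Qed.

Lemma winteg_le m f g : measurable_fun H g ->
  (forall z, halfplane z -> `|g z| <= f z) -> winteg m f -> winteg m g.
Proof.
move=> mg gf; apply: le_integrable; first exact: measurable_halfplane.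
- by apply/measurable_EFinP; exact: measurable_weighted.
- move=> z Hz /=; rewrite lee_fin !normrM ler_wpM2r//.
  by rewrite (le_trans (gf z Hz))// ler_norm.
Qed.

Lemma winteg_add m f g : winteg m f -> winteg m g -> winteg m (fun z => f z + g z).
Proof.
move=> if_ ig; have := integrableD measurable_halfplane if_ ig.
by apply: eq_integrable => [|z _ /=]; [exact: measurable_halfplane|rewrite mulrDl].
Qed.

Lemma winteg_scale m k f : winteg m f -> winteg m (fun z => k * f z).
Proof.
move=> if_; have := integrableZl measurable_halfplane k if_.
by apply: eq_integrable => [|z _ /=]; [exact: measurable_halfplane|rewrite -EFinM mulrA].
Qed.

Lemma winteg_sqr m f : measurable_fun H f ->
  (wint P m (fun z => f z ^+ 2)%R < +oo)%E <-> winteg m (fun z => f z ^+ 2).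
Proof.
move=> mf.
have E : wint P m (fun z => f z ^+ 2) =
    (\int[leb2]_(z in H) `|(f z ^+ 2 * weight P m z)%R%:E|)%E.
  apply: eq_integral => z _; rewrite gee0_abs// lee_fin.
  by rewrite mulr_ge0 ?sqr_ge0 ?weight_ge0.
rewrite E; split => [h|/integrableP[]//].
apply/integrableP; split => //; apply/measurable_EFinP.
by apply: measurable_weighted; exact: measurable_funX.
Qed.

Lemma L2wP m f : fs_mem (L2w P m) f <->
  measurable_fun H f /\ winteg m (fun z => f z ^+ 2).
Proof.
split=> -[mf h]; split => //; first exact/winteg_sqr.
exact/(winteg_sqr _ _).2.
Qed.

Lemma L2w_le m f g : measurable_fun H g ->
  (forall z, halfplane z -> `|g z| <= `|f z|) -> fs_mem (L2w P m) f ->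
  fs_mem (L2w P m) g.
Proof.
move=> mg gf /L2wP[mf if_]; apply/L2wP; split => //.
apply: winteg_le if_; first exact: measurable_funX.
move=> z Hz; rewrite ger0_norm ?sqr_ge0//.
by rewrite -(real_normK (num_real (g z))) -(real_normK (num_real (f z))) lerXn2r ?nnegrE//; exact: gf.
Qed.

Lemma L2w_mul m f g : fs_mem (L2w P m) f -> fs_mem (L2w P m) g ->
  winteg m (fun z => f z * g z).
Proof.
move=> /L2wP[mf if_] /L2wP[mg ig].
apply: winteg_le (winteg_add if_ ig); first exact: measurable_funM.
by move=> z _; exact: normM_le_sqrD.
Qed.

Lemma L2w_add m f g : fs_mem (L2w P m) f -> fs_mem (L2w P m) g ->
  fs_mem (L2w P m) (fun z => f z + g z).
Proof.
move=> /L2wP[mf if_] /L2wP[mg ig]; apply/L2wP; split; first exact: measurable_funD.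
apply: winteg_le (winteg_scale 2 (winteg_add if_ ig)).
  by apply: measurable_funX; exact: measurable_funD.
by move=> z _; rewrite ger0_norm ?sqr_ge0//; exact: sqrD_le.
Qed.

Lemma L2w_scale m k f : fs_mem (L2w P m) f -> fs_mem (L2w P m) (fun z => k * f z).
Proof.
move=> /L2wP[mf if_]; apply/L2wP; split.
  by apply: measurable_funM => //; exact: measurable_cst.
have := winteg_scale (k ^+ 2) if_; apply: eq_integrable => [|z _ /=].
  exact: measurable_halfplane.
by rewrite exprMn.
Qed.

Lemma L2w_sub m f g : fs_mem (L2w P m) f -> fs_mem (L2w P m) g ->
  fs_mem (L2w P m) (fun z => f z - g z).
Proof.
move=> hf hg; have := L2w_add hf (L2w_scale (-1) hg).
by rewrite (_ : (fun z => f z + _) = (fun z => f z - g z))//;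
  apply/funext => z; rewrite mulN1r.
Qed.

End WeightedSpaces.

(** * The space V *)

Section FixedTime.
Context {R : realType} (P : heston R).
Local Notation mR := (measurableTypeR R).
Local Notation H := (halfplane : set (mR * mR)).
Implicit Types (m k : R) (z : R * R) (f g h : R * R -> R) (d : bool).

Lemma weak_derivP v f : weakly_derivable v f -> is_weak_deriv v f (weak_deriv v f).
Proof. by move=> vf; exact: xgetPex. Qed.

Lemma weak_deriv_ae d f g : is_weak_deriv (dirv d) f g ->
  {ae leb2, forall z, halfplane z -> g z = weak_deriv (dirv d) f z}.
Proof.
move=> fg; apply: (weak_deriv_unique fg); apply: weak_derivP; by exists g.
Qed.

Lemma measurable_snd2 : measurable_fun H (fun z => z.2 : R).
Proof. by apply: measurable_funTS; exact: measurable_snd. Qed.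

Lemma measurable_1snd2 : measurable_fun H (fun z => 1 + z.2 : R).
Proof. by apply: measurable_funD; [exact: measurable_cst|exact: measurable_snd2]. Qed.

Lemma measurable_sqrt_comp (D : set (mR * mR)) f : measurable_fun D f ->
  measurable_fun D (fun z => Num.sqrt (f z)).
Proof.
exact: (measurableT_comp (continuous_measurable_fun (@sqrt_continuous R))).
Qed.

Lemma halfplane_gt0 z : halfplane z -> 0 < z.2.
Proof. by move=> [_ /=]; rewrite in_itv/= andbT. Qed.

Lemma weak_deriv_measurable v f g : is_weak_deriv v f g ->
  measurable_fun H f /\ measurable_fun H g.
Proof. by move=> [[mf _] [mg _] _]. Qed.

Lemma sqr_scale_norm (s a b : R) :
  (s * a) ^+ 2 + (s * b) ^+ 2 = (s * Num.sqrt (a ^+ 2 + b ^+ 2)) ^+ 2.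
Proof. by rewrite !exprMn sqr_sqrtr ?addr_ge0 ?sqr_ge0// mulrDr. Qed.

Lemma inVP f : inV P f -> [/\ inH P f,
  inH P (fun z => Num.sqrt (1 + z.2) * f z),
  is_weak_deriv dir_x f (dx f) /\ is_weak_deriv dir_y f (dy f) &
  inH P (fun z => Num.sqrt z.2 * dx f z) /\
  inH P (fun z => Num.sqrt z.2 * dy f z)].
Proof.
move=> [hf [/weak_derivP wx /weak_derivP wy] h1 h2].
have [mf mx] := weak_deriv_measurable wx.
have [_ my] := weak_deriv_measurable wy.
have ms := measurable_sqrt_comp measurable_snd2.
split; [exact: hf|exact: h1|exact: (conj wx wy)|split]; apply: (@L2w_le _ P (mu P) _ _ _ _ h2).
- exact: (measurable_funM ms mx).
- move=> z Hz; rewrite !normrM ler_wpM2l// [`|grad_norm _ _|]ger0_norm ?sqrtr_ge0//.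
  by rewrite -sqrtr_sqr ler_wsqrtr// lerDl sqr_ge0.
- exact: (measurable_funM ms my).
- move=> z Hz; rewrite !normrM ler_wpM2l// [`|grad_norm _ _|]ger0_norm ?sqrtr_ge0//.
  by rewrite -sqrtr_sqr ler_wsqrtr// lerDr sqr_ge0.
Qed.

(** Membership in V refers to chosen representatives of the weak derivatives;
    by uniqueness, any representatives will do. *)
Lemma inVI f gx gy : is_weak_deriv dir_x f gx -> is_weak_deriv dir_y f gy ->
  inH P (fun z => Num.sqrt (1 + z.2) * f z) ->
  inH P (fun z => Num.sqrt z.2 * gx z) ->
  inH P (fun z => Num.sqrt z.2 * gy z) -> inV P f.
Proof.
move=> wx wy h1 h2 h3.
have [mf mgx] := weak_deriv_measurable wx.
have [_ mgy] := weak_deriv_measurable wy.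
have wdx : is_weak_deriv dir_x f (dx f) by apply: weak_derivP; exists gx.
have wdy : is_weak_deriv dir_y f (dy f) by apply: weak_derivP; exists gy.
have [_ mx] := weak_deriv_measurable wdx.
have [_ my] := weak_deriv_measurable wdy.
have ms := measurable_sqrt_comp measurable_snd2.
split.
- apply: (L2w_le mf _ h1) => z Hz; rewrite normrM ler_peMl// ger0_norm ?sqrtr_ge0//.
  by rewrite -[leLHS]sqrtr1 ler_wsqrtr// lerDl ltW// halfplane_gt0.
- by split; [exists gx|exists gy].
- exact: h1.
have mgn : measurable_fun H (grad_norm f).
  exact: (measurable_sqrt_comp (measurable_funD (measurable_funX 2 mx) (measurable_funX 2 my))).
have [/L2wP[_ i2] /L2wP[_ i3]] := conj h2 h3.
apply/L2wP; split; first exact: (measurable_funM ms mgn).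
apply: (ae_eq_Rintegral measurable_halfplane (winteg_add i2 i3) _ _).1.
  by apply: measurable_weighted; exact: (measurable_funX 2 (measurable_funM ms mgn)).
apply: ae_imp2 (weak_deriv_ae (d := true) wx) (weak_deriv_ae (d := false) wy).
move=> z ex ey Hz; rewrite -[RHS]/((_ * Num.sqrt (weak_deriv (dirv true) f z ^+ 2 + weak_deriv (dirv false) f z ^+ 2)) ^+ 2 * _).
by rewrite -(ex Hz) -(ey Hz) sqr_scale_norm.
Qed.

Lemma is_weak_derivN v f g : is_weak_deriv v f g ->
  is_weak_deriv v (fun z => - f z) (fun z => - g z).
Proof.
move=> fg; have := is_weak_derivB (is_weak_derivB fg fg) fg.
rewrite (_ : (fun z => f z - f z - f z) = (fun z => - f z)); last first.
  by apply/funext => z; rewrite subrr sub0r.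
by rewrite (_ : (fun z => g z - g z - g z) = (fun z => - g z))//;
  apply/funext => z; rewrite subrr sub0r.
Qed.

Lemma sqr_le_real (a b : R) : `|a| <= `|b| -> a ^+ 2 <= b ^+ 2.
Proof.
move=> ab; rewrite -(real_normK (num_real a)) -(real_normK (num_real b)).
by rewrite lerXn2r ?nnegrE.
Qed.

Lemma L2w_le2 m f1 f2 g : measurable_fun H g ->
  (forall z, halfplane z -> g z ^+ 2 <= 2 * (f1 z ^+ 2 + f2 z ^+ 2)) ->
  fs_mem (L2w P m) f1 -> fs_mem (L2w P m) f2 -> fs_mem (L2w P m) g.
Proof.
move=> mg gf /L2wP[_ i1] /L2wP[_ i2]; apply/L2wP; split; first exact: mg.
apply: winteg_le (winteg_scale 2 (winteg_add i1 i2)).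
  exact: (measurable_funX 2 mg).
by move=> z Hz; rewrite ger0_norm ?sqr_ge0//; exact: gf.
Qed.

(** Integrand of the squared norm of V. *)
Definition Vdens f z := z.2 * grad_norm f z ^+ 2 + (1 + z.2) * f z ^+ 2.

Lemma sqr_grad_norm f z : grad_norm f z ^+ 2 = dx f z ^+ 2 + dy f z ^+ 2.
Proof. by rewrite sqr_sqrtr// addr_ge0 ?sqr_ge0. Qed.

Lemma measurable_Vdens f : inV P f ->
  measurable_fun H (fun z => Vdens f z * weight P (mu P) z).
Proof.
move=> /inVP[_ _ [wx wy] _].
have [mf mx] := weak_deriv_measurable wx.
have [_ my] := weak_deriv_measurable wy.
have m2 := measurable_snd2.
apply: measurable_weighted.
have mg : measurable_fun H (fun z => grad_norm f z ^+ 2).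
  have mg := measurable_funD (measurable_funX 2 mx) (measurable_funX 2 my).
  by apply: eq_measurable_fun mg => z _; rewrite sqr_grad_norm.
exact: (measurable_funD (measurable_funM m2 mg)
  (measurable_funM measurable_1snd2 (measurable_funX 2 mf))).
Qed.

Lemma Vdens_ge0 f z : halfplane z -> 0 <= Vdens f z.
Proof.
move=> /halfplane_gt0 z0.
by rewrite addr_ge0// mulr_ge0 ?sqr_ge0//; rewrite ?addr_ge0// ltW.
Qed.

Lemma Vdens_arith (y a b c x1 x2 y1 y2 a1 a2 : R) : 0 < y ->
  b <= 2 * (x1 + x2) -> c <= 2 * (y1 + y2) -> a <= 2 * (a1 + a2) ->
  y * (b + c) + (1 + y) * a <=
  2 * (y * (x1 + y1) + (1 + y) * a1 + (y * (x2 + y2) + (1 + y) * a2)).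
Proof.
move=> y0 hb hc ha; have y0' := ltW y0.
have := ler_wpM2l y0' hb; have := ler_wpM2l y0' hc; have := ler_wpM2l y0' ha.
lra.
Qed.

(** Membership in V and the norm depend only on the squares of the function
    and of its weak derivatives, so they are inherited by domination. *)
Lemma inV_dominated f1 f2 h gx gy : inV P f1 -> inV P f2 ->
  is_weak_deriv dir_x h gx -> is_weak_deriv dir_y h gy ->
  (forall z, h z ^+ 2 <= 2 * (f1 z ^+ 2 + f2 z ^+ 2)) ->
  (forall z, gx z ^+ 2 <= 2 * (dx f1 z ^+ 2 + dx f2 z ^+ 2)) ->
  (forall z, gy z ^+ 2 <= 2 * (dy f1 z ^+ 2 + dy f2 z ^+ 2)) ->
  inV P h /\ (wint P (mu P) (Vdens h) <=
    2%:E * (wint P (mu P) (Vdens f1) + wint P (mu P) (Vdens f2)))%E.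
Proof.
move=> v1 v2 wx wy h1 h2 h3.
have vh : inV P h.
  have [_ a1 _ [b1 c1]] := inVP v1; have [_ a2 _ [b2 c2]] := inVP v2.
  have [mh mgx] := weak_deriv_measurable wx.
  have [_ mgy] := weak_deriv_measurable wy.
  have ms := measurable_sqrt_comp measurable_snd2.
  have m1 : measurable_fun H (fun z => Num.sqrt (1 + z.2)).
    exact: (measurable_sqrt_comp measurable_1snd2).
  have sc (s a b c : R) : a ^+ 2 <= 2 * (b ^+ 2 + c ^+ 2) ->
      (s * a) ^+ 2 <= 2 * ((s * b) ^+ 2 + (s * c) ^+ 2).
    move=> abc; rewrite !exprMn -mulrDr [leRHS]mulrCA ler_wpM2l ?sqr_ge0//.
  apply: (inVI wx wy).
  - by apply: (L2w_le2 (measurable_funM m1 mh) _ a1 a2) => z _; apply: sc; exact: h1.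
  - by apply: (L2w_le2 (measurable_funM ms mgx) _ b1 b2) => z _; apply: sc; exact: h2.
  - by apply: (L2w_le2 (measurable_funM ms mgy) _ c1 c2) => z _; apply: sc; exact: h3.
split; first exact: vh.
have m1 := measurable_Vdens v1; have m2 := measurable_Vdens v2.
have w0 f z : halfplane z -> (0 <= (Vdens f z * weight P (mu P) z)%:E)%E.
  by move=> Hz; rewrite lee_fin mulr_ge0 ?weight_ge0 ?Vdens_ge0.
have me f : measurable_fun H (fun z => Vdens f z * weight P (mu P) z) ->
    measurable_fun H (fun z => (Vdens f z * weight P (mu P) z)%:E).
  by move=> mf; exact/measurable_EFinP.
rewrite /wint -ge0_integralD//; [|exact: measurable_halfplane|exact: w0|exact: me|exact: w0|exact: me].
rewrite -ge0_integralZl//; last 3 first.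
- exact: measurable_halfplane.
- exact: (emeasurable_funD (me _ m1) (me _ m2)).
- by move=> z Hz; rewrite adde_ge0 ?w0.
apply: ae_le_lower_integral_r.
- exact: measurable_halfplane.
- exact: (measurable_funeM 2%:E (emeasurable_funD (me _ m1) (me _ m2))).
- by move=> z Hz; exact: w0.
- by move=> z Hz; rewrite mule_ge0 ?adde_ge0 ?w0.
apply: ae_imp2 (weak_deriv_ae (d := true) wx) (weak_deriv_ae (d := false) wy).
move=> z ex ey Hz; rewrite -EFinD -EFinM lee_fin -mulrDl mulrA ler_wpM2r ?weight_ge0//.
have z0 := halfplane_gt0 Hz.
rewrite /Vdens (sqr_grad_norm h z) (sqr_grad_norm f1 z) (sqr_grad_norm f2 z).
have -> : dx h z = gx z by rewrite (ex Hz).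
have -> : dy h z = gy z by rewrite (ey Hz).
exact: (Vdens_arith z0 (h2 z) (h3 z) (h1 z)).
Qed.

End FixedTime.

(** * Truncated differences in V *)

Section Truncation.
Context {R : realType} (P : heston R).
Local Notation mR := (measurableTypeR R).
Local Notation H := (halfplane : set (mR * mR)).
Implicit Types (m k : R) (z : R * R) (f g h : R * R -> R) (d : bool).

Lemma pos_cases (r : R) : (0 < r /\ pos r = r /\ step r = 1) \/
  (r <= 0 /\ pos r = 0 /\ step r = 0).
Proof.
rewrite /pos /step maxEle; case: (ltP 0 r) => r0; by [left|right].
Qed.

Lemma pos_diff_sqr (a b k : R) : 0 <= k ->
  [/\ pos (a - b - k) ^+ 2 <= 2 * (a ^+ 2 + b ^+ 2),
      (a - pos (a - b - k)) ^+ 2 <= 2 * (a ^+ 2 + b ^+ 2) &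
      (b + pos (a - b - k)) ^+ 2 <= 2 * (a ^+ 2 + b ^+ 2)].
Proof.
move=> k0; have h1 := sqr_ge0 (a + b); have h2 := sqr_ge0 a; have h3 := sqr_ge0 b.
have h4 := sqr_ge0 (a - b - k); have h5 := sqr_ge0 (b + k - (a + b)).
have h6 := sqr_ge0 (a - k - (a + b)); have h7 := sqr_ge0 k.
case: (pos_cases (a - b - k)) => -[r0 [-> _]]; last by split; nra.
by have h8 := mulr_ge0 k0 (ltW r0); split; nra.
Qed.

Lemma step_diff_sqr (r a b : R) :
  [/\ (step r * (a - b)) ^+ 2 <= 2 * (a ^+ 2 + b ^+ 2),
      (a - step r * (a - b)) ^+ 2 <= 2 * (a ^+ 2 + b ^+ 2) &
      (b + step r * (a - b)) ^+ 2 <= 2 * (a ^+ 2 + b ^+ 2)].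
Proof.
have h1 := sqr_ge0 (a + b); have h2 := sqr_ge0 a; have h3 := sqr_ge0 b.
by case: (pos_cases r) => -[r0 [_ ->]]; split; nra.
Qed.

Section Pair.
Variables (f1 f2 : R * R -> R) (k : R).
Hypotheses (v1 : inV P f1) (v2 : inV P f2) (k0 : 0 <= k).

Let w z := pos (f1 z - f2 z - k).
Let s z := step (f1 z - f2 z - k).

(** With w = (f1 - f2 - k)^+ one has f1 - w = min(f1, f2 + k) and f2 + w =
    max(f2, f1 - k): at each point the values and the gradients are controlled
    by those of f1 and f2. *)
Lemma truncation_deriv d :
  [/\ is_weak_deriv (dirv d) w
        (fun z => s z * (weak_deriv (dirv d) f1 z - weak_deriv (dirv d) f2 z)),
      is_weak_deriv (dirv d) (fun z => f1 z - w z) (fun z => weak_deriv (dirv d) f1 z -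
        s z * (weak_deriv (dirv d) f1 z - weak_deriv (dirv d) f2 z)) &
      is_weak_deriv (dirv d) (fun z => f2 z + w z) (fun z => weak_deriv (dirv d) f2 z +
        s z * (weak_deriv (dirv d) f1 z - weak_deriv (dirv d) f2 z))].
Proof.
have D1 : is_weak_deriv (dirv d) f1 (weak_deriv (dirv d) f1).
  by have [_ _ [wx wy] _] := inVP v1; case: d; [exact: wx|exact: wy].
have D2 : is_weak_deriv (dirv d) f2 (weak_deriv (dirv d) f2).
  by have [_ _ [wx wy] _] := inVP v2; case: d {D1}; [exact: wx|exact: wy].
have W := weak_deriv_pos k0 (is_weak_derivB D1 D2).
split; [exact: W|exact: (is_weak_derivB D1 W)|].
have := is_weak_derivB D2 (is_weak_derivN W).
rewrite (_ : (fun z => f2 z - _) = (fun z => f2 z + w z)); last first.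
  by apply/funext => z; rewrite opprK.
rewrite (_ : (fun z => weak_deriv (dirv d) f2 z - _) = (fun z => weak_deriv (dirv d) f2 z +
        s z * (weak_deriv (dirv d) f1 z - weak_deriv (dirv d) f2 z))) => //.
by apply/funext => z; rewrite opprK.
Qed.

Let w_sqr z : [/\ w z ^+ 2 <= 2 * (f1 z ^+ 2 + f2 z ^+ 2),
  (f1 z - w z) ^+ 2 <= 2 * (f1 z ^+ 2 + f2 z ^+ 2) &
  (f2 z + w z) ^+ 2 <= 2 * (f1 z ^+ 2 + f2 z ^+ 2)].
Proof. exact: pos_diff_sqr. Qed.

Let s_sqr z (a b : R) := step_diff_sqr (f1 z - f2 z - k) a b.

Lemma truncation_inV : inV P w /\ inV P (fun z => - w z).
Proof.
have [x1 _ _] := truncation_deriv true; have [y1 _ _] := truncation_deriv false.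
split.
- refine (proj1 (inV_dominated v1 v2 x1 y1 _ _ _)) => z; [by have [] := w_sqr z|
  by have [] := s_sqr z (dx f1 z) (dx f2 z)|by have [] := s_sqr z (dy f1 z) (dy f2 z)].
- refine (proj1 (inV_dominated v1 v2 (is_weak_derivN x1) (is_weak_derivN y1) _ _ _)) => z;
  rewrite sqrrN; [by have [] := w_sqr z|
  by have [] := s_sqr z (dx f1 z) (dx f2 z)|by have [] := s_sqr z (dy f1 z) (dy f2 z)].
Qed.

Lemma truncation_competitors :
  (inV P (fun z => f1 z - w z) /\
   (wint P (mu P) (Vdens (fun z => f1 z - w z)%R) <=
    2%:E * (wint P (mu P) (Vdens f1) + wint P (mu P) (Vdens f2)))%E) /\
  (inV P (fun z => f2 z + w z) /\
   (wint P (mu P) (Vdens (fun z => f2 z + w z)%R) <=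
    2%:E * (wint P (mu P) (Vdens f1) + wint P (mu P) (Vdens f2)))%E).
Proof.
have [_ x1 x2] := truncation_deriv true; have [_ y1 y2] := truncation_deriv false.
split.
- apply: (inV_dominated v1 v2 x1 y1) => z; [by have [] := w_sqr z|
  by have [] := s_sqr z (dx f1 z) (dx f2 z)|by have [] := s_sqr z (dy f1 z) (dy f2 z)].
- apply: (inV_dominated v1 v2 x2 y2) => z; [by have [] := w_sqr z|
  by have [] := s_sqr z (dx f1 z) (dx f2 z)|by have [] := s_sqr z (dy f1 z) (dy f2 z)].
Qed.

End Pair.
End Truncation.

(** * The bilinear form on truncated differences *)

Lemma Rintegral_ge0_ae (d : measure_display) (T : measurableType d) (R : realType)
    (m : {measure set T -> \bar R}) (D : set T) (f : T -> R) :
  measurable D -> m.-integrable D (EFin \o f) ->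
  {ae m, forall x, D x -> 0 <= f x} -> 0 <= \int[m]_(x in D) f x.
Proof.
move=> mD if_ f0.
have mf : measurable_fun D f by have /measurable_EFinP := measurable_int _ if_.
have mn : measurable_fun D (fun x => `|f x|).
  exact: (measurableT_comp (continuous_measurable_fun (@norm_continuous _ R)) mf).
rewrite (ae_eq_Rintegral mD if_ mn _).2; first exact: Rintegral_ge0.
by apply: ae_imp f0 => x h Dx; rewrite ger0_norm// h.
Qed.

Lemma le_Rintegral_ae (d : measure_display) (T : measurableType d) (R : realType)
    (m : {measure set T -> \bar R}) (D : set T) (f g : T -> R) :
  measurable D -> m.-integrable D (EFin \o f) -> m.-integrable D (EFin \o g) ->
  {ae m, forall x, D x -> f x <= g x} ->
  \int[m]_(x in D) f x <= \int[m]_(x in D) g x.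
Proof.
move=> mD if_ ig fg; rewrite -subr_ge0 -(RintegralB mD ig if_).
apply: (Rintegral_ge0_ae mD (integrableB mD ig if_)).
by apply: ae_imp fg => x h Dx; rewrite subr_ge0 h.
Qed.

Section FormInequality.
Context {R : realType} (P : heston R).
Local Notation mR := (measurableTypeR R).
Local Notation H := (halfplane : set (mR * mR)).
Implicit Types (m k : R) (z : R * R) (f g h : R * R -> R) (d : bool).

Local Notation winteg m f :=
  (leb2.-integrable H (EFin \o (fun z => f z * weight P m z))).
Local Notation mu := (Defs.mu P).

Lemma wRintD f g : winteg mu f -> winteg mu g ->
  wRint P (fun z => f z + g z) = wRint P f + wRint P g.
Proof.
move=> if_ ig; rewrite /wRint -(RintegralD measurable_halfplane if_ ig).
by apply: eq_Rintegral => z _; rewrite mulrDl.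
Qed.

Lemma wRintZ k f : winteg mu f -> wRint P (fun z => k * f z) = k * wRint P f.
Proof.
move=> if_; rewrite /wRint -(RintegralZl k measurable_halfplane if_).
by apply: eq_Rintegral => z _; rewrite mulrA.
Qed.

Lemma wRint_le_ae f g : winteg mu f -> winteg mu g ->
  {ae leb2, forall z, halfplane z -> f z <= g z} -> wRint P f <= wRint P g.
Proof.
move=> if_ ig fg; apply: (le_Rintegral_ae measurable_halfplane if_ ig).
by apply: ae_imp fg => z h Hz; rewrite ler_wpM2r ?weight_ge0 ?h.
Qed.

Lemma winteg_y f g : inH P (fun z => Num.sqrt z.2 * f z) ->
  inH P (fun z => Num.sqrt z.2 * g z) -> winteg mu (fun z => z.2 * (f z * g z)).
Proof.
move=> hf hg; have := L2w_mul hf hg.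
apply: eq_integrable => [|z /set_mem/halfplane_gt0 z0 /=]; first exact: measurable_halfplane.
by congr (_ * _)%:E; rewrite mulrACA -expr2 sqr_sqrtr// ltW.
Qed.

Lemma inV_sqrty f : inV P f -> inH P (fun z => Num.sqrt z.2 * f z).
Proof.
move=> /inVP[[mf _] h [wx _] _]; apply: L2w_le h.
  exact: (measurable_funM (measurable_sqrt_comp measurable_snd2) mf).
move=> z /halfplane_gt0 z0; rewrite !normrM ler_wpM2r// !ger0_norm ?sqrtr_ge0//.
by rewrite ler_wsqrtr// lerDr.
Qed.

Lemma sg_bounded (c : R -> R) : exists B, forall x, `|c (Num.sg x)| <= B.
Proof.
exists (`|c 1| + `|c 0| + `|c (-1)|) => x.
by case: sgrP => _; rewrite ?(lerDr,lerDl,addr_ge0)// -addrA ?lerDl ?addr_ge0// addrCA lerDl addr_ge0.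
Qed.

Lemma coef_j_bounded : exists B, forall x, `|coef_j P x| <= B.
Proof. exact: sg_bounded (fun s => 2^-1 * (1 - gamma P * s - mu * rho P * sigma P)). Qed.

Lemma coef_k_bounded : exists B, forall x, `|coef_k P x| <= B.
Proof.
exact: sg_bounded (fun s => kappa P - gamma P * rho P * sigma P / 2 * s - mu * sigma P ^+ 2 / 2).
Qed.

(** Completing the squares in the nondegenerate quadratic form of the
    principal part absorbs the first-order terms. As j and k are bounded, K
    depends on the parameters only. *)
Lemma form_lower_bound : admissible P -> exists K, 0 < K /\ forall x X Y W,
  - K * W ^+ 2 <= 2^-1 * (X ^+ 2 + 2 * (rho P * sigma P) * (X * Y) + sigma P ^+ 2 * Y ^+ 2)
    + (coef_j P x * X + coef_k P x * Y) * W.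
Proof.
move=> [[_ _ s0] [/andP[r1 r2] _ _ _]].
have [J hJ] := coef_j_bounded; have [L hL] := coef_k_bounded.
set s := sigma P ^+ 2 * (1 - rho P ^+ 2).
have sp : 0 < s by rewrite mulr_gt0 ?exprn_gt0// subr_gt0; nra.
(* With X + rho sigma Y as new variable, the coefficient of Y is
   l = k - j rho sigma, which M bounds; s is that of Y^2. *)
pose M := L + J * `|rho P * sigma P|.
have J0 : 0 <= J := le_trans (normr_ge0 _) (hJ 0).
exists (1 + (J ^+ 2 + M ^+ 2 / s) / 2); split.
  by rewrite ltr_pwDl// divr_ge0// addr_ge0 ?sqr_ge0// divr_ge0 ?sqr_ge0// ltW.
move=> x X Y W; move: (coef_j P x) (coef_k P x) (hJ x) (hL x) => j k hj hk.
set l := k - j * (rho P * sigma P).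
have hl : `|l| <= M.
  rewrite /l (le_trans (ler_normB _ _))// lerD// normrM ler_wpM2r//.
have hj2 : j ^+ 2 <= J ^+ 2 by apply: sqr_le_real; rewrite (ger0_norm J0).
have hl2 : l ^+ 2 <= M ^+ 2 by apply: sqr_le_real; rewrite (le_trans hl)// ler_norm.
have h1 := sqr_ge0 (X + rho P * sigma P * Y + j * W).
have h2 : 0 <= s * (Y + l * W / s) ^+ 2 by rewrite mulr_ge0 ?sqr_ge0// ltW.
have h3 : 0 <= (J ^+ 2 - j ^+ 2) * W ^+ 2 by rewrite mulr_ge0 ?sqr_ge0// subr_ge0.
have h4 : 0 <= (M ^+ 2 - l ^+ 2) / s * W ^+ 2.
  by rewrite mulr_ge0 ?sqr_ge0// divr_ge0 ?subr_ge0// ltW.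
have h5 := sqr_ge0 W.
rewrite -subr_ge0.
have -> : 2^-1 * (X ^+ 2 + 2 * (rho P * sigma P) * (X * Y) + sigma P ^+ 2 * Y ^+ 2)
    + (j * X + k * Y) * W - - (1 + (J ^+ 2 + M ^+ 2 / s) / 2) * W ^+ 2 =
  2^-1 * ((X + rho P * sigma P * Y + j * W) ^+ 2 + s * (Y + l * W / s) ^+ 2 +
    (J ^+ 2 - j ^+ 2) * W ^+ 2 + (M ^+ 2 - l ^+ 2) / s * W ^+ 2) + W ^+ 2.
  have sn : s != 0 by rewrite gt_eqF.
  have -> : k = l + j * (rho P * sigma P) by rewrite /l subrK.
  have E (r b : R) : r != 0 -> r * (Y + b * W / r) ^+ 2 =
      r * Y ^+ 2 + 2 * b * W * Y + b ^+ 2 * W ^+ 2 / r by move=> rn; field.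
  rewrite (E s l sn) (_ : s * Y ^+ 2 = sigma P ^+ 2 * (1 - rho P ^+ 2) * Y ^+ 2)//; move: (l) (s) sn => a b bn; field.
  exact: bn.
lra.
Qed.

End FormInequality.

Section FormDifference.
Context {R : realType} (P : heston R).
Local Notation mR := (measurableTypeR R).
Local Notation H := (halfplane : set (mR * mR)).
Implicit Types (m k : R) (z : R * R) (f g h : R * R -> R) (d : bool).

Local Notation winteg m f :=
  (leb2.-integrable H (EFin \o (fun z => f z * weight P m z))).
Local Notation mu := (Defs.mu P).

Definition form_principal f g z := z.2 *
  (dx f z * dx g z + rho P * sigma P * dx f z * dy g z +
   rho P * sigma P * dy f z * dx g z + sigma P ^+ 2 * dy f z * dy g z).

Definition form_lower f g z :=
  z.2 * (coef_j P z.1 * dx f z + coef_k P z.1 * dy f z) * g z.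

Lemma form_principal_expand (y a b c e r s : R) :
  y * (a * c) + r * (y * (a * e)) + r * (y * (b * c)) + s * (y * (b * e)) =
  y * (a * c + r * a * e + r * b * c + s * b * e).
Proof. by ring. Qed.

Lemma winteg_form_principal f g : inV P f -> inV P g ->
  winteg mu (form_principal f g).
Proof.
move=> /inVP[_ _ _ [xf yf]] /inVP[_ _ _ [xg yg]].
rewrite (_ : form_principal f g = fun z => z.2 * (dx f z * dx g z) +
   rho P * sigma P * (z.2 * (dx f z * dy g z)) +
   rho P * sigma P * (z.2 * (dy f z * dx g z)) +
   sigma P ^+ 2 * (z.2 * (dy f z * dy g z))).
  apply: winteg_add; last exact: (winteg_scale _ (winteg_y yf yg)).
  apply: winteg_add; last exact: (winteg_scale _ (winteg_y yf xg)).
  apply: winteg_add; last exact: (winteg_scale _ (winteg_y xf yg)).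
  exact: (winteg_y xf xg).
by apply/funext => z; rewrite form_principal_expand.
Qed.

Lemma measurable_sg1 : measurable_fun H (fun z => Num.sg z.1 : R).
Proof.
have E (x : R) : Num.sg x = step x - step (- x).
  rewrite /step oppr_gt0; case: (ltrgtP x 0) => h.
  - by rewrite ltr0_sg// sub0r.
  - by rewrite gtr0_sg// subr0.
  - by rewrite h sgr0 subrr.
have m1 : measurable_fun H (fun z => z.1 : R).
  by apply: measurable_funTS; exact: measurable_fst.
rewrite (_ : (fun z => Num.sg z.1 : R) = fun z => step z.1 - step (- z.1)); last first.
  by apply/funext => z; rewrite E.
apply: measurable_funB; first exact: (measurableT_comp (@measurable_step R) m1).
exact: (measurableT_comp (@measurable_step R) (measurable_funN m1)).
Qed.

Lemma inH_bounded_mul (c : R * R -> R) f : measurable_fun H c ->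
  (exists B, forall z, `|c z| <= B) -> measurable_fun H f ->
  inH P (fun z => Num.sqrt z.2 * f z) ->
  inH P (fun z => Num.sqrt z.2 * (c z * f z)).
Proof.
move=> mc [B hB] mf hf; apply: (L2w_le _ _ (L2w_scale B hf)).
  exact: (measurable_funM (measurable_sqrt_comp measurable_snd2) (measurable_funM mc mf)).
move=> z _; rewrite mulrCA !normrM ler_wpM2r ?mulr_ge0//.
by rewrite (le_trans (hB z))// ler_norm.
Qed.

Lemma winteg_form_lower f g : inV P f -> inV P g -> winteg mu (form_lower f g).
Proof.
move=> /inVP[_ _ [wx wy] [xf yf]] vg.
have [_ mx] := weak_deriv_measurable wx.
have [_ my] := weak_deriv_measurable wy.
have mj : measurable_fun H (fun z => coef_j P z.1).
  apply: measurable_funM; first exact: measurable_cst.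
  apply: measurable_funB; last exact: measurable_cst.
  apply: measurable_funB; first exact: measurable_cst.
  by apply: measurable_funM; [exact: measurable_cst|exact: measurable_sg1].
have mk : measurable_fun H (fun z => coef_k P z.1).
  apply: measurable_funB; last exact: measurable_cst.
  apply: measurable_funB; first exact: measurable_cst.
  by apply: measurable_funM; [exact: measurable_cst|exact: measurable_sg1].
have [J hJ] := coef_j_bounded P; have [K hK] := coef_k_bounded P.
have i1 := inH_bounded_mul mj (ex_intro _ J (fun z => hJ z.1)) mx xf.
have i2 := inH_bounded_mul mk (ex_intro _ K (fun z => hK z.1)) my yf.
rewrite (_ : form_lower f g = fun z => z.2 * (coef_j P z.1 * dx f z * g z) +
   z.2 * (coef_k P z.1 * dy f z * g z)).
  by apply: winteg_add; apply: winteg_y => //; exact: inV_sqrty.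
by apply/funext => z; rewrite -mulrDr -mulrDl mulrA.
Qed.

Lemma form_aE f g : form_a P f g =
  2^-1 * wRint P (form_principal f g) + wRint P (form_lower f g).
Proof. by []. Qed.

Lemma form_difference_arith (j k q y x1 x2 y1 y2 d1 d2 w s r s2 a b : R) :
  0 < y -> - q * w ^+ 2 <=
    2^-1 * ((x1 - x2) ^+ 2 + 2 * r * ((x1 - x2) * (y1 - y2)) + s2 * (y1 - y2) ^+ 2)
    + (j * (x1 - x2) + k * (y1 - y2)) * w ->
  (s = 1 \/ s = 0 /\ w = 0) ->
  a = s * (x1 - x2) -> b = s * (y1 - y2) ->
  (-1) * (d1 * - w) + 2^-1 * (y * (x1 * - a + r * x1 * - b + r * y1 * - a + s2 * y1 * - b))
  + y * (j * x1 + k * y1) * - w + ((-1) * (d2 * w) +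
   2^-1 * (y * (x2 * a + r * x2 * b + r * y2 * a + s2 * y2 * b)) +
    y * (j * x2 + k * y2) * w) <= (d1 - d2) * w + q * (y * w ^+ 2).
Proof.
move=> y0 hq [s1|[s0 w0]] ha hb.
  move: ha hb; rewrite s1 !mul1r => -> ->.
  have h := ler_wpM2l (ltW y0) hq; lra.
move: ha hb; rewrite s0 !mul0r w0 => -> ->.
by rewrite !(oppr0,mulr0,addr0,expr0n)/= ?mulr0.
Qed.

Lemma le_combine (a1 a2 b1 b2 c1 c2 p q y : R) :
  0 <= - c1 + (2^-1 * a1 + b1) -> 0 <= - c2 + (2^-1 * a2 + b2) ->
  - c1 + 2^-1 * a1 + b1 + (- c2 + 2^-1 * a2 + b2) <= p + q * y -> - q * y <= p.
Proof. by move=> *; lra. Qed.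

(** Adding the two inequalities leaves the form of f1 - f2 against w. As grad
    w is grad (f1 - f2) where w > 0 and 0 elsewhere, [form_lower_bound]
    applies pointwise and leaves only the term y w^2. *)
Theorem form_difference : admissible P -> exists K : R, 0 < K /\
  forall f1 f2 (d1 d2 : R * R -> R) k, inV P f1 -> inV P f2 -> inH P d1 -> inH P d2 -> 0 <= k ->
  let w z := pos (f1 z - f2 z - k) in
  0 <= - dotH P d1 (fun z => - w z) + form_a P f1 (fun z => - w z) ->
  0 <= - dotH P d2 w + form_a P f2 w ->
  - K * wRint P (fun z => z.2 * w z ^+ 2) <= wRint P (fun z => (d1 z - d2 z) * w z).
Proof.
move=> /form_lower_bound[K [K0 hK]]; exists K; split => //.
move=> f1 f2 d1 d2 k v1 v2 e1 e2 k0 w.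
have [vw vnw] := truncation_inV v1 v2 k0; rewrite -/w in vw.
have [wx _ _] := truncation_deriv v1 v2 k0 true.
have [wy _ _] := truncation_deriv v1 v2 k0 false.
have hw : inH P w by have [] := inVP vw.
have hnw : inH P (fun z => - w z) by have [] := inVP vnw.
rewrite !form_aE /dotH.
have i1 := winteg_scale (-1) (L2w_mul e1 hnw).
have i2 := winteg_scale 2^-1 (winteg_form_principal v1 vnw).
have i3 := winteg_form_lower v1 vnw.
have i4 := winteg_scale (-1) (L2w_mul e2 hw).
have i5 := winteg_scale 2^-1 (winteg_form_principal v2 vw).
have i6 := winteg_form_lower v2 vw.
move=> h1 h2.
have id := L2w_mul (L2w_sub e1 e2) hw.
have iy : winteg mu (fun z => z.2 * (w z * w z)) := winteg_y (inV_sqrty vw) (inV_sqrty vw).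
have iy2 : winteg mu (fun z => z.2 * w z ^+ 2) by [].
have := wRint_le_ae (winteg_add (winteg_add (winteg_add i1 i2) i3)
  (winteg_add (winteg_add i4 i5) i6)) (winteg_add id (winteg_scale K iy2)).
rewrite (wRintD (winteg_add (winteg_add i1 i2) i3) (winteg_add (winteg_add i4 i5) i6)).
rewrite (wRintD (winteg_add i1 i2) i3) (wRintD i1 i2).
rewrite (wRintD (winteg_add i4 i5) i6) (wRintD i4 i5).
rewrite (wRintD id (winteg_scale K iy2)) (wRintZ K iy2).
rewrite (wRintZ (-1) (L2w_mul e1 hnw)) (wRintZ (-1) (L2w_mul e2 hw)).
rewrite (wRintZ 2^-1 (winteg_form_principal v1 vnw)).
rewrite (wRintZ 2^-1 (winteg_form_principal v2 vw)) !mulN1r => hle.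
suff hae : {ae leb2, forall z, halfplane z -> 
    (-1) * (d1 z * - w z) + 2^-1 * form_principal f1 (fun z => - w z) z +
    form_lower f1 (fun z => - w z) z +
    ((-1) * (d2 z * w z) + 2^-1 * form_principal f2 w z + form_lower f2 w z) <=
    (d1 z - d2 z) * w z + K * (z.2 * w z ^+ 2)}.
  exact: (le_combine h1 h2 (hle hae)).
have ax : {ae leb2, forall z, halfplane z ->
    dx w z = step (f1 z - f2 z - k) * (dx f1 z - dx f2 z) /\
    dx (fun z => - w z) z = - dx w z}.
  apply: ae_imp2 (weak_deriv_ae wx) (weak_deriv_ae (d := true) (is_weak_derivN wx)) => z.
  move=> h h' Hz; split; first exact: (esym (h Hz)).
  by apply: (etrans (esym (h' Hz))); congr (- _); exact: h.
have ay : {ae leb2, forall z, halfplane z ->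
    dy w z = step (f1 z - f2 z - k) * (dy f1 z - dy f2 z) /\
    dy (fun z => - w z) z = - dy w z}.
  apply: ae_imp2 (weak_deriv_ae wy) (weak_deriv_ae (d := false) (is_weak_derivN wy)) => z.
  move=> h h' Hz; split; first exact: (esym (h Hz)).
  by apply: (etrans (esym (h' Hz))); congr (- _); exact: h.
apply: ae_imp2 ax ay => z hx hy Hz.
have [ex ex'] := hx Hz; have [ey ey'] := hy Hz.
rewrite /form_principal /form_lower ex' ey'.
have z0 : 0 < z.2 :> R := halfplane_gt0 Hz.
apply: (form_difference_arith (d1 z) (d2 z) z0 (hK z.1 _ _ _) _ ex ey).
by case: (pos_cases (f1 z - f2 z - k)) => -[_ []]; [left|right].
Qed.

End FormDifference.

(** * Slices of space-time functions *)

Section ParametricDerivative.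
Context {R : realType}.
Local Notation mR := (measurableTypeR R).
Local Notation ST := (mR * (mR * mR))%type.

Lemma measurable_itvT (T : R) : measurable (`[0, T]%classic : set mR).
Proof. exact: measurable_itv. Qed.

Lemma measurable_cylinder (T : R) : measurable (cylinder T : set ST).
Proof.
by apply: measurableX; [exact: measurable_itvT|exact: measurable_halfplane].
Qed.

(** The weak derivatives of the slices of a measurable function are measurable
    in the parameter as well, being limits of difference quotients. *)
Lemma measurable_weak_deriv_slices T d (u : R * (R * R) -> R) :
  measurable_fun (cylinder T : set ST) u ->
  exists g : R * (R * R) -> R, measurable_fun (setT : set ST) g /\
    forall t, 0 <= t <= T -> weakly_derivable (dirv d) (slice u t) ->
    {ae leb2, forall z, halfplane z -> g (t, z) = weak_deriv (dirv d) (slice u t) z}.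
Proof.
move=> mu_; pose uh : ST -> R := u \_ (cylinder T).
have muh : measurable_fun (setT : set ST) uh.
  exact: ((measurable_restrictT u (measurable_cylinder T)).1 mu_).
pose q n (p : ST) := n.+1%:R * (uh (p.1, p.2 + n.+1%:R^-1 *: dirv d) - uh p).
have mq n : measurable_fun (setT : set ST) (q n).
  apply: measurable_funM; first exact: measurable_cst.
  apply: measurable_funB; last exact: muh.
  have h2 := measurableT_comp (measurable_shift2 (n.+1%:R^-1 *: dirv d))
    (measurable_snd : measurable_fun (setT : set ST) snd).
  have h1 := (measurable_fst : measurable_fun (setT : set ST) fst).
  exact: (measurableT_comp muh (measurable_fun_pair h1 h2)).
exists (fun p => fine (limn_esup (fun n => (q n p)%:E))); split.
  have h : measurable_fun (setT : set ST) (fun p => limn_esup (fun n => (q n p)%:E)).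
    apply: (measurable_fun_limn_esup (f := fun n p => (q n p)%:E)) => n.
    exact/measurable_EFinP.
  exact: (measurableT_comp (@fine_measurable R setT measurableT) h).
move=> t t0T /weak_derivP/weak_deriv_quotient; apply: ae_imp => z hz Hz.
have uhE y : halfplane y -> uh (t, y) = u (t, y).
  by move=> Hy; rewrite /uh patchE mem_set//; split => //=; rewrite in_itv.
have c : (q n (t, z))%:E @[n --> \oo] --> (weak_deriv (dirv d) (slice u t) z)%:E.
  apply/cvg_EFin; first exact: nearW.
  rewrite (_ : (fine \o _) = (fun n => n.+1%:R *
    (slice u t (z + n.+1%:R^-1 *: dirv d) - slice u t z))); first exact: hz.
  by apply/funext => n /=; rewrite /q /= !uhE//; exact: halfplane_shift.
rewrite is_cvg_limn_esupE; last by apply/cvg_ex; eexists; exact: c.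
by rewrite (cvg_lim _ c).
Qed.

End ParametricDerivative.

Section TimeNorms.
Context {R : realType} (P : heston R).
Local Notation leb := (@lebesgue_measure R).
Local Notation mR := (measurableTypeR R).
Local Notation H := (halfplane : set (mR * mR)).
Local Notation ST := (mR * (mR * mR))%type.
Local Notation mu := (Defs.mu P).
Local Notation T := (maturity P).
Implicit Types u : R * (R * R) -> R.

Lemma wint_Vdens_ge0 f : (0 <= wint P mu (Vdens f))%E.
Proof.
apply: integral_ge0 => z Hz; rewrite lee_fin mulr_ge0 ?weight_ge0//.
exact: Vdens_ge0.
Qed.

(** The norm in V of the slices, a priori only a number for each time, agrees
    almost everywhere with a measurable function of time. *)
Lemma Vnorm_time_measurable u : measurable_fun (cylinder T : set ST) u ->
  ae_time T (fun t => inV P (slice u t)) ->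
  exists N : mR -> \bar R, [/\ measurable_fun setT N, forall t, (0 <= N t)%E &
    ae_time T (fun t => N t = wint P mu (Vdens (slice u t)))].
Proof.
move=> mu_ uV.
have [gx [mgx hgx]] := measurable_weak_deriv_slices true mu_.
have [gy [mgy hgy]] := measurable_weak_deriv_slices false mu_.
pose uh : ST -> R := u \_ (cylinder T).
have muh : measurable_fun (setT : set ST) uh.
  exact: ((measurable_restrictT u (measurable_cylinder T)).1 mu_).
pose D (p : ST) : R := (p.2.2 * (gx p ^+ 2 + gy p ^+ 2) + (1 + p.2.2) * uh p ^+ 2) *
  weight P mu p.2.
have m22 : measurable_fun (setT : set ST) (fun p => p.2.2 : R).
  exact: (measurableT_comp measurable_snd measurable_snd).
have mw : measurable_fun (setT : set ST) (fun p => weight P mu p.2).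
  exact: (measurableT_comp (measurable_weight P mu) measurable_snd).
have m122 : measurable_fun (setT : set ST) (fun p => 1 + p.2.2 : R).
  by apply: measurable_funD; [exact: measurable_cst|exact: m22].
have mD : measurable_fun (setT : set ST) D.
  exact: (measurable_funM (measurable_funD
    (measurable_funM m22 (measurable_funD (measurable_funX 2 mgx) (measurable_funX 2 mgy)))
    (measurable_funM m122 (measurable_funX 2 muh))) mw).
pose SH : set ST := setT `*` H.
have mSH : measurable SH by apply: measurableX; [|exact: measurable_halfplane].
pose F : ST -> \bar R := (EFin \o D) \_ SH.
have mF : measurable_fun setT F.
  apply: (measurable_restrictT _ mSH).1; apply: measurable_funTS.
  exact/measurable_EFinP.
have F0 p : (0 <= F p)%E.
  rewrite /F patchE; case: ifPn => // /set_mem[_ Hp]; rewrite lee_fin mulr_ge0 ?weight_ge0//.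
  have p0 := halfplane_gt0 Hp.
  by rewrite addr_ge0// mulr_ge0 ?addr_ge0 ?sqr_ge0// ltW.
exists (fun t => \int[leb2]_z F (t, z))%E; split.
- exact: (measurable_fun_fubini_tonelli_F (m2 := leb2) F mF F0).
- by move=> t; apply: integral_ge0.
apply: ae_imp uV => t tV t0T; have {}tV := tV t0T.
have t0T' : 0 <= t <= T by move: t0T; rewrite in_itv.
have [_ [wx wy] _ _] := tV.
have ax := hgx t t0T' wx; have ay := hgy t t0T' wy.
rewrite [RHS]/wint.
transitivity (\int[leb2]_(z in H) (D (t, z))%:E)%E.
  rewrite [RHS]integral_mkcond; apply: eq_integral => z _; rewrite /F !patchE.
  rewrite (_ : ((t, z) \in SH) = (z \in H))//.
  by apply/idP/idP; rewrite !inE/=; [case|].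
apply: ge0_ae_eq_integral.
- exact: measurable_halfplane.
- apply/measurable_EFinP; apply: measurable_funTS.
  exact: (measurableT_comp mD (pair1_measurable t)).
- by apply/measurable_EFinP; exact: measurable_Vdens.
- move=> z Hz; have := F0 (t, z); rewrite /F patchE mem_set//.
- by move=> z Hz; rewrite lee_fin mulr_ge0 ?weight_ge0 ?Vdens_ge0.
apply: ae_imp2 ax ay => z ex ey Hz; congr (_ * _)%:E.
rewrite (ex Hz) (ey Hz) /Vdens sqr_grad_norm.
have -> : uh (t, z) = slice u t z; last by [].
by rewrite /uh patchE mem_set//; split => //=; rewrite in_itv.
Qed.

Lemma L2_time_V_norm u : (Lp_time_norm T 2%:E (spV P) u < +oo)%E =
  (\int[leb]_(t in `[0%R, T]) wint P mu (Vdens (slice u t)) < +oo)%E.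
Proof. exact: (Lnorm2_sqrte leb `[0, T]%classic (fun t => wint_Vdens_ge0 (slice u t))). Qed.

(** Lower integrals are not additive, hence the detour through the measurable
    versions of the norms of u1 and u2. *)
Lemma L2_time_V_dominated u1 u2 v : L2_time P (spV P) u1 -> L2_time P (spV P) u2 ->
  measurable_fun (cylinder T : set ST) v ->
  (forall t, inV P (slice u1 t) -> inV P (slice u2 t) -> inV P (slice v t) /\
    (wint P mu (Vdens (slice v t)) <= 2%:E * (wint P mu (Vdens (slice u1 t)) +
      wint P mu (Vdens (slice u2 t))))%E) ->
  L2_time P (spV P) v.
Proof.
move=> [m1 V1 n1] [m2 V2 n2] mv dom; split; first exact: mv.
  by apply: ae_imp2 V1 V2 => t h1 h2 t0T; have [] := dom t (h1 t0T) (h2 t0T).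
rewrite -/(Lp_time_norm _ _ _ _) L2_time_V_norm.
have [N1 [mN1 N10 e1]] := Vnorm_time_measurable m1 V1.
have [N2 [mN2 N20 e2]] := Vnorm_time_measurable m2 V2.
have mI := measurable_itvT T.
have bound u N : measurable_fun setT N -> (forall t, 0 <= N t)%E ->
    ae_time T (fun t => N t = wint P mu (Vdens (slice u t))) ->
    (Lp_time_norm T 2%:E (spV P) u < +oo)%E -> (\int[leb]_(t in (`[0%R, T]%classic : set mR)) N t < +oo)%E.
  move=> mN N0 eN; rewrite L2_time_V_norm; apply: le_lt_trans.
  apply: (ae_le_lower_integral_l mI); [exact: measurable_funTS mN|by move=> t _; exact: wint_Vdens_ge0|by []|].
  by apply: ae_imp eN => t h tI; rewrite h//; exact: mem_set.
have b1 := bound _ _ mN1 N10 e1 n1; have b2 := bound _ _ mN2 N20 e2 n2.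
apply: (@le_lt_trans _ _ (\int[leb]_(t in (`[0%R, T]%classic : set mR)) (2%:E * (N1 t + N2 t)))%E).
  apply: (ae_le_lower_integral_r mI).
  - apply: measurable_funTS; apply: measurable_funeM.
    exact: emeasurable_funD.
  - by move=> t _; exact: wint_Vdens_ge0.
  - by move=> t _; rewrite mule_ge0 ?adde_ge0.
  apply: ae_imp2 (ae_and e1 e2) (ae_and V1 V2).
  move=> t [h1 h2] [k1 k2] tI.
  by rewrite h1 ?h2//; have [] := dom t (k1 tI) (k2 tI).
have mE1 : measurable_fun (`[0%R, T]%classic : set mR) N1 by exact: measurable_funTS.
have mE2 : measurable_fun (`[0%R, T]%classic : set mR) N2 by exact: measurable_funTS.
rewrite ge0_integralZl//; last 2 first.
- exact: emeasurable_funD.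
- by move=> t _; rewrite adde_ge0.
rewrite ge0_integralD// lte_mul_pinfty//.
exact: lte_add_pinfty.
Qed.

End TimeNorms.

Section SpaceTime.
Context {R : realType} (P : heston R).
Local Notation leb := (@lebesgue_measure R).
Local Notation mR := (measurableTypeR R).
Local Notation H := (halfplane : set (mR * mR)).
Local Notation ST := (mR * (mR * mR))%type.
Local Notation mu := (Defs.mu P).
Local Notation T := (maturity P).
Implicit Types (f g u : R * (R * R) -> R).

Lemma measurable_weighted3 f : measurable_fun (cylinder T : set ST) f ->
  measurable_fun (cylinder T : set ST) (fun p => f p * weight P mu p.2).
Proof.
move=> mf; apply: measurable_funM; first exact: mf.
apply: measurable_funTS.
exact: (measurableT_comp (measurable_weight P mu) measurable_snd).
Qed.

Lemma integral_cylinder f : measurable_fun (cylinder T : set ST) f ->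
  measurable_fun (`[0%R, T]%classic : set mR) (fun t => wint P mu (fun z => slice f t z ^+ 2)%R) /\
  (\int[leb3]_(p in (cylinder T : set ST)) (f p ^+ 2 * weight P mu p.2)%R%:E =
   \int[leb]_(t in `[0%R, T]) wint P mu (fun z => slice f t z ^+ 2)%R)%E.
Proof.
move=> mf; pose G : ST -> \bar R :=
  (fun p => (f p ^+ 2 * weight P mu p.2)%:E) \_ (cylinder T).
have mG : measurable_fun setT G.
  apply: (measurable_restrictT _ (measurable_cylinder T)).1.
  apply/measurable_EFinP; exact: (measurable_weighted3 (measurable_funX 2 mf)).
have G0 p : (0 <= G p)%E.
  by rewrite /G patchE; case: ifP => // _; rewrite lee_fin mulr_ge0 ?sqr_ge0 ?weight_ge0.
have GE : fubini_F leb2 G = (fun t => wint P mu (fun z => slice f t z ^+ 2)%R) \_ `[0, T].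
  apply/funext => t; rewrite /fubini_F patchE; case: ifPn => [/set_mem tI|tI].
    rewrite /wint [RHS]integral_mkcond; apply: eq_integral => z _; rewrite /G !patchE.
    rewrite (_ : ((t, z) \in cylinder T) = (z \in H))//.
    by apply/idP/idP; rewrite !inE/=; [case|].
  rewrite integral0_eq// => z _; rewrite /G patchE ifF//.
  by apply/negbTE; rewrite notin_setE/= => -[/mem_set]; rewrite (negbTE tI).
have mE : measurable_fun setT (fubini_F leb2 G).
  exact: (measurable_fun_fubini_tonelli_F (m2 := leb2) G mG G0).
split.
  have h : measurable_fun (`[0%R, T]%classic : set mR) (fubini_F leb2 G) by exact: measurable_funTS mE.
  by apply: eq_measurable_fun h => t tI; rewrite GE patchE tI.
rewrite [LHS]integral_mkcond -/G.
rewrite [LHS](fubini_tonelli1 (m1 := leb) (m2 := leb2) G mG G0) GE.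
by rewrite [RHS]integral_mkcond.
Qed.

Lemma L2_time_H_norm f : (Lp_time_norm T 2%:E (spH P) f < +oo)%E =
  (\int[leb]_(t in `[0%R, T]) wint P mu (fun z => slice f t z ^+ 2)%R < +oo)%E.
Proof.
have w0 t : (0 <= wint P mu (fun z => slice f t z ^+ 2)%R)%E.
  by apply: integral_ge0 => z _; rewrite lee_fin mulr_ge0 ?sqr_ge0 ?weight_ge0.
exact: (Lnorm2_sqrte leb `[0, T]%classic w0).
Qed.

Lemma L2_time_VH u : L2_time P (spV P) u -> L2_time P (spH P) u.
Proof.
move=> [mu_ uV nu]; split => //.
  by apply: ae_imp uV => t h t0T; have [] := h t0T.
rewrite -/(Lp_time_norm _ _ _ _) L2_time_H_norm.
move: nu; rewrite -/(Lp_time_norm _ _ _ _) L2_time_V_norm; apply: le_lt_trans.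
apply: (ae_le_lower_integral_l (measurable_itvT T)).
- exact: (integral_cylinder mu_).1.
- by move=> t _; exact: wint_Vdens_ge0.
- by move=> t _; apply: integral_ge0 => z _; rewrite lee_fin mulr_ge0 ?sqr_ge0 ?weight_ge0.
apply: ae_imp uV => t h tI; have {}h := h tI.
have [[mf _] _ _ _] := h.
apply: ge0_le_integral.
- exact: measurable_halfplane.
- by move=> z _; rewrite lee_fin mulr_ge0 ?sqr_ge0 ?weight_ge0.
- apply/measurable_EFinP; apply: measurable_weighted; exact: (measurable_funX 2 mf).
- by apply/measurable_EFinP; exact: (measurable_Vdens h).
move=> z Hz; rewrite lee_fin ler_wpM2r ?weight_ge0//.
have z0 := halfplane_gt0 Hz; rewrite /Vdens.
apply: ler_wpDl; first by rewrite mulr_ge0 ?sqr_ge0// ltW.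
by rewrite ler_peMl ?sqr_ge0// lerDl ltW.
Qed.

Lemma L2_time_integrable f : L2_time P (spH P) f ->
  leb3.-integrable (cylinder T : set ST) (EFin \o (fun p => f p ^+ 2 * weight P mu p.2)).
Proof.
move=> [mf _ nf]; apply/integrableP; split.
  apply/measurable_EFinP; exact: (measurable_weighted3 (measurable_funX 2 mf)).
move: nf; rewrite -/(Lp_time_norm _ _ _ _) L2_time_H_norm -(integral_cylinder mf).2.
congr (_ < _)%E; apply: eq_integral => p _ /=.
by rewrite ger0_norm// mulr_ge0 ?sqr_ge0 ?weight_ge0.
Qed.

Lemma L2_time_dominated (f1 f2 f3 f4 : R * (R * R) -> R) g : L2_time P (spH P) f1 -> L2_time P (spH P) f2 ->
  L2_time P (spH P) f3 -> L2_time P (spH P) f4 ->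
  measurable_fun (cylinder T : set ST) g ->
  (forall p, `|g p| <= 2 * (f1 p ^+ 2 + f2 p ^+ 2 + (f3 p ^+ 2 + f4 p ^+ 2))) ->
  leb3.-integrable (cylinder T : set ST) (EFin \o (fun p => g p * weight P mu p.2)).
Proof.
move=> /L2_time_integrable i1 /L2_time_integrable i2 /L2_time_integrable i3
  /L2_time_integrable i4 mg hg.
have mC := measurable_cylinder T.
have := integrableZl mC 2 (integrableD mC (integrableD mC i1 i2) (integrableD mC i3 i4)).
apply: le_integrable; [exact: mC|apply/measurable_EFinP; exact: (measurable_weighted3 mg)|].
move=> p Cp /=; rewrite lee_fin normrM -!mulrDl mulrA [leRHS]normrM ler_wpM2r//.
by rewrite (le_trans (hg p))// ler_norm.
Qed.

End SpaceTime.

(** * The energy of the excess *)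

Section Energy.
Context {R : realType} (P : heston R).
Local Notation leb := (@lebesgue_measure R).
Local Notation mR := (measurableTypeR R).
Local Notation H := (halfplane : set (mR * mR)).
Local Notation ST := (mR * (mR * mR))%type.
Local Notation mu := (Defs.mu P).
Local Notation T := (maturity P).

Lemma measurable_posq : measurable_fun setT (@posq R).
Proof.
apply: measurable_funM; last exact: measurable_cst.
exact: (measurable_funX 2 (@measurable_pos R)).
Qed.

Lemma ae_neq (a : R) : {ae leb, forall s : mR, s != a}.
Proof.
exists [set a]; split; first exact: measurable_set1.
  exact: lebesgue_measure_set1.
by move=> s /= /negP; rewrite negbK => /eqP.
Qed.

Lemma ae_itv_oo (a b : R) (A : R -> Prop) :
  {ae leb, forall s : mR, s \in `]a, b[ -> A s} ->
  {ae leb, forall s : mR, s \in `[a, b] -> A s}.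
Proof.
move=> h; have h2 : {ae leb, forall s : mR, s != a /\ s != b}.
  by apply: ae_imp2 (ae_neq a) (ae_neq b).
apply: ae_imp2 h h2 => s hs [sa sb]; rewrite in_itv/= => /andP[h1 h3]; apply: hs.
by rewrite in_itv/= !lt_neqAle eq_sym sa sb h1 h3.
Qed.

Variables (u1 u2 d1 d2 : R * (R * R) -> R) (c : R).
Hypotheses (c0 : 0 <= c) (hu1 : L2_time P (spH P) u1) (hu2 : L2_time P (spH P) u2)
  (hd1 : L2_time P (spH P) d1) (hd2 : L2_time P (spH P) d2)
  (td1 : is_time_deriv T u1 d1) (td2 : is_time_deriv T u2 d2).

Let w p := pos (u1 p - u2 p - c).
Let E p := posq (u1 p - u2 p - c).
Let D p := (d1 p - d2 p) * w p.

(** The excess is w = (u1 - u2 - c)^+. The energy is half its squared norm in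
    H, the power the rate (d/dt (u1 - u2), w)_H. *)
Definition energy t := wRint P (fun z => E (t, z)).
Definition power t := wRint P (fun z => D (t, z)).

Let mdiff : measurable_fun (cylinder T : set ST) (fun p => u1 p - u2 p - c).
Proof.
have [m1 _ _] := hu1; have [m2 _ _] := hu2.
apply: measurable_funB; last exact: measurable_cst.
exact: (measurable_funB m1 m2).
Qed.

Lemma measurable_excess : measurable_fun (cylinder T : set ST) w.
Proof. exact: (measurableT_comp (@measurable_pos R) mdiff). Qed.

Lemma energy_integrable3 :
  leb3.-integrable (cylinder T : set ST) (EFin \o (fun p => E p * weight P mu p.2)).
Proof.
apply: (L2_time_dominated hu1 hu2 hu1 hu2).
  exact: (measurableT_comp measurable_posq mdiff).
move=> p; have [h _ _] := pos_diff_sqr (u1 p) (u2 p) c0.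
rewrite /E /posq ger0_norm; last by rewrite mulr_ge0 ?sqr_ge0// invr_ge0.
have := sqr_ge0 (u1 p); have := sqr_ge0 (u2 p); lra.
Qed.

Lemma power_integrable3 :
  leb3.-integrable (cylinder T : set ST) (EFin \o (fun p => D p * weight P mu p.2)).
Proof.
have [m1 _ _] := hd1; have [m2 _ _] := hd2.
apply: (L2_time_dominated hu1 hu2 hd1 hd2).
  exact: (measurable_funM (measurable_funB m1 m2) measurable_excess).
move=> p; have [h _ _] := pos_diff_sqr (u1 p) (u2 p) c0.
rewrite /D (le_trans (normM_le_sqrD _ _))//.
have := sqrD_le (d1 p) (- d2 p); rewrite sqrrN => h'.
move: h h'; rewrite -/(w p).
move: (w p ^+ 2) ((d1 p - d2 p) ^+ 2) (d1 p ^+ 2) (d2 p ^+ 2) (u1 p ^+ 2) (u2 p ^+ 2).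
by move=> ? ? ? ? ? ?; lra.
Qed.

Variables (a b : R).
Hypotheses (a0 : 0 < a) (ab : a < b) (bT : b < T).

(** At almost every point of the half-plane u1 - u2 is an indefinite integral
    in time, to which the chain rule [ac_posq] applies. *)
Lemma lines_by_parts (f g : R -> R) : ac a b f g -> f a = 0 -> f b = 0 ->
  continuous f -> continuous g ->
  {ae leb2, forall z, halfplane z ->
    leb.-integrable `[a, b] (EFin \o (fun s => E (s, z) * g s + D (s, z) * f s)) /\
    \int[leb]_(s in `[a, b]) (E (s, z) * g s + D (s, z) * f s) = 0}.
Proof.
move=> acf fa fb cf cg.
apply: ae_imp2 (time_deriv_lines td1 a0 ab bT) (time_deriv_lines td2 a0 ab bT).
move=> z h1 h2 Hz; have [iu1 id1 [k1 e1]] := h1 Hz; have [iu2 id2 [k2 e2]] := h2 Hz.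
have acF := ac_shift c (ac_sub (ac_primitive k1 id1) (ac_primitive k2 id2)).
have acE := ac_posq (ltW ab) acF.
have parts := ac_parts0 (ltW ab) acE acf fa fb.
have [iE _] := acf.
pose F s := k1 + \int[leb]_(t in `[a, s]) d1 (t, z) -
   (k2 + \int[leb]_(t in `[a, s]) d2 (t, z)) - c.
have cE := ac_continuous (ltW ab) acE.
have i1 := integrable_continuous_mul cE iE.
have [iD _] := acE.
have i2 := integrable_continuous_mul (continuous_subspaceT cf) iD.
have mI : measurable (`[a, b]%classic : set mR) by exact: measurable_itv.
have isum := integrableD mI i1 i2.
rewrite -parts.
suff [h h'] : leb.-integrable `[a, b] (EFin \o (fun s => E (s, z) * g s + D (s, z) * f s)) /\
    \int[leb]_(s in `[a, b]) (posq (F s) * g s + pos (F s) * (d1 (s, z) - d2 (s, z)) * f s) =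
    \int[leb]_(s in `[a, b]) (E (s, z) * g s + D (s, z) * f s).
  by split; [exact: h|exact: (esym h')].
apply: (@ae_eq_Rintegral _ _ mR leb (`[a, b]%classic) _ _ mI).
- apply: eq_integrable isum => // s _ /=; congr (_ + _)%:E.
  by rewrite mulrC.
- have mu1 : measurable_fun (`[a, b]%classic : set mR) (fun s => u1 (s, z)).
    by have /measurable_EFinP := measurable_int _ iu1.
  have mu2 : measurable_fun (`[a, b]%classic : set mR) (fun s => u2 (s, z)).
    by have /measurable_EFinP := measurable_int _ iu2.
  have md1 : measurable_fun (`[a, b]%classic : set mR) (fun s => d1 (s, z)).
    by have /measurable_EFinP := measurable_int _ id1.
  have md2 : measurable_fun (`[a, b]%classic : set mR) (fun s => d2 (s, z)).
    by have /measurable_EFinP := measurable_int _ id2.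
  have md : measurable_fun (`[a, b]%classic : set mR) (fun s => u1 (s, z) - u2 (s, z) - c).
    by apply: measurable_funB; [exact: (measurable_funB mu1 mu2)|exact: measurable_cst].
  have mp := measurableT_comp (@measurable_pos R) md.
  have mE := measurableT_comp measurable_posq md.
  have mf : measurable_fun (`[a, b]%classic : set mR) f.
    by apply: measurable_funTS; exact: (continuous_measurable_fun cf).
  have mg : measurable_fun (`[a, b]%classic : set mR) g.
    by apply: measurable_funTS; exact: (continuous_measurable_fun cg).
  exact: (measurable_funD (measurable_funM mE mg)
    (measurable_funM (measurable_funM (measurable_funB md1 md2) mp) mf)).
apply: ae_itv_oo; apply: ae_imp2 e1 e2 => s h3 h4 sI.
by rewrite /E /D /w (h3 sI) (h4 sI) [in RHS](mulrC (_ - _)).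
Qed.

(** Integrating [lines_by_parts] over the half-plane shows that the power is
    the weak derivative of the energy, whence the identity by
    [du_bois_reymond]. *)
Lemma energy_identity :
  [/\ leb.-integrable `[a, b] (EFin \o energy), leb.-integrable `[a, b] (EFin \o power) &
    exists k, {ae leb, forall s, s \in `]a, b[ ->
      energy s = k + \int[leb]_(t in `[a, s]) power t}].
Proof.
have mI : measurable (`[a, b]%classic : set mR) by exact: measurable_itv.
have mIH : measurable ((`[a, b]%classic : set mR) `*` H).
  by apply: measurableX; [exact: mI|exact: measurable_halfplane].
have sub : ((`[a, b]%classic : set mR) `*` H) `<=` cylinder T.
  move=> [t z] [/= tI Hz]; split => //=; move: tI; rewrite !in_itv/= => /andP[h1 h2].
  by rewrite (le_trans (ltW a0) h1) (le_trans h2 (ltW bT)).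
have iE := integrableS (measurable_cylinder T) mIH sub energy_integrable3.
have iD := integrableS (measurable_cylinder T) mIH sub power_integrable3.
have [aE ifE _] := Rfubini1 mI measurable_halfplane iE.
have [aD ifD _] := Rfubini1 mI measurable_halfplane iD.
split; [exact: ifE|exact: ifD|].
have [j [jin jm]] := exists_mean_neq0 ab.
apply: (du_bois_reymond ab jin jm ifE ifD) => i iin.
set f := test1_prim a b j i; set g := test1_deriv a b j i.
have cg : continuous g := smooth1_continuous (smooth1_test1_deriv a b j i).
have cf : continuous f := smooth1_continuous (smooth1_test1_prim ab jin iin jm).
have [a' [b' [aa' bb' out]]] := test1_prim_out ab jin iin jm.
have fa : f a = 0 by apply: out; rewrite in_itv/= leNgt aa'.
have fb : f b = 0 by apply: out; rewrite in_itv/= [b <= _]leNgt bb' andbF.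
have lines := lines_by_parts (ac_test1_prim a b j i) fa fb cf cg.
have m1 : measurable_fun (setT : set ST) (fun q => q.1 : R) by exact: measurable_fst.
have t_in q : ((`[a, b]%classic : set mR) `*` H) q -> q.1 \in `[a, b] by case.
have i1 := integrable_mul_comp mIH m1 t_in cg iE.
have i2 := integrable_mul_comp mIH m1 t_in cf iD.
have iG := integrableD mIH i1 i2.
have [aG1 iG1 eG1] := Rfubini1 mI measurable_halfplane iG.
have [aG2 iG2 eG2] := Rfubini2 mI measurable_halfplane iG.
have z0 : \int[leb3]_(p in (`[a, b]%classic : set mR) `*` H)
   (E p * weight P mu p.2 * g p.1 + D p * weight P mu p.2 * f p.1) = 0.
  rewrite [LHS]eG2.
  have m0 : measurable_fun H (fun=> 0 : R) by exact: measurable_cst.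
  refine (etrans (ae_eq_Rintegral measurable_halfplane iG2 m0 _).2 _); last first.
    by rewrite /Rintegral integral0_eq.
  apply: ae_imp lines => z h Hz; have [h1 h2] := h Hz.
  transitivity (\int[leb]_(s in `[a, b]) (weight P mu z * (E (s, z) * g s + D (s, z) * f s))).
    by apply: eq_Rintegral => s _ /=; ring.
  by rewrite (RintegralZl _ mI h1) h2 mulr0.
have mEP : measurable_fun (`[a, b]%classic : set mR) (fun t => energy t * g t + power t * f t).
  have /measurable_EFinP mE := measurable_int _ ifE.
  have /measurable_EFinP mP := measurable_int _ ifD.
  have mf : measurable_fun (`[a, b]%classic : set mR) f.
    by apply: measurable_funTS; exact: (continuous_measurable_fun cf).
  have mg : measurable_fun (`[a, b]%classic : set mR) g.
    by apply: measurable_funTS; exact: (continuous_measurable_fun cg).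
  exact: (measurable_funD (measurable_funM mE mg) (measurable_funM mP mf)).
rewrite -[RHS]z0 [RHS]eG1; apply/esym.
apply: (ae_eq_Rintegral mI iG1 mEP _).2.
apply: ae_imp2 aE aD => t h1 h2 tI; have {}h1 := h1 tI; have {}h2 := h2 tI.
have k1 := integrableZr measurable_halfplane (g t) h1.
have k2 := integrableZr measurable_halfplane (f t) h2.
rewrite /= (RintegralD measurable_halfplane k1 k2).
by congr (_ + _); rewrite RintegralZr//; exact: measurable_halfplane.
Qed.

End Energy.

(** * Backward uniqueness *)

Section BackwardUniqueness.
Context {R : realType}.
Local Notation mu := (@lebesgue_measure R).
Local Notation mR := (measurableTypeR R).
Implicit Types (a b s : R) (E Q : R -> R).

Lemma ae_itv_inhabited (a b : R) (A : R -> Prop) : a < b ->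
  {ae mu, forall s : mR, s \in `]a, b[ -> A s} ->
  exists s, (s \in `]a, b[) /\ A s.
Proof.
move=> ab [N [mN N0 AN]]; apply: contrapT => /forallNP nA.
have sub : (`]a, b[%classic : set mR) `<=` N.
  by move=> s sI; apply: AN => /= h; apply: (nA s); split => //; exact: h.
have mI : measurable (`]a, b[%classic : set mR) by exact: measurable_itv.
have h : (mu (`]a, b[%classic : set mR) <= mu N)%E.
  by apply: le_measure => //; apply: mem_set.
have : ((b - a)%:E <= 0)%E.
  by rewrite -N0; apply: le_trans h; rewrite lebesgue_measure_itv/= lte_fin ab.
by rewrite lee_fin leNgt subr_gt0 ab.
Qed.

(** The product exp(L s) F(s) has derivative at least - eta exp(L s). *)
Lemma backward_gronwall a b (F Q : R -> R) (L eta : R) : a <= b -> 0 <= L -> 0 <= eta ->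
  ac a b F Q -> {ae mu, forall s : mR, s \in `[a, b] -> - (L * F s + eta) <= Q s} ->
  0 <= F b ->
  forall s, a <= s -> s <= b -> F s <= expR (L * (b - a)) * (F b + eta * (b - a)).
Proof.
move=> ab L0 eta0 acF hQ Fb s as_ sb.
pose e x : R := expR (L * x).
have de x : is_derive x (1 : R) e (L * e x).
  by apply: is_derive_eq; rewrite /GRing.scale/= mulr1 mulrC.
have ce : continuous e.
  by move=> x; apply: differentiable_continuous; apply/derivable1_diffP; have [] := de x.
have ace : ac a b e (fun x => L * e x).
  apply: C1_ac => //= x; apply: continuousM; [exact: cst_continuous|exact: ce].
have acp := ac_mul ab ace acF; have [ip hp] := acp.
have := hp s b as_ sb (lexx b).
have mI : measurable (`[s, b]%classic : set mR) by exact: measurable_itv.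
have ips := integrable_subitv ip as_ (lexx b).
have ic : mu.-integrable `[s, b] (EFin \o (fun=> - (eta * e b))).
  by apply: continuous_integrable_itv => x; exact: cvg_cst.
have hle : \int[mu]_(x in `[s, b]) (- (eta * e b)) <=
    \int[mu]_(x in `[s, b]) (e x * Q x + L * e x * F x).
  apply: (le_Rintegral_ae mI ic ips); apply: ae_imp hQ => x hx xsb.
  have [sx xb] : s <= x /\ x <= b by move: xsb; rewrite /= in_itv/= => /andP[].
  have {}hx := hx (_ : x \in `[a, b]).
  have {hx} hx : - (L * F x + eta) <= Q x.
    by apply: hx; rewrite in_itv/= (le_trans as_ sx) xb.
  have ex0 : 0 <= e x by exact: expR_ge0.
  have exb : e x <= e b by rewrite ler_expR ler_wpM2l.
  have h1 := ler_wpM2l ex0 hx; have h2 := ler_wpM2l eta0 exb; nra.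
have mE : mu (`[s, b]%classic : set mR) = (b - s)%:E.
  rewrite lebesgue_measure_itv/= lte_fin; case: ltP => // bs.
  by rewrite (le_anti (_ : b <= s <= b)) ?bs// subrr.
have cE : \int[mu]_(x in `[s, b]) (- (eta * e b)) = - (eta * e b) * (b - s).
  exact: (etrans (Rintegral_cst mu mI _) (congr1 (fun x => _ * fine x) mE)).
move: hle; rewrite cE => hle heq.
have {hle heq} h : e s * F s <= e b * (F b + eta * (b - s)) by move: hle; rewrite -heq; nra.
have es : e s * expR (L * (b - s)) = e b by rewrite -expRD; congr expR; ring.
have esp : 0 < e s by exact: expR_gt0.
have h1 : F s <= expR (L * (b - s)) * (F b + eta * (b - s)).
  by rewrite -(ler_pM2l esp) mulrA es.
apply: (le_trans h1); apply: ler_pM.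
- exact: expR_ge0.
- by rewrite addr_ge0// mulr_ge0// subr_ge0.
- by rewrite ler_expR ler_wpM2l// lerD2l lerN2.
- by rewrite lerD2l ler_wpM2l// lerD2l lerN2.
Qed.

Lemma le_harmonic (x A B : R) : (forall n : nat, x <= A * n.+1%:R^-1 + B) -> x <= B.
Proof.
move=> h; rewrite leNgt; apply/negP => Bx.
have d0 : 0 < x - B by rewrite subr_gt0.
pose n := Num.bound (`|A| / (x - B)).
have hn : `|A| / (x - B) < n%:R by apply: archi_boundP; rewrite divr_ge0// ltW.
have n0 : (0 : R) < n.+1%:R by rewrite ltr0n.
have h1 : `|A| < n.+1%:R * (x - B).
  rewrite -ltr_pdivrMr//; apply: (lt_le_trans hn).
  by rewrite ler_nat.
have h2 : A * n.+1%:R^-1 < x - B.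
  rewrite ltr_pdivrMr// mulrC; exact: (le_lt_trans (ler_norm A) h1).
have := h n; move: h2; move: (A * _) => y h2; lra.
Qed.

Variables (E Q : R -> R) (T K C d : R).
Hypotheses (K0 : 0 < K) (C0 : 0 <= C) (d0 : 0 < d) (E0 : forall t, 0 <= E t).
Hypothesis idE : forall a b, 0 < a -> a < b -> b < T ->
  [/\ mu.-integrable `[a, b] (EFin \o E), mu.-integrable `[a, b] (EFin \o Q) &
    exists k, {ae mu, forall s : mR, s \in `]a, b[ ->
      E s = k + \int[mu]_(t in `[a, s]) Q t}].
Hypothesis powerE : forall M, 0 <= M -> {ae mu, forall s : mR, s \in `]0, T[ ->
  - (K * (2 * M * E s + C * expR (- (d * M)))) <= Q s}.

Definition vanishes_before b := forall e : R, 0 < e -> exists r, r < b /\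
  {ae mu, forall s : mR, s \in `]r, b[ -> 0 < s -> E s <= e}.

(** Gronwall's inequality starts from a point close to b at which E is at most
    e. *)
Lemma backward_step_bound a b e M : 0 < a -> a < b -> b <= T -> vanishes_before b ->
  0 < e -> 0 <= M -> {ae mu, forall s : mR, s \in `]a, b[ ->
    E s <= expR (2 * K * M * (b - a)) * (e + K * C * expR (- (d * M)) * (b - a))}.
Proof.
move=> a0 ab bT vb e0 M0.
pose X : R := expR (2 * K * M * (b - a)) * (e + K * C * expR (- (d * M)) * (b - a)).
have [r [rb hr]] := vb e e0.
suff key beta : a < beta -> beta < b -> {ae mu, forall s : mR, s \in `]a, beta[ -> E s <= X}.
  have : {ae mu, forall s : mR, forall n : nat, s \in `]a, b - n.+1%:R^-1[ -> E s <= X}.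
    apply: ae_foralln => n; have n0 : (0 : R) < n.+1%:R^-1 by rewrite invr_gt0 ltr0n.
    have [h|h] := ltP a (b - n.+1%:R^-1); first by apply: key => //; rewrite ltrBlDr ltrDl.
    apply: aeW => s; rewrite in_itv/= => /andP[h1 h2].
    by have := lt_le_trans (lt_trans h1 h2) h; rewrite ltxx.
  apply: ae_imp => s hs; rewrite in_itv/= => /andP[h1 h2].
  have p0 : 0 < b - s by rewrite subr_gt0.
  pose n := Num.bound (b - s)^-1.
  have hn : (b - s)^-1 < n%:R by apply: archi_boundP; rewrite invr_ge0 ltW.
  apply: (hs n); rewrite in_itv/= h1/=.
  have : n.+1%:R^-1 < b - s.
    rewrite invf_plt ?posrE ?ltr0n//; apply: (lt_le_trans hn); by rewrite ler_nat.
  by move: (n.+1%:R^-1) => y; lra.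
move=> abeta betab.
pose b1 := Num.max beta r; pose b2 := (b1 + b) / 2.
have b1b : b1 < b by rewrite gt_max betab rb.
have betab1 : beta <= b1 by rewrite le_max lexx.
have rb1 : r <= b1 by rewrite le_max lexx orbT.
have b12 : b1 < b2 by rewrite /b2; lra.
have b2b : b2 < b by rewrite /b2; lra.
have ab2 : a < b2 by lra.
have [iE iQ [k hk]] := idE a0 ab2 (lt_le_trans b2b bT).
pose F s := k + \int[mu]_(t in `[a, s]) Q t.
have acF : ac a b2 F Q by exact: ac_primitive.
have [p [pI [Ep pe]]] : exists p, (p \in `]b1, b2[) /\ (E p = F p /\ E p <= e).
  apply: (ae_itv_inhabited b12); apply: ae_imp2 hk hr => s h1 h2.
  rewrite in_itv/= => /andP[s1 s2]; split.
    by apply: h1; rewrite in_itv/= s2 andbT; lra.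
  by apply: h2; rewrite ?in_itv/=; [apply/andP; split; lra|lra].
have [p1 p2] : b1 < p /\ p < b2 by move: pI; rewrite in_itv/= => /andP[].
have ap : a <= p by lra.
have acp : ac a p F Q.
  have [_ h] := acF; split; first exact: (integrable_subitv iQ (lexx a) (ltW p2)).
  by move=> x y ax xy yp; apply: h => //; exact: (le_trans yp (ltW p2)).
have L0 : 0 <= 2 * K * M by rewrite !mulr_ge0// ltW.
have eta0 : 0 <= K * C * expR (- (d * M)) by rewrite !mulr_ge0 ?expR_ge0// ltW.
have hQ : {ae mu, forall s : mR, s \in `[a, p] ->
    - (2 * K * M * F s + K * C * expR (- (d * M))) <= Q s}.
  apply: ae_itv_oo; apply: ae_imp2 hk (powerE M0) => s h1 h2.
  rewrite in_itv/= => /andP[s1 s2].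
  have : E s = F s by apply: h1; rewrite in_itv/= s1/=; lra.
  have := h2 _; rewrite in_itv/= => /(_ _) h3 <-.
  have {}h3 := h3 (_ : 0 < s < T).
  have : - (K * (2 * M * E s + C * expR (- (d * M)))) <= Q s by apply: h3; lra.
  by congr (_ <= _); ring.
have Fp : 0 <= F p by rewrite -Ep.
have G := backward_gronwall ap L0 eta0 acp hQ Fp.
apply: ae_imp hk => s h1; rewrite in_itv/= => /andP[s1 s2].
rewrite h1; last by rewrite in_itv/= s1/=; lra.
apply: (le_trans (G s (ltW s1) _)); first lra.
rewrite /X; apply: ler_pM.
- exact: expR_ge0.
- by rewrite addr_ge0// mulr_ge0// subr_ge0.
- by rewrite ler_expR ler_wpM2l//; lra.
- by rewrite lerD ?ler_wpM2l// -?Ep//; lra.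
Qed.

(** First e -> 0, then M -> oo in [backward_step_bound]. *)
Lemma backward_step a b : 0 < a -> a < b -> b <= T -> vanishes_before b ->
  4 * K * (b - a) <= d -> {ae mu, forall s : mR, s \in `]a, b[ -> E s <= 0}.
Proof.
move=> a0 ab bT vb small.
have : {ae mu, forall s : mR, forall i : nat * nat, s \in `]a, b[ ->
    E s <= expR (2 * K * i.2%:R * (b - a)) *
      (i.1.+1%:R^-1 + K * C * expR (- (d * i.2%:R)) * (b - a))}.
  apply: ae_forall_countable => -[i j] /=.
  by apply: backward_step_bound; rewrite ?invr_gt0 ?ltr0n.
apply: ae_imp => s hs sI.
have h1 l : E s <= expR (2 * K * l%:R * (b - a)) * (K * C * expR (- (d * l%:R)) * (b - a)).
  apply: (@le_harmonic _ (expR (2 * K * l%:R * (b - a)))) => n.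
  by rewrite -mulrDr; exact: (hs (n, l)).
(* 1 + (d / 2) l >= m (l + 1) *)
pose m := Num.min 1 (d / 2).
have m0 : 0 < m by rewrite lt_min ltr01/= divr_gt0.
have bound0 : 0 <= K * C * (b - a) by rewrite !mulr_ge0 ?subr_ge0// ltW.
apply: (@le_harmonic _ (K * C * (b - a) / m)) => l; rewrite addr0.
apply: (le_trans (h1 l)).
have l0 : (0 : R) <= l%:R by rewrite ler0n.
have -> : expR (2 * K * l%:R * (b - a)) * (K * C * expR (- (d * l%:R)) * (b - a)) =
    K * C * (b - a) * expR (- ((d - 2 * K * (b - a)) * l%:R)).
  rewrite [LHS](_ : _ = K * C * (b - a) * (expR (2 * K * l%:R * (b - a)) * expR (- (d * l%:R)))).
    by rewrite -expRD; congr (_ * expR _); ring.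
  by move: (expR _) (expR _) => ? ?; ring.
rewrite -[leRHS]mulrA ler_wpM2l// -invfM expRN lef_pV2 ?posrE ?mulr_gt0 ?ltr0n ?expR_gt0//.
apply: le_trans (expR_ge1Dx _).
have h2 : m <= 1 by rewrite ge_min lexx.
have h3 : m <= d / 2 by rewrite ge_min lexx orbT.
have h4 : m * l%:R <= (d - 2 * K * (b - a)) * l%:R by apply: ler_wpM2r => //; lra.
rewrite -natr1; lra.
Qed.

(** On intervals that are short compared with d / K the gain exp(- d M) beats
    the Gronwall factor exp(2 K M (b - a)) as M grows, so that E vanishes
    there; one then steps back from T. *)
Theorem backward_uniqueness : vanishes_before T ->
  {ae mu, forall s : mR, s \in `]0, T[ -> E s <= 0}.
Proof.
(* Two steps of length tau satisfy the smallness condition of [backward_step];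
   the overlap provides [vanishes_before] at an intermediate point. *)
move=> vT; pose tau := d / (8 * K).
have tau0 : 0 < tau by rewrite divr_gt0// mulr_gt0.
have Ktau : 8 * K * tau = d by rewrite /tau mulrC divfK// gt_eqF// mulr_gt0.
have small x : x <= 2 * tau -> 4 * K * x <= d.
  by move=> h; have := ler_wpM2l (ltW K0) h; move: Ktau; lra.
have key (n : nat) : forall a, 0 < a -> T - n%:R * tau <= a ->
    {ae mu, forall s : mR, s \in `]a, T[ -> E s <= 0}.
  elim: n => [|n IH] a a0 ha.
    apply: aeW => s; rewrite in_itv/= => /andP[h1 h2].
    by exfalso; move: ha; rewrite mul0r subr0 leNgt (lt_trans h1 h2).
  have [hb|hb] := leP T (a + tau).
    have [aT|Ta] := ltP a T; last first.
      by apply: aeW => s; rewrite in_itv/= => /andP[h1 h2]; exfalso; lra.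
    by apply: backward_step => //; apply: small; lra.
  have Zb : {ae mu, forall s : mR, s \in `]a + tau, T[ -> E s <= 0}.
    by apply: IH; [lra|move: ha; rewrite -natr1; lra].
  pose b' := Num.min (a + tau + tau) T.
  have b'T : b' <= T by rewrite ge_min lexx orbT.
  have b'1 : b' <= a + tau + tau by rewrite ge_min lexx.
  have bb' : a + tau < b' by rewrite lt_min hb andbT; lra.
  have vb' : vanishes_before b'.
    move=> e e0; exists (a + tau); split => //; apply: ae_imp Zb => s hs.
    rewrite in_itv/= => /andP[s1 s2] _; apply: le_trans (hs _) (ltW e0).
    by rewrite in_itv/= s1/=; lra.
  have Zab : {ae mu, forall s : mR, s \in `]a, b'[ -> E s <= 0}.
    by apply: backward_step => //; [lra|apply: small; lra].
  apply: ae_imp2 Zb Zab => s h1 h2; rewrite in_itv/= => /andP[s1 s2].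
  have [sb|sb] := ltP s b'; [apply: h2|apply: h1]; rewrite in_itv/= ?s1 ?s2 ?sb ?andbT//.
  lra.
have : {ae mu, forall s : mR, forall n : nat, s \in `]n.+1%:R^-1, T[ -> E s <= 0}.
  apply: ae_foralln => n.
  have [N hN] : exists N : nat, T / tau <= N%:R.
    exists (Num.bound (`|T| / tau)); apply: ltW.
    apply: le_lt_trans (archi_boundP _); last by rewrite divr_ge0// ltW.
    by rewrite ler_wpM2r ?ler_norm// invr_ge0 ltW.
  apply: (key N); first by rewrite invr_gt0 ltr0n.
  have : T <= N%:R * tau by rewrite -ler_pdivrMr.
  have : (0 : R) <= n.+1%:R^-1 by rewrite invr_ge0 ler0n.
  by move: (n.+1%:R^-1) => y; lra.
apply: ae_imp => s hs; rewrite in_itv/= => /andP[s0 sT].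
apply: (hs (Num.bound s^-1)); rewrite in_itv/= sT andbT.
rewrite invf_plt ?posrE ?ltr0n//.
apply: lt_le_trans (archi_boundP _) _; first by rewrite invr_ge0 ltW.
by rewrite ler_nat.
Qed.

End BackwardUniqueness.

(** * Estimates on the excess *)

Lemma ae_le_Lnorm_oo (d : measure_display) (T : measurableType d) (R : realType)
    (m : {measure set T -> \bar R}) (f : T -> \bar R) :
  {ae m, forall x, (`|f x| <= Lnorm m +oo%E f)%E}.
Proof.
rewrite unlock; case: ifPn => [_|]; first exact: (ess_sup_ge m (abse \o f)).
rewrite -leNgt measure_le0 => /eqP m0.
by exists setT; split => //; exact: measurableT.
Qed.

Lemma Lnorm_oo_le (d : measure_display) (T : measurableType d) (R : realType)
    (m : {measure set T -> \bar R}) (f : T -> \bar R) (B : \bar R) : (0 <= B)%E ->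
  {ae m, forall x, (`|f x| <= B)%E} -> (Lnorm m +oo%E f <= B)%E.
Proof.
move=> B0 fB; rewrite unlock; case: ifPn => // _.
by rewrite ess_supEae; apply: ereal_inf_lbound.
Qed.

Section ExcessEstimates.
Context {R : realType} (P : heston R).
Local Notation leb := (@lebesgue_measure R).
Local Notation mR := (measurableTypeR R).
Local Notation H := (halfplane : set (mR * mR)).
Local Notation mu := (Defs.mu P).
Local Notation T := (maturity P).
Implicit Types (u v psi Phi d : R * (R * R) -> R) (c : R).

Lemma ae_cylinder_slices (A : R * (R * R) -> Prop) : ae_cylinder T A ->
  ae_time T (fun t => {ae leb2, forall z, halfplane z -> A (t, z)}).
Proof.
move=> h; have := @ae_product1 _ _ mR (mR * mR)%type R leb leb2 _ h.
apply: ae_imp => t ht tI; apply: ae_imp ht => z hz Hz; apply: hz.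
by split => //=.
Qed.

Lemma Lp_time_oo_bound m u : Lp_time T +oo%E (L2w P m) u -> exists B, 0 <= B /\
  ae_time T (fun t => (wint P m (fun z => slice u t z ^+ 2)%R <= B%:E)%E).
Proof.
move=> [_ _ nu].
pose f := (fun t => fs_norm (L2w P m) (slice u t)) \_ `[0, T].
have n0 : (0 <= Lnorm leb +oo%E f)%E by exact: Lnorm_ge0.
pose r := fine (Lnorm leb +oo%E f).
have rE : Lnorm leb +oo%E f = r%:E by rewrite /r fineK// ge0_fin_numE.
have r0 : 0 <= r by rewrite -lee_fin -rE.
exists (r ^+ 2); split; first exact: sqr_ge0.
have h : {ae leb, forall t, (`|f t| <= Lnorm leb +oo%E f)%E} := ae_le_Lnorm_oo leb f.
apply: ae_imp h => t; rewrite rE /f patchE => h tI.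
move: h; rewrite mem_set//= gee0_abs ?sqrte_ge0//.
set x := wint _ _ _ => h.
have x0 : (0 <= x)%E.
  by apply: integral_ge0 => z _; rewrite lee_fin mulr_ge0 ?sqr_ge0 ?weight_ge0.
by rewrite -(sqr_sqrte x0) EFin_expe lee_sqr// sqrte_ge0.
Qed.

Lemma weight_tail m M z : m < mu -> M <= z.2 ->
  weight P mu z <= expR (- ((mu - m) * M)) * weight P m z.
Proof.
move=> mmu Mz; rewrite /weight mulrCA ler_wpM2l ?powR_ge0// -expRD ler_expR.
have := ler_wpM2l (ltW (_ : 0 < mu - m)) Mz; rewrite subr_gt0 => /(_ mmu); lra.
Qed.

Lemma moment_tail (y w2 phi2 M e wm wmu : R) : 0 < y -> 0 <= M -> 0 <= w2 ->
  w2 <= phi2 -> 0 <= wm -> 0 <= wmu -> 0 <= e -> (M <= y -> wmu <= e * wm) ->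
  y * w2 * wmu <= M * (w2 * wmu) + e * ((1 + y) * phi2 * wm).
Proof.
move=> y0 M0 w0 wphi wm0 wmu0 e0 tail.
have A : 0 <= e * ((1 + y) * phi2 * wm).
  have phi0 : 0 <= phi2 := le_trans w0 wphi.
  have y1 : 0 <= 1 + y by rewrite addr_ge0// ltW.
  exact: (mulr_ge0 e0 (mulr_ge0 (mulr_ge0 y1 phi0) wm0)).
have [yM|My] := ltP y M.
  have h : y * (w2 * wmu) <= M * (w2 * wmu) by rewrite ler_wpM2r ?mulr_ge0// ltW.
  by rewrite -mulrA; apply: (le_trans h); rewrite lerDl.
apply: (@le_trans _ _ (e * ((1 + y) * phi2 * wm))); last by rewrite lerDr !mulr_ge0.
rewrite [leRHS](_ : _ = (1 + y) * phi2 * (e * wm)); last by ring.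
apply: ler_pM; [by rewrite mulr_ge0// ltW|by []| |exact: tail].
by apply: ler_pM => //; [exact: ltW|rewrite lerDr].
Qed.

(** Where y <= M the squared excess is controlled by the energy. Where y > M
    it is at most Phi^2, and Phi is bounded in the space with exponent m < mu,
    which gains the factor exp(- (mu - m) M). *)
Lemma excess_moment_bound m Phi u1 u2 c : 0 <= c -> m < mu ->
  Lp_time T +oo%E (L2w P m) (fun p => Num.sqrt (1 + p.2.2) * Phi p) ->
  ae_time T (fun t => inV P (slice u1 t)) -> ae_time T (fun t => inV P (slice u2 t)) ->
  ae_cylinder T (fun p => 0 <= u1 p <= Phi p) ->
  ae_cylinder T (fun p => 0 <= u2 p <= Phi p) ->
  exists B, 0 <= B /\ forall M, 0 <= M -> ae_time T (fun t =>
    wRint P (fun z => z.2 * pos (u1 (t, z) - u2 (t, z) - c) ^+ 2) <=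
    2 * M * energy P u1 u2 c t + B * expR (- ((mu - m) * M))).
Proof.
move=> c0 mmu bPhi V1 V2 /ae_cylinder_slices b1 /ae_cylinder_slices b2.
have [B [B0 hB]] := Lp_time_oo_bound bPhi; exists B; split => // M M0.
have [_ mPhi _] := bPhi.
have hV := ae_and V1 V2.
have hb := ae_and b1 b2.
have hP := ae_and mPhi hB.
apply: ae_imp2 (ae_and hV hb) hP.
move=> t [[hv1 hv2] [hb1 hb2]] [hp1 hp2] tI.
have v1 := hv1 tI; have v2 := hv2 tI; have {}b1 := hb1 tI; have {}b2 := hb2 tI.
have /L2wP[mphi iphi] := hp1 tI; have wphi := hp2 tI.
pose w z := pos (u1 (t, z) - u2 (t, z) - c).
have [vw _] := truncation_inV v1 v2 c0; rewrite -/w in vw.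
have iy : leb2.-integrable H (EFin \o (fun z => z.2 * w z ^+ 2 * weight P mu z)).
  exact: (winteg_y (inV_sqrty vw) (inV_sqrty vw)).
have iw : leb2.-integrable H (EFin \o (fun z => w z ^+ 2 * weight P mu z)).
  by have [/L2wP[]] := vw.
pose e := expR (- ((mu - m) * M)).
have e0 : 0 <= e by exact: expR_ge0.
have mH := measurable_halfplane (R := R).
have i1 := integrableZl mH M iw; have i2 := integrableZl mH e iphi.
have hle : \int[leb2]_(z in H) (z.2 * w z ^+ 2 * weight P mu z) <=
    \int[leb2]_(z in H) (M * (w z ^+ 2 * weight P mu z) +
      e * ((slice (fun p => Num.sqrt (1 + p.2.2) * Phi p) t z) ^+ 2 * weight P m z)).
  apply: (le_Rintegral_ae mH iy (integrableD mH i1 i2)).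
  apply: ae_imp2 b1 b2 => z h1 h2 Hz; have /andP[p1 q1] := h1 Hz; have /andP[p2 q2] := h2 Hz.
  have z0 : 0 < z.2 :> R := halfplane_gt0 Hz.
  have s0 : 0 <= 1 + z.2 :> R by rewrite addr_ge0// ltW.
  rewrite /slice exprMn sqr_sqrtr//.
  apply: moment_tail; rewrite ?sqr_ge0 ?weight_ge0//; last exact: weight_tail.
  rewrite lerXn2r ?nnegrE ?pos_ge0//; first exact: le_trans q1.
  rewrite /w; case: (pos_cases (u1 (t, z) - u2 (t, z) - c)) => -[_ [-> _]]; last exact: le_trans q1.
  by clear - c0 p2 q1; lra.
move: hle; rewrite (RintegralD mH i1 i2) (RintegralZl M mH iw) (RintegralZl e mH iphi).
have -> : \int[leb2]_(z in H) (w z ^+ 2 * weight P mu z) = 2 * energy P u1 u2 c t.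
  rewrite /energy /wRint -[RHS]RintegralZl//; last first.
    have := integrableZl mH 2^-1 iw; apply: eq_integrable => // z _ /=.
    by congr EFin; rewrite /posq -/(w z); ring.
  by apply: eq_Rintegral => z _; rewrite /posq -/(w z); field.
rewrite mulrCA mulrA => hle; apply: (le_trans hle); rewrite lerD2l [leRHS]mulrC ler_wpM2l//.
rewrite -lee_fin /Rintegral fineK//.
exact: (integrable_fin_num mH iphi).
Qed.

End ExcessEstimates.

Section Comparison.
Context {R : realType} (P : heston R).
Local Notation mR := (measurableTypeR R).
Local Notation H := (halfplane : set (mR * mR)).
Local Notation ST := (mR * (mR * mR))%type.
Local Notation mu := (Defs.mu P).
Local Notation T := (maturity P).
Implicit Types (u v psi Phi d : R * (R * R) -> R) (f g : R * R -> R) (c : R).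

(** Testing the two variational inequalities with u1 - w and u2 + w, where w is
    the positive part of u1 - u2 - c; both competitors lie above the respective
    obstacles. *)
Lemma power_lower_bound : admissible P -> exists K, 0 < K /\
  forall psi1 psi2 u1 u2 d1 d2 c, 0 <= c ->
  L2_time P (spV P) u1 -> L2_time P (spV P) u2 ->
  L2_time P (spH P) d1 -> L2_time P (spH P) d2 ->
  ae_cylinder T (fun p => psi1 p <= u1 p) -> ae_cylinder T (fun p => psi2 p <= u2 p) ->
  ae_cylinder T (fun p => psi1 p <= psi2 p + c) ->
  (forall v, L2_time P (spV P) v -> ae_cylinder T (fun p => psi1 p <= v p) ->
    ae_time T (fun t => let w := fun z => v (t, z) - u1 (t, z) in
      0 <= - dotH P (slice d1 t) w + form_a P (slice u1 t) w)) ->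
  (forall v, L2_time P (spV P) v -> ae_cylinder T (fun p => psi2 p <= v p) ->
    ae_time T (fun t => let w := fun z => v (t, z) - u2 (t, z) in
      0 <= - dotH P (slice d2 t) w + form_a P (slice u2 t) w)) ->
  ae_time T (fun t =>
    - K * wRint P (fun z => z.2 * pos (u1 (t, z) - u2 (t, z) - c) ^+ 2) <=
    power P u1 u2 d1 d2 c t).
Proof.
move=> /form_difference[K [K0 hK]]; exists K; split; first exact: K0.
move=> psi1 psi2 u1 u2 d1 d2 c c0 hu1 hu2 hd1 hd2 o1 o2 oc VI1 VI2.
have [mu1 V1 _] := hu1; have [mu2 V2 _] := hu2.
have [_ D1 _] := hd1; have [_ D2 _] := hd2.
pose w p := pos (u1 p - u2 p - c).
have mw : measurable_fun (cylinder T : set ST) w.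
  exact: (measurable_excess c (L2_time_VH hu1) (L2_time_VH hu2)).
have hv1 : L2_time P (spV P) (fun p => u1 p - w p).
  apply: (L2_time_V_dominated hu1 hu2 (measurable_funB mu1 mw)) => t t1 t2.
  by have [] := truncation_competitors t1 t2 c0.
have hv2 : L2_time P (spV P) (fun p => u2 p + w p).
  apply: (L2_time_V_dominated hu1 hu2 (measurable_funD mu2 mw)) => t t1 t2.
  by have [] := truncation_competitors t1 t2 c0.
have a1 : ae_cylinder T (fun p => psi1 p <= u1 p - w p).
  apply: ae_imp2 (ae_and o1 o2) oc => p [h1 h2] h3 Cp.
  have {}h1 := h1 Cp; have {}h2 := h2 Cp; have {}h3 := h3 Cp; rewrite /w.
  by case: (pos_cases (u1 p - u2 p - c)) => -[_ [-> _]]; lra.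
have a2 : ae_cylinder T (fun p => psi2 p <= u2 p + w p).
  apply: ae_imp o2 => p h Cp; apply: (le_trans (h Cp)).
  by rewrite lerDl pos_ge0.
have b1 := VI1 _ hv1 a1; have b2 := VI2 _ hv2 a2.
apply: ae_imp2 (ae_and b1 b2)
  (ae_and (ae_and V1 V2)
    (ae_and D1 D2)).
move=> t [h1 h2] [[v1 v2] [e1 e2]] tI.
have {}h1 := h1 tI; have {}h2 := h2 tI; cbv zeta in h1, h2.
apply: (hK _ _ _ _ _ (v1 tI) (v2 tI) (e1 tI) (e2 tI) c0).
- move: h1; rewrite (_ : (fun z => u1 (t, z) - w (t, z) - u1 (t, z)) = fun z => - w (t, z))//.
  by apply/funext => z; rewrite addrAC subrr sub0r.
- move: h2; rewrite (_ : (fun z => u2 (t, z) + w (t, z) - u2 (t, z)) = fun z => w (t, z))//.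
  by apply/funext => z; rewrite addrAC subrr add0r.
Qed.

Lemma wint_sqr_ge0 f : (0 <= wint P mu (fun z => f z ^+ 2)%R)%E.
Proof. by apply: integral_ge0 => z _; rewrite lee_fin mulr_ge0 ?sqr_ge0 ?weight_ge0. Qed.

Lemma cont_timeH_terminal u e : cont_timeH P u -> 0 < T -> 0 < e ->
  exists r, r < T /\ forall s, 0 < s -> r < s -> s < T ->
    (wint P mu (fun z => (u (s, z) - u (T, z)) ^+ 2)%R <= e%:E)%E.
Proof.
move=> [_ cu] T0 e0.
have TT : T \in `[0, T] by rewrite in_itv/= lexx ltW.
have ne : nbhs 0%E [set x : \bar R | (x < (Num.sqrt e)%:E)%E].
  apply: open_nbhs_nbhs; split; first exact: open_ereal_lt_ereal.
  by rewrite /= lte_fin sqrtr_gt0.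
have := cu T TT _ ne; rewrite /nbhs/= => /nbhs_ballP[r /= r0 hr].
exists (T - r); split; first by rewrite ltrBlDr ltrDl.
move=> s s0 rs sT; have sb : ball T r s.
  by rewrite /ball/= ger0_norm ?subr_ge0 ?ltW//; move: rs; rewrite ltrBlDr ltrBlDl.
have sI : `[0, T]%classic s by rewrite /= in_itv/= !ltW.
have := hr s sb sI => /= /ltW; rewrite -[X in (_ <= X)%E]/(sqrte e%:E) lee_sqrt//.
by rewrite lee_fin ltW.
Qed.

Lemma pos_diff_le (a1 a2 b1 b2 c : R) : pos (b1 - b2 - c) = 0 ->
  pos (a1 - a2 - c) ^+ 2 <= 2 * ((a1 - b1) ^+ 2 + (a2 - b2) ^+ 2).
Proof.
move=> hb; have h1 := sqr_ge0 (a1 - b1 + (a2 - b2)).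
have h2 := sqr_ge0 (a1 - b1); have h3 := sqr_ge0 (a2 - b2).
case: (pos_cases (b1 - b2 - c)) => -[b0 [eb _]]; first by move: b0; rewrite -eb hb ltxx.
case: (pos_cases (a1 - a2 - c)) => -[a0 [-> _]]; last by nra.
have : (a1 - a2 - c) ^+ 2 <= ((a1 - b1) - (a2 - b2)) ^+ 2.
  by rewrite lerXn2r ?nnegrE//; lra.
nra.
Qed.

Lemma wint_excess_le f1 f2 g1 g2 c : measurable_fun H f1 -> measurable_fun H f2 ->
  measurable_fun H g1 -> measurable_fun H g2 ->
  {ae leb2, forall z, halfplane z -> pos (g1 z - g2 z - c) = 0} ->
  (wint P mu (fun z => pos (f1 z - f2 z - c) ^+ 2)%R <=
   2%:E * (wint P mu (fun z => (f1 z - g1 z) ^+ 2)%R +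
     wint P mu (fun z => (f2 z - g2 z) ^+ 2)%R))%E.
Proof.
move=> mf1 mf2 mg1 mg2 g0.
have w0 (r : R) z : (0 <= (r ^+ 2 * weight P mu z)%:E)%E.
  by rewrite lee_fin mulr_ge0 ?sqr_ge0 ?weight_ge0.
have me f : measurable_fun H f -> measurable_fun H (fun z => (f z ^+ 2 * weight P mu z)%:E).
  move=> mf; apply/measurable_EFinP; apply: measurable_weighted.
  exact: (measurable_funX 2 mf).
have m1 := me _ (measurable_funB mf1 mg1); have m2 := me _ (measurable_funB mf2 mg2).
have mH := measurable_halfplane (R := R).
rewrite /wint -ge0_integralD//.
rewrite -ge0_integralZl//; last 2 first.
- exact: (emeasurable_funD m1 m2).
- by move=> z Hz; apply: adde_ge0; exact: w0.
apply: (ae_le_lower_integral_r mH).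
- exact: (measurable_funeM 2%:E (emeasurable_funD m1 m2)).
- by move=> z _; exact: w0.
- by move=> z _; apply: mule_ge0 => //; apply: adde_ge0; exact: w0.
apply: ae_imp g0 => z h Hz; rewrite -EFinD -EFinM lee_fin -mulrDl mulrA.
by rewrite ler_wpM2r ?weight_ge0//; apply: pos_diff_le; exact: h.
Qed.

Lemma wint_sqr_eq0 f : measurable_fun H f ->
  (forall e, 0 < e -> (wint P mu (fun z => f z ^+ 2)%R <= e%:E)%E) ->
  {ae leb2, forall z, halfplane z -> f z = 0}.
Proof.
move=> mf small; have mH := measurable_halfplane (R := R).
have h0 : (wint P mu (fun z => f z ^+ 2)%R = 0)%E.
  apply/eqP; rewrite eq_le wint_sqr_ge0 andbT; apply/lee_addgt0Pr => e e0.
  by rewrite add0e; exact: small.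
have mF : measurable_fun H (fun z => (f z ^+ 2 * weight P mu z)%:E).
  apply/measurable_EFinP; apply: measurable_weighted.
  exact: (measurable_funX 2 mf).
have : (\int[leb2]_(z in H) `|(f z ^+ 2 * weight P mu z)%R%:E| = 0)%E.
  rewrite -[RHS]h0; apply: eq_integral => z _.
  by rewrite gee0_abs// lee_fin mulr_ge0 ?sqr_ge0 ?weight_ge0.
move/(ae_eq_integral_abs leb2 mH mF); apply: ae_imp => z h Hz.
have := h Hz => /= -[] /eqP; rewrite mulf_eq0 sqrf_eq0 (gt_eqF (weight_gt0 P mu Hz)) orbF.
by move/eqP.
Qed.

(** The order of u1 and u2 + c is known at almost every time; continuity in H
    carries it to the time T. *)
Lemma terminal_excess u1 u2 c : 0 < T -> cont_timeH P u1 -> cont_timeH P u2 ->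
  ae_cylinder T (fun p => u1 p <= u2 p + c) ->
  {ae leb2, forall z, halfplane z -> pos (u1 (T, z) - u2 (T, z) - c) = 0}.
Proof.
move=> T0 cu1 cu2 /ae_cylinder_slices le12.
have mslice u t : cont_timeH P u -> t \in `[0, T] -> measurable_fun H (fun z => u (t, z)).
  by move=> [h _] tI; have [] := h t tI.
have TI : T \in `[0, T] by rewrite in_itv/= lexx ltW.
have m1 := mslice _ _ cu1 TI; have m2 := mslice _ _ cu2 TI.
apply: wint_sqr_eq0.
  apply: (measurableT_comp (@measurable_pos R)).
  by apply: measurable_funB; [exact: (measurable_funB m1 m2)|exact: measurable_cst].
move=> e e0; have e4 : 0 < e / 4 by rewrite divr_gt0.
have [r1 [r1T h1]] := cont_timeH_terminal cu1 T0 e4.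
have [r2 [r2T h2]] := cont_timeH_terminal cu2 T0 e4.
pose r := Num.max 0 (Num.max r1 r2).
have rT : r < T by rewrite !gt_max T0 r1T r2T.
have [r0 rr1 rr2] : [/\ 0 <= r, r1 <= r & r2 <= r].
  by rewrite !le_max !lexx !orbT.
have [s [sI hs]] : exists s, (s \in `]r, T[) /\
    {ae leb2, forall z, halfplane z -> u1 (s, z) <= u2 (s, z) + c}.
  apply: (ae_itv_inhabited rT); apply: ae_imp le12 => t h.
  by rewrite in_itv/= => /andP[a1 a2]; apply: h; rewrite in_itv/= (ltW a2) (le_trans r0 (ltW a1)).
have [rs sT] : r < s /\ s < T by move: sI; rewrite in_itv/= => /andP[].
have s0 : 0 < s := le_lt_trans r0 rs.
have sI' : s \in `[0, T] by rewrite in_itv/= !ltW.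
have k1 := h1 s s0 (le_lt_trans rr1 rs) sT; have k2 := h2 s s0 (le_lt_trans rr2 rs) sT.
have sym u : (wint P mu (fun z => (u (T, z) - u (s, z)) ^+ 2)%R =
    wint P mu (fun z => (u (s, z) - u (T, z)) ^+ 2)%R).
  by congr wint; apply/funext => z; rewrite -sqrrN opprB.
have p0 : {ae leb2, forall z, halfplane z -> pos (u1 (s, z) - u2 (s, z) - c) = 0}.
  apply: ae_imp hs => z h Hz; have {}h := h Hz.
  by case: (pos_cases (u1 (s, z) - u2 (s, z) - c)) => -[a0 [ea _]] //; move: a0; lra.
have := wint_excess_le m1 m2 (mslice _ _ cu1 sI') (mslice _ _ cu2 sI') p0.
rewrite !sym => k; apply: (le_trans k).
apply: (@le_trans _ _ (2%:E * ((e / 4)%:E + (e / 4)%:E))%E).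
  by rewrite lee_wpmul2l// leeD.
by rewrite -EFinD -EFinM lee_fin; lra.
Qed.

Lemma energyE u1 u2 c t : 0 <= c -> inH P (slice u1 t) -> inH P (slice u2 t) ->
  [/\ measurable_fun H (fun z => pos (u1 (t, z) - u2 (t, z) - c)),
    (wint P mu (fun z => pos (u1 (t, z) - u2 (t, z) - c) ^+ 2)%R < +oo)%E &
    wint P mu (fun z => pos (u1 (t, z) - u2 (t, z) - c) ^+ 2)%R =
    (2 * energy P u1 u2 c t)%:E].
Proof.
move=> c0 h1 h2; have [m1 _] := h1; have [m2 _] := h2.
have mw : measurable_fun H (fun z => pos (u1 (t, z) - u2 (t, z) - c)).
  apply: (measurableT_comp (@measurable_pos R)).
  by apply: measurable_funB; [exact: (measurable_funB m1 m2)|exact: measurable_cst].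
have hw : inH P (fun z => pos (u1 (t, z) - u2 (t, z) - c)).
  apply: (L2w_le2 mw _ h1 h2) => z _.
  by have [] := pos_diff_sqr (u1 (t, z)) (u2 (t, z)) c0.
have [_ fw] := hw; have /L2wP[_ iw] := hw.
split; [exact: mw|exact: fw|].
have mH := measurable_halfplane (R := R).
have -> : energy P u1 u2 c t = 2^-1 * wRint P (fun z => pos (u1 (t, z) - u2 (t, z) - c) ^+ 2).
  rewrite -(wRintZ 2^-1 iw); congr wRint; apply/funext => z.
  by rewrite /posq mulrC.
rewrite mulrA divff// mul1r /wRint /Rintegral fineK//.
exact: (integrable_fin_num mH iw).
Qed.

Lemma energy_vanishes u1 u2 c : 0 < T -> 0 <= c -> cont_timeH P u1 -> cont_timeH P u2 ->
  {ae leb2, forall z, halfplane z -> pos (u1 (T, z) - u2 (T, z) - c) = 0} ->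
  vanishes_before (energy P u1 u2 c) T.
Proof.
move=> T0 c0 cu1 cu2 p0 e e0; have e4 : 0 < e / 4 by rewrite divr_gt0.
have [r1 [r1T h1]] := cont_timeH_terminal cu1 T0 e4.
have [r2 [r2T h2]] := cont_timeH_terminal cu2 T0 e4.
exists (Num.max r1 r2); split; first by rewrite gt_max r1T r2T.
apply: aeW => s; rewrite in_itv/= gt_max => /andP[/andP[a1 a2] sT] s0.
have k1 := h1 s s0 a1 sT; have k2 := h2 s s0 a2 sT.
have TI : T \in `[0, T] by rewrite in_itv/= lexx ltW.
have sI : s \in `[0, T] by rewrite in_itv/= !ltW.
have [H1 _] := cu1; have [H2 _] := cu2.
have [_ _ E1] := energyE c0 (H1 s sI) (H2 s sI).
have [ms1 _] := H1 s sI; have [ms2 _] := H2 s sI.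
have [mt1 _] := H1 T TI; have [mt2 _] := H2 T TI.
have := wint_excess_le ms1 ms2 mt1 mt2 p0; rewrite E1 => k.
have : ((2 * energy P u1 u2 c s)%:E <= 2%:E * ((e / 4)%:E + (e / 4)%:E))%E.
  by apply: (le_trans k); rewrite lee_wpmul2l// leeD.
by rewrite -EFinD -EFinM lee_fin; lra.
Qed.

End Comparison.

(** * Comparison *)

Section Conclusion.
Context {R : realType} (P : heston R).
Local Notation leb := (@lebesgue_measure R).
Local Notation mR := (measurableTypeR R).
Local Notation ST := (mR * (mR * mR))%type.
Local Notation mu := (Defs.mu P).
Local Notation T := (maturity P).

Lemma energy_ge0 u1 u2 (c t : R) : 0 <= energy P u1 u2 c t.
Proof.
apply: Rintegral_ge0 => z _; rewrite mulr_ge0 ?weight_ge0//.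
by rewrite divr_ge0 ?sqr_ge0.
Qed.

(** The order of the obstacles up to a constant passes to the solutions: c = 0
    is the comparison principle, and two uses with c the distance of the
    obstacles give the bound on the distance of the solutions. *)
Theorem comparison_up_to_constant (Phi psi1 psi2 u1 u2 : R * (R * R) -> R) (c : R) :
  admissible P -> assumption_H2 P Phi -> cont_timeH P psi1 -> cont_timeH P psi2 ->
  solution_VI P Phi psi1 u1 -> solution_VI P Phi psi2 u2 -> 0 <= c ->
  ae_cylinder T (fun p => psi1 p <= psi2 p + c) ->
  ae_cylinder T (fun p => u1 p <= u2 p + c).
Proof.
move=> hP [_ _ _ [m [/andP[m0 mmu] bPhi]]] cpsi1 cpsi2.
move=> [[cu1 V1] o1 t1 b1 [d1 [td1 hd1 VI1]]] [[cu2 V2] o2 t2 b2 [d2 [td2 hd2 VI2]]] c0 oc.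
have T0 : 0 < T by have [_ []] := hP.
have [K [K0 hK]] := power_lower_bound hP.
have pw := hK _ _ _ _ _ _ _ c0 V1 V2 hd1 hd2 o1 o2 oc VI1 VI2.
have [_ sV1 _] := V1; have [_ sV2 _] := V2.
have [B [B0 hB]] := excess_moment_bound c0 mmu bPhi sV1 sV2 b1 b2.
have uT : {ae leb2, forall z, halfplane z -> pos (u1 (T, z) - u2 (T, z) - c) = 0}.
  apply: ae_imp2 (terminal_excess T0 cpsi1 cpsi2 oc) (ae_and t1 t2).
  by move=> z h [e1 e2] Hz; rewrite e1// e2//; exact: h.
have h1 := L2_time_VH V1; have h2 := L2_time_VH V2.
have zero : {ae leb, forall s : mR, s \in `]0, T[ -> energy P u1 u2 c s <= 0}.
  apply: (@backward_uniqueness R _ (power P u1 u2 d1 d2 c) T K B (mu - m) K0 B0 _ (energy_ge0 _ _ _)).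
  - by rewrite subr_gt0.
  - by move=> a b a0 ab bT; exact: (energy_identity c0 h1 h2 hd1 hd2 td1 td2 a0 ab bT).
  - move=> M M0; apply: ae_imp2 pw (hB M M0) => s hp hb; rewrite in_itv/= => /andP[s0 sT].
    have sI : s \in `[0, T] by rewrite in_itv/= !ltW.
    apply: le_trans (hp sI); rewrite mulNr lerN2 ler_wpM2l ?(ltW K0)//.
    exact: hb.
  - exact: energy_vanishes.
have zero_slices : {ae leb, forall s : mR, s \in `[0, T] ->
    {ae leb2, forall z, halfplane z -> pos (u1 (s, z) - u2 (s, z) - c) = 0}}.
  apply: ae_itv_oo; apply: ae_imp zero => s hs sI.
  have sI' : s \in `[0, T] by apply: subset_itv_oo_cc.
  have [H1 _] := cu1; have [H2 _] := cu2.
  have [mw _ E] := energyE c0 (H1 s sI') (H2 s sI').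
  apply: (wint_sqr_eq0 mw) => e e0.
  apply: (@le_trans _ _ (2 * energy P u1 u2 c s)%:E); first by rewrite -E.
  by rewrite lee_fin; apply: le_trans (ltW e0); have := hs sI; lra.
pose A : set ST := [set p | cylinder T p -> u1 p <= u2 p + c].
have mA : measurable A.
  have [m1 _ _] := h1; have [m2 _ _] := h2.
  have mw := measurable_excess c h1 h2.
  have : measurable ((cylinder T : set ST) `&` (fun p => pos (u1 p - u2 p - c)) @^-1` `]0, +oo[%classic).
    by apply: (mw (measurable_cylinder T)); exact: measurable_itv.
  move/measurableC; congr measurable; apply/seteqP; split=> p /= hp.
    move=> Cp; rewrite leNgt; apply/negP => lt; apply: hp; split => //.
    rewrite in_itv/= andbT; case: (pos_cases (u1 p - u2 p - c)) => -[h [-> _]] //; lra.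
  move=> [Cp]; rewrite in_itv/= andbT; have := hp Cp.
  by case: (pos_cases (u1 p - u2 p - c)) => -[h [-> _]] //; [move: h; lra|rewrite ltxx].
apply: (@product_ae1 _ _ mR (mR * mR)%type R leb leb2 A mA).
apply: ae_imp zero_slices => t ht.
have [tI|tI] := boolP (t \in `[0, T]); last first.
  by apply: aeW => z [/= tI' _]; rewrite tI' in tI.
apply: ae_imp (ht tI) => z h [_ Hz]; have {h} := h Hz.
by case: (pos_cases (u1 (t, z) - u2 (t, z) - c)) => -[h [-> _]]; move: h; lra.
Qed.

Lemma norm_oo_bound (f : R * (R * R) -> R) : Linfty T f -> exists c,
  [/\ 0 <= c, norm_oo T f = c%:E & ae_cylinder T (fun p => `|f p| <= c)].
Proof.
move=> [mf nf]; pose c := fine (norm_oo T f).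
have n0 : (0 <= norm_oo T f)%E by exact: Lnorm_ge0.
have cE : norm_oo T f = c%:E by rewrite /c fineK// ge0_fin_numE.
exists c; split; [by rewrite -lee_fin -cE|exact: cE|].
have h := ae_le_Lnorm_oo leb3 ((EFin \o f) \_ (cylinder T)).
apply: ae_imp h => p; rewrite -/(norm_oo T f) cE patchE => h Cp.
by move: h; rewrite mem_set.
Qed.

Lemma norm_oo_le (f : R * (R * R) -> R) (c : R) : 0 <= c ->
  ae_cylinder T (fun p => `|f p| <= c) -> (norm_oo T f <= c%:E)%E.
Proof.
move=> c0 h; apply: Lnorm_oo_le; first by rewrite lee_fin.
apply: ae_imp h => p hp; rewrite patchE; case: ifPn => [/set_mem/hp //|_].
by rewrite abse0 lee_fin.
Qed.

End Conclusion.

Theorem proposition3p15 (R : realType) (P : heston R) (hP : admissible P)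
  (Phi psi1 psi2 u1 u2 : R * (R * R) -> R)
  (hPhi : assumption_H2 P Phi)
  (hpsi1 : assumption_H1 P psi1) (hpsi2 : assumption_H1 P psi2)
  (le_psi1 : ae_cylinder (maturity P) (fun p => 0 <= psi1 p <= Phi p))
  (le_psi2 : ae_cylinder (maturity P) (fun p => 0 <= psi2 p <= Phi p))
  (hu1 : solution_VI P Phi psi1 u1) (hu2 : solution_VI P Phi psi2 u2) :
  (ae_cylinder (maturity P) (fun p => psi1 p <= psi2 p) ->
   ae_cylinder (maturity P) (fun p => u1 p <= u2 p)) /\
  (Linfty (maturity P) (fun p => psi1 p - psi2 p) ->
   Linfty (maturity P) (fun p => u1 p - u2 p) /\
   (norm_oo (maturity P) (fun p => u1 p - u2 p)%R <=
    norm_oo (maturity P) (fun p => psi1 p - psi2 p)%R)%E).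
Proof.
have [c1 _ _ _] := hpsi1; have [c2 _ _ _] := hpsi2.
split=> [le12|psib].
  have le12' : ae_cylinder (maturity P) (fun p => psi1 p <= psi2 p + 0).
    by apply: ae_imp le12 => p h Cp; rewrite addr0; exact: h.
  have := comparison_up_to_constant hP hPhi c1 c2 hu1 hu2 (lexx 0) le12'.
  by apply: ae_imp => p h Cp; rewrite -[leRHS]addr0; exact: h.
have [c [c0 cE hc]] := norm_oo_bound psib.
have le12 : ae_cylinder (maturity P) (fun p => psi1 p <= psi2 p + c).
  by apply: ae_imp hc => p h Cp; have := h Cp; rewrite ler_norml => /andP[]; lra.
have le21 : ae_cylinder (maturity P) (fun p => psi2 p <= psi1 p + c).
  by apply: ae_imp hc => p h Cp; have := h Cp; rewrite ler_norml => /andP[]; lra.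
have k12 := comparison_up_to_constant hP hPhi c1 c2 hu1 hu2 c0 le12.
have k21 := comparison_up_to_constant hP hPhi c2 c1 hu2 hu1 c0 le21.
have ub : (norm_oo (maturity P) (fun p => u1 p - u2 p)%R <= c%:E)%E.
  apply: (norm_oo_le c0); apply: ae_imp2 k12 k21 => p h1 h2 Cp.
  by have := h1 Cp; have := h2 Cp; rewrite ler_norml; lra.
rewrite cE; split; last exact: ub.
have [[_ [mu1 _ _]] _ _ _ _] := hu1; have [[_ [mu2 _ _]] _ _ _ _] := hu2.
by split; [exact: (measurable_funB mu1 mu2)|exact: (le_lt_trans ub (ltry c))].
Qed.
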